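(* Let $c\in\mathbb R$ and assume that $f\in\mathbb L^2_{\mathbb R_+}(x^{2c-1})$, $\Psi\,\mathcal M_c[f]\in\mathbb L^1_{\mathbb R}$, $\mathbb E_{f_Y}(Y_1^{8(c-1)})<\infty$ and $\|g\|_{\infty,x^{2c-1}}<\infty$. Then for $\chi\ge72$ (a fixed numerical constant), $$\mathbb E^n_{f_Y}\big((\vartheta(f)-\widehat\vartheta_{\widehat k})^2\big)\le C_1\inf_{k\in\mathcal K_n}\Big(\big\|\mathbf 1_{[k,\infty)}\Psi\,\mathcal M_c[f]\big\|^2_{\mathbb L^1_{\mathbb R}}+V(k)\Big)+\frac{C_2}{n},$$ where $C_1$ is a positive numerical constant and $C_2$ is a positive constant depending on $\Psi$, $g$ and $\mathbb E_{f_Y}(Y_1^{8(c-1)})$ (and not on $n$).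
   Context: Notation: $\mathbb R_+=(0,\infty)$. For $p\ge1$ and $a\in\mathbb R$, $\mathbb L^p_{\mathbb R_+}(x^a)$ is the space of measurable $h:\mathbb R_+\to\mathbb C$ with $\int_0^\infty|h(x)|^px^a\,dx<\infty$; $\mathbb L^p_{\mathbb R}$ is the usual (unweighted) space on $\mathbb R$. $\|g\|_{\infty,x^{2c-1}}$ is the essential supremum over $x\in\mathbb R_+$ of $x^{2c-1}g(x)$. $(a)_+=\max(a,0)$. Model: $X$ and $U$ are independent positive random variables with Lebesgue densities $f$ and $g$ on $\mathbb R_+$, $g$ known. $Y=XU$ has density $f_Y(y)=\int_0^\infty f(x)g(y/x)x^{-1}dx$. One observes i.i.d. $Y_1,\dots,Y_n$ with density $f_Y$. $\mathbb E^n_{f_Y}$ is expectation with respect to the law of $(Y_1,\dots,Y_n)$, $\mathbb E_{f_Y}=\mathbb E^1_{f_Y}$, and $\mathbb E_f$ denotes expectation when $X_1$ has density $f$; $U_1$ has density $g$. Mellin transform: for $h\in\mathbb L^1_{\mathbb R_+}(x^{c-1})$, $\mathcal M_c[h](t)=\int_0^\infty x^{c-1+it}h(x)\,dx$, $t\in\mathbb R$. Standing assumptions: $f,g\in\mathbb L^1_{\mathbb R_+}(x^{c-1})$; $\mathcal M_c[g](t)\ne0$ for all $t\in\mathbb R$; $\Psi:\mathbb R\to\mathbb C$ is a known measurable function with $\overline{\Psi(t)}=\Psi(-t)$ for all $t$, and $\Psi/\mathcal M_c[g]$ is integrable on $[-k,k]$ for each $k\in\mathbb R_+$. Linear functional and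 spectral cut-off estimators: $$\vartheta(f)=\frac1{2\pi}\int_{-\infty}^\infty\Psi(-t)\mathcal M_c[f](t)\,dt,\qquad \widehat\vartheta_k=\frac1{2\pi}\int_{-k}^k\Psi(-t)\frac{\widehat{\mathcal M}_c(t)}{\mathcal M_c[g](t)}\,dt,\qquad \widehat{\mathcal M}_c(t)=\frac1n\sum_{j=1}^nY_j^{c-1+it},$$ and $\Delta_{\Psi,g}(k)=\frac1{2\pi}\int_{-k}^k|\Psi(t)/\mathcal M_c[g](t)|^2dt$. Data-driven choice of $k$: let $n\ge2$ be such that $$\mathcal K_n:=\{k\in\mathbb N:\ \|g\|_{\infty,x^{2c-1}}\Delta_{\Psi,g}(k)\le n,\ k\le n^{1/2}(\log n)^{-2}\}$$ is nonempty, and put $K_n=\max\mathcal K_n$. Let $\sigma=\mathbb E_f(X_1^{2(c-1)})$, $\widehat\sigma=\frac1n\sum_{j=1}^n\frac{Y_j^{2(c-1)}}{\mathbb E(U_1^{2(c-1)})}$, and for $k\in\mathcal K_n$ $$V(k)=\chi\|g\|_{\infty,x^{2c-1}}\,\sigma\,\Delta_{\Psi,g}(k)\frac{\log n}{n},\qquad \widehat V(k)=2\chi\|g\|_{\infty,x^{2c-1}}\,\widehat\sigma\,\Delta_{\Psi,g}(k)\frac{\log n}{n},$$ $$\widehat A(k)=\sup_{k'\in(k,K_n]\cap\mathbb N}\big((\widehat\vartheta_{k'}-\widehat\vartheta_k)^2-\widehat V(k')\big)_+$$ (a supremum over the empty set being $0$), and $$\widehat k\in\operatorname*{arg\,min}_{k\in\mathcal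 K_n}\big(\widehat A(k)+\widehat V(k)\big).$$
   Formalization: The constant C_2 may also depend on σ = E_f(X_1^{2(c-1)}) (and on c, χ), not only on Ψ, g and E(Y_1^{8(c-1)}); with the stated dependence alone the bound fails when σ tends to 0 with n while E(Y_1^{8(c-1)}) stays fixed. *)

(* Defs.v *)
From HB Require Import structures.
From mathcomp Require Import all_boot all_order all_algebra.
From mathcomp Require Import all_classical all_reals all_analysis.
From mathcomp Require Import ess_sup_inf.
From mathcomp Require Export complex.

Set Implicit Arguments.
Unset Strict Implicit.
Unset Printing Implicit Defensive.

Import Order.TTheory GRing.Theory Num.Theory.
Import numFieldNormedType.Exports.

Local Open Scope classical_set_scope.
Local Open Scope ring_scope.
Local Open Scope complex_scope.

Section ComplexIntegration.
Context {R : realType}.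
Implicit Types (D : set R) (F : R -> R[i]).

Local Notation mu := (@lebesgue_measure R).

(* The library integrates only real and extended-real functions, so
   complex-valued ones are handled through their real and imaginary parts. *)
Definition cmeasurable D F : Prop :=
  measurable_fun D (fun t => complex.Re (F t)) /\
  measurable_fun D (fun t => complex.Im (F t)).

Definition cintegrable D F : Prop :=
  mu.-integrable D (fun t => (complex.Re (F t))%:E) /\
  mu.-integrable D (fun t => (complex.Im (F t))%:E).

Definition cintegral D F : R[i] :=
  (\int[mu]_(t in D) complex.Re (F t)) +i*
  (\int[mu]_(t in D) complex.Im (F t)).

End ComplexIntegration.

Section Model.
Context {R : realType}.
Implicit Types (a c k p t chi : R) (f g h : R -> R) (Psi : R -> R[i]).

Local Notation mu := (@lebesgue_measure R).

Definition Rpos : set R := `]0, +oo[.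

Lemma measurable_Rpos : measurable Rpos.
Proof. exact: measurable_itv. Qed.

(* h is in L^p_{R_+}(x^a) *)
Definition in_Lp p a h : Prop :=
  measurable_fun Rpos h /\
  (\int[mu]_(x in Rpos) (`|h x| `^ p * x `^ a)%:E < +oo)%E.

Definition is_density h : Prop :=
  [/\ measurable_fun Rpos h,
      forall x, 0 < x -> 0 <= h x
    & (\int[mu]_(x in Rpos) (h x)%:E = 1)%E].

(* E(X^a) for a positive X with density h *)
Definition moment a h : \bar R :=
  (\int[mu]_(x in Rpos) (x `^ a * h x)%:E)%E.

(* Density of Y = X U; extended-real since the integral may be infinite on a
   null set. *)
Definition dens_Y f g (y : R) : \bar R :=
  (\int[mu]_(x in Rpos) (f x * g (y / x) * x^-1)%:E)%E.

Definition moment_Y a f g : \bar R :=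
  (\int[mu]_(y in Rpos) ((y `^ a)%:E * dens_Y f g y))%E.

(* x^(c-1+it) = x^(c-1) exp(i t ln x), for x > 0 *)
Definition mellin_kernel c t (x : R) : R[i] :=
  (x `^ (c - 1) * cos (t * ln x)) +i* (x `^ (c - 1) * sin (t * ln x)).

Definition mellin c h t : R[i] :=
  cintegral Rpos (fun x => mellin_kernel c t x * (h x)%:C).

(* ess sup over x > 0 of x^(2c-1) g(x) *)
Definition wsup c g : \bar R :=
  ess_sup (mrestr mu measurable_Rpos) (fun x => (x `^ (2 * c - 1) * g x)%:E).

Definition theta c Psi f : R[i] :=
  ((2 * pi)^-1)%:C * cintegral setT (fun t => Psi (- t) * mellin c f t).

(* May be +oo: Psi / M_c[g] is only assumed to be locally integrable. *)
Definition Delta c Psi g k : \bar R :=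
  (((2 * pi)^-1)%:E *
   \int[mu]_(t in `[(- k)%R, k]) (Normc.normc (Psi t / mellin c g t) ^+ 2)%:E)%E.

(* || 1_[k,oo) Psi M_c[f] ||_{L^1_R} *)
Definition tail_norm c Psi f k : \bar R :=
  (\int[mu]_(t in `[k, +oo[) (Normc.normc (Psi t * mellin c f t))%:E)%E.

(* The index set K_n, with indices k = 1, 2, ... *)
Definition index_set c Psi g (n : nat) : set nat :=
  [set k : nat | [/\ (0 < k)%N,
     (wsup c g * Delta c Psi g k%:R <= (n%:R)%:E)%E
   & k%:R <= Num.sqrt (n%:R : R) / (ln n%:R) ^+ 2]].

Definition sigma c f : R := fine (moment (2 * (c - 1)) f).

(* V and Vhat are only used at indices of K_n, where Delta is finite. *)
Definition V c chi Psi f g (n k : nat) : R :=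
  chi * fine (wsup c g) * sigma c f * fine (Delta c Psi g k%:R)
  * (ln n%:R / n%:R).

Section Estimators.
Variables (n : nat) (y : 'I_n -> R).

Definition mellin_hat c t : R[i] :=
  (n%:R)^-1 * \sum_(j < n) mellin_kernel c t (y j).

Definition theta_hat c Psi g k : R[i] :=
  ((2 * pi)^-1)%:C *
  cintegral `[- k, k] (fun t => Psi (- t) * (mellin_hat c t / mellin c g t)).

Definition sigma_hat c g : R :=
  (n%:R)^-1 *
  \sum_(j < n) (y j `^ (2 * (c - 1)) / fine (moment (2 * (c - 1)) g)).

Definition Vhat c chi Psi g (k : nat) : R :=
  2 * chi * fine (wsup c g) * sigma_hat c g * fine (Delta c Psi g k%:R)
  * (ln n%:R / n%:R).

(* theta_hat takes real values, because Psi (- t) and Psi t are conjugate; the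
   square of a difference is written as the squared modulus. *)
Definition Ahat c chi Psi g (Kn k : nat) : R :=
  \big[Num.max/0]_(k.+1 <= l < Kn.+1)
    Num.max
      (Normc.normc (theta_hat c Psi g l%:R - theta_hat c Psi g k%:R) ^+ 2
       - Vhat c chi Psi g l) 0.

Definition is_argmin c chi Psi g (Kn k : nat) : Prop :=
  index_set c Psi g n k /\
  forall l, index_set c Psi g n l ->
    Ahat c chi Psi g Kn k + Vhat c chi Psi g k <=
    Ahat c chi Psi g Kn l + Vhat c chi Psi g l.

End Estimators.

End Model.

Section Sampling.
Context d (T : measurableType d) (R : realType) (P : probability T R).
Context (n : nat).
Implicit Type Y : 'I_n -> {RV P >-> R}.

Definition mutually_independent Y : Prop :=
  forall (J : {set 'I_n}) (A : 'I_n -> set R),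
    (forall j, measurable (A j)) ->
    P (\bigcap_(j in [set` J]) (Y j @^-1` A j)) =
    (\prod_(j in J) P (Y j @^-1` A j))%E.

(* Y_1, ..., Y_n are i.i.d. with density h on (0, oo). *)
Definition iid_with_density Y (h : R -> \bar R) : Prop :=
  mutually_independent Y /\
  forall j (A : set R), measurable A ->
    distribution P (Y j) A =
    (\int[@lebesgue_measure R]_(y in A `&` Rpos) h y)%E.

End Sampling.

(* Main.v *)
(** Since [Psi (- t)] and [Psi t] are conjugate, the estimator with cut-off [k] is
    the empirical mean of a real kernel [h_k (Y_j)], where [h_k y] is [y `^ (c - 1)]
    times a truncated Fourier integral of [Psi / M_c[g]] evaluated at [ln y]. The
    mean of [h_k (Y_1)] is the functional restricted to [[-k, k]], so the bias is at
    most the tail norm. Bessel's inequality at the nodes [u + m pi / k] bounds [h_k]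
    pointwise, and summing it over the blocks of [(0, oo)] cut at the powers of
    [exp (pi / k)] gives the Plancherel-type bound [||g|| sigma Delta k] for the
    second moment of [h_k (Y_1)].

    Truncating the observations at a level of order [sqrt n ln n], a Bernstein-type
    bound makes the squared stochastic error exceed [6 ||g|| sigma Delta k ln n / n]
    by [O (n ^ (-3/2))] in mean. There are at most [O (sqrt n)] indices, so even the
    sum of these excesses is [O (1 / n)]; the truncated part is controlled by the
    moment of order [8 (c - 1)], and the event [sigma_hat < sigma / 2] is
    exponentially unlikely. A deterministic comparison of the Goldenshluger-Lepski
    type criterion at the selected and at any other index then gives the oracle
    inequality. *)

Require Import Defs.
From mathcomp Require Import all_boot all_order all_algebra.
From mathcomp Require Import all_classical all_reals all_analysis.
From mathcomp Require Import ess_sup_inf measurable_realfun.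
From mathcomp Require Import ring lra.

Set Implicit Arguments.
Unset Strict Implicit.
Unset Printing Implicit Defensive.

Import Order.TTheory GRing.Theory Num.Theory.
Import numFieldNormedType.Exports.

Local Open Scope classical_set_scope.
Local Open Scope ring_scope.

(** * Change of variables *)

(** The selected index is random, so the fluctuations must be controlled at all indices at once;
    this fixes the constants. At the scale [x ^+ 2 = 6 v L / n], with [v = G sigma Delta k] and
    [L = ln n], the exponent [n x ^+ 2 / (4 v)] equals [3/2 L], just enough to leave [1 / n] after
    summation over the indices. Splitting off the truncated part doubles 6 to 12. Comparing two
    estimators adds two deviations under a factor 3, so each may spend only a sixth of the penalty:
    [72 = 6 * 12]. The two constraints on an index act separately. The bound [k <= sqrt n / L ^+ 2]
    keeps the Bernstein condition valid at a truncation level as high as [sqrt n L]; the bound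
    [G Delta k <= n] keeps the prefactors of the exponentials bounded. Together they give
    [k Delta k] the order [n ^ (3/2)] at most. Against this, the part beyond the level has a second
    moment of order [level ^- 3], divided by [n] on averaging: the order 8 is 2 for the square plus
    6 for these three powers of the squared observation. *)

Section Transfer.
Context d1 d2 d (T1 : measurableType d1) (T2 : measurableType d2)
  (S : measurableType d) (R : realType).
Variables (m1 : {measure set T1 -> \bar R}) (m2 : {measure set T2 -> \bar R}).
Variables (W1 : T1 -> R) (W2 : T2 -> R) (X1 : T1 -> S) (X2 : T2 -> S).
Hypothesis mW1 : measurable_fun setT W1.
Hypothesis mW2 : measurable_fun setT W2.
Hypothesis mX1 : measurable_fun setT X1.
Hypothesis mX2 : measurable_fun setT X2.
Hypothesis W1_ge0 : forall x, 0 <= W1 x.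
Hypothesis W2_ge0 : forall x, 0 <= W2 x.

Import HBNNSimple.
Local Open Scope ereal_scope.

(** Decomposing a simple function along its level sets reduces its weighted integral to the
    indicators covered by [agree]. *)
Let simple d' (T : measurableType d') (m : {measure set T -> \bar R})
    (W : T -> R) (X : T -> S) (f : {nnsfun S >-> R}) :
  measurable_fun setT W -> measurable_fun setT X -> (forall x, 0 <= W x)%R ->
  \int[m]_x (W x * f (X x))%:E =
  \sum_(r \in range f) (r%:E * \int[m]_x (W x * \1_(f @^-1` [set r]) (X x))%:E).
Proof.
move=> mW mX W0.
have mi r : measurable_fun setT (fun x => \1_(f @^-1` [set r]) (X x) : R).
  by apply: (measurableT_comp _ mX) => //; exact: measurable_indic.
transitivity (\int[m]_x (\sum_(r \in range f)
    (r * (W x * \1_(f @^-1` [set r]) (X x)))%:E)).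
  apply: eq_integral => x _; rewrite fsumEFin//; congr EFin.
  rewrite {1}fimfunE mulr_fsumr.
  by apply: eq_fsbigr => r _; rewrite mulrCA.
(* A negative [r] is harmless: its level set is empty because [f] is nonnegative. *)
have nn r x : 0 <= (r * (W x * \1_(f @^-1` [set r]) (X x)))%:E.
  rewrite lee_fin indicE; case: (boolP (_ \in _)); last by rewrite !mulr0.
  by rewrite inE /= => <-; rewrite mulr1 mulr_ge0.
rewrite ge0_integral_fsum//; last first.
  by move=> r; apply/measurable_EFinP; do 2 apply: measurable_funM => //.
apply: eq_fsbigr => r /set_mem[y _ fyr].
rewrite -ge0_integralZl_EFin//.
- by move=> x _; rewrite lee_fin mulr_ge0.
- by apply/measurable_EFinP; exact: measurable_funM.
- by rewrite -fyr.
Qed.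

Let limit d' (T : measurableType d') (m : {measure set T -> \bar R})
    (W : T -> R) (X : T -> S) (phi : S -> R) (mphi : measurable_fun setT (EFin \o phi)) :
  (forall y, 0 <= phi y)%R ->
  measurable_fun setT W -> measurable_fun setT X -> (forall x, 0 <= W x)%R ->
  \int[m]_x (W x * phi (X x))%:E =
  limn (fun n => \int[m]_x (W x * nnsfun_approx measurableT mphi n (X x))%:E).
Proof.
move=> phi0 mW mX W0.
rewrite -monotone_convergence//.
- apply: eq_integral => x _; apply/esym/cvg_lim => //.
  under eq_fun do rewrite EFinM.
  rewrite EFinM; apply: cvgeZl => //.
  apply: (@cvg_nnsfun_approx _ _ _ _ measurableT _ mphi) => //.
  by move=> y _; rewrite lee_fin.
- move=> n; apply/measurable_EFinP; apply: measurable_funM => //.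
  exact: measurableT_comp.
- by move=> n x _; rewrite lee_fin mulr_ge0.
- move=> x _ i j ij; rewrite lee_fin ler_wpM2l//.
  exact/lefP/nd_nnsfun_approx.
Qed.

Hypothesis agree : forall A, measurable A ->
  \int[m1]_x (W1 x * \1_A (X1 x))%:E = \int[m2]_x (W2 x * \1_A (X2 x))%:E.

Lemma ge0_weighted_transfer (phi : S -> R) : measurable_fun setT phi ->
  (forall y, 0 <= phi y)%R ->
  \int[m1]_x (W1 x * phi (X1 x))%:E = \int[m2]_x (W2 x * phi (X2 x))%:E.
Proof.
move=> mphi phi0.
have mphi' : measurable_fun setT (EFin \o phi) by exact/measurable_EFinP.
rewrite !(limit _ mphi')//; congr (limn _); apply/funext => n.
by rewrite !simple//; apply: eq_fsbigr => r _; rewrite agree.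
Qed.

(* Several changes of measure are instances: scaling and reflection of Lebesgue
   measure, the law of [X * U], and the replacement of one factor of a product of
   independent variables by its mean. *)
Lemma weighted_transfer (phi : S -> R) : measurable_fun setT phi ->
  \int[m1]_x (W1 x * phi (X1 x))%:E = \int[m2]_x (W2 x * phi (X2 x))%:E.
Proof.
move=> mphi.
(* A nonnegative weight factors out of the positive and negative parts, so the identity follows from
   the nonnegative case applied to both parts of [phi]. *)
have pos d' (T : measurableType d') (W : T -> R) (X : T -> S) :
    (forall x, 0 <= W x)%R ->
    (fun x => (W x * phi (X x))%:E)^\+ = (fun x => (W x * (phi^\+ (X x))%R)%:E).
  move=> W0; apply/funext => x; rewrite funeposE /funrpos.
  by rewrite -EFin_max maxr_pMr// mulr0.
have neg d' (T : measurableType d') (W : T -> R) (X : T -> S) :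
    (forall x, 0 <= W x)%R ->
    (fun x => (W x * phi (X x))%:E)^\- = (fun x => (W x * (phi^\- (X x))%R)%:E).
  move=> W0; apply/funext => x; rewrite funenegE /funrneg.
  by rewrite -EFinN -EFin_max maxr_pMr// mulr0 mulrN.
rewrite integralE [RHS]integralE !pos// !neg//.
rewrite (ge0_weighted_transfer (measurable_funrpos mphi) (@funrpos_ge0 _ _ _)).
by rewrite (ge0_weighted_transfer (measurable_funrneg mphi) (@funrneg_ge0 _ _ _)).
Qed.

End Transfer.

Section LebesgueChange.
Context {R : realType}.
Local Notation mu := (@lebesgue_measure R).

(** The number [r] is the Jacobian: 1 for the reflection, the factor itself for a dilation. *)
Lemma lebesgue_transfer (r : R) (X : measurableTypeR R -> measurableTypeR R)
    (phi : R -> R) : 0 <= r -> measurable_fun setT X ->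
  (forall A : set (measurableTypeR R), measurable A ->
    (r%:E * mu (X @^-1` A) = mu A)%E) ->
  measurable_fun setT phi ->
  (\int[mu]_t (r * phi (X t))%:E = \int[mu]_t (phi t)%:E)%E.
Proof.
move=> r0 mX HA mphi.
have tr := @weighted_transfer _ _ _ (measurableTypeR R) (measurableTypeR R)
  (measurableTypeR R) R mu mu (cst r) (cst 1) X id
  (measurable_cst _) (measurable_cst _) mX (@measurable_id _ _ _)
  (fun=> r0) (fun=> ler01).
transitivity (\int[mu]_x (1 * phi x)%:E)%E; last first.
  by apply: eq_integral => x _; rewrite mul1r.
apply: (tr _ phi mphi) => A mA.
have mA' : measurable (X @^-1` A) by rewrite -[_ @^-1` _]setTI; exact: mX.
transitivity (\int[mu]_x (r%:E * (\1_(X @^-1` A) x)%:E)%E)%E.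
  by apply: eq_integral => x _; rewrite EFinM.
rewrite ge0_integralZl_EFin//; last first.
  by apply/measurable_EFinP; exact: measurable_indic.
rewrite integral_indic// setIT HA//.
under eq_integral do rewrite mul1r.
by rewrite integral_indic// setIT.
Qed.

Lemma integral_reflect (phi : R -> R) : measurable_fun setT phi ->
  (\int[mu]_t (phi (- t))%:E = \int[mu]_t (phi t)%:E)%E.
Proof.
move=> mphi.
rewrite -[RHS](@lebesgue_transfer 1 (-%R : measurableTypeR R -> measurableTypeR R))//.
  by under [RHS]eq_integral do rewrite mul1r.
by move=> A mA; rewrite mul1e; exact: lebesgue_measureN.
Qed.

Lemma integral_scale (x : R) (phi : R -> R) : 0 < x -> measurable_fun setT phi ->
  (\int[mu]_u (x * phi (x * u))%:E = \int[mu]_y (phi y)%:E)%E.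
Proof.
move=> x0 mphi.
have mX : measurable_fun setT ( *%R x : measurableTypeR R -> measurableTypeR R).
  exact: mulrl_measurable.
rewrite -[RHS](@lebesgue_transfer x ( *%R x : measurableTypeR R -> measurableTypeR R))//.
  exact: ltW.
move=> A mA; apply/esym.
have x0' : 0 <= x by exact: ltW.
(* The scaled pushforward is packaged as a measure so that uniqueness of Lebesgue measure applies;
   only half-open intervals remain to be computed. *)
have [nu nuE] : exists nu : {measure set (measurableTypeR R) -> \bar R},
    forall B, nu B = (x%:E * mu ( *%R x @^-1` B))%E.
  by exists (mscale (NngNum x0')
    (measure_function_pushforward__canonical__measure_function_Measure mu mX)).
rewrite -nuE; apply: lebesgue_measure_unique => //.
move=> _ [[a b] _ <-]; rewrite nuE /=.
have -> : ( *%R x : measurableTypeR R -> measurableTypeR R) @^-1` `]a, b] =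
    `]a / x, b / x]%classic.
  apply/seteqP; split => t /=; rewrite !in_itv/= ltr_pdivrMr// ler_pdivlMr//.
    by rewrite ![x * _]mulrC.
  by rewrite ![x * _]mulrC.
rewrite !lebesgue_measure_itv/= !lte_fin ltr_pM2r ?invr_gt0//.
case: ifP => _; last by rewrite mule0.
by rewrite -!EFinB -EFinM; congr EFin; field; rewrite gt_eqF.
Qed.
End LebesgueChange.

(** * Bessel and Plancherel inequalities *)

Section RealIntegrals.
Context {R : realType}.
Local Notation mu := (@lebesgue_measure R).

Lemma Rintegral_sum d (T : measurableType d) (m : {measure set T -> \bar R})
    (D : set T) (I : Type) (s : seq I) (F : I -> T -> R) : measurable D ->
  (forall i, m.-integrable D (EFin \o F i)) ->
  (m.-integrable D (EFin \o (fun x => \sum_(i <- s) F i x)) *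
  (\int[m]_(x in D) (\sum_(i <- s) F i x) = \sum_(i <- s) \int[m]_(x in D) F i x))%type.
Proof.
move=> mD iF; elim: s => [|i s [IH1 IH2]].
  have -> : (fun x => \sum_(j <- [::]) F j x) = cst 0.
    by apply/funext => x; rewrite /= big_nil.
  rewrite big_nil; split; first exact: integrable0.
  by rewrite Rintegral_cst// mul0r.
have -> : (fun x => \sum_(j <- (i :: s)) F j x) = (fun x => F i x + \sum_(j <- s) F j x).
  by apply/funext => x; rewrite big_cons.
split; first by apply: (@integrableD _ _ _ _ _ mD (EFin \o F i) (EFin \o (fun x => \sum_(j <- s) F j x))) => //; exact: iF.
by rewrite RintegralD// IH2 big_cons.
Qed.

Lemma FTC2_everywhere (f F : R -> R) (a b : R) : a < b ->
  {within `[a, b], continuous f} ->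
  (forall x, a <= x <= b -> is_derive x 1 F (f x)) ->
  (\int[mu]_(x in `[a, b]) (f x)%:E = (F b)%:E - (F a)%:E)%E.
Proof.
move=> ab cf dF.
have cF x : a <= x <= b -> {for x, continuous F}.
  move=> /dF dFx; apply: differentiable_continuous.
  by apply/derivable1_diffP; exact: ex_derive.
apply: continuous_FTC2 => //.
- split.
  + move=> x; rewrite in_itv/= => /andP[ax xb].
    have dFx : is_derive x 1 F (f x) by apply: dF; rewrite !ltW.
    exact: ex_derive.
  + by apply: cvg_at_right_filter; apply: cF; rewrite lexx ltW.
  + by apply: cvg_at_left_filter; apply: cF; rewrite lexx ltW.
- move=> x; rewrite in_itv/= => /andP[ax xb].
  have dFx : is_derive x 1 F (f x) by apply: dF; rewrite !ltW.
  by rewrite derive1E; exact: derive_val.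
Qed.

Lemma sin_natmul_pi (n : nat) : sin (n%:R * pi) = 0 :> R.
Proof.
elim: n => [|n IH]; first by rewrite mul0r sin0.
by rewrite -natr1 mulrDl mul1r sinDpi IH oppr0.
Qed.

Lemma integral_cos_itv (w k : R) : 0 < k -> w != 0 ->
  \int[mu]_(t in `[- k, k]) cos (w * t) = 2 * sin (w * k) / w.
Proof.
move=> k0 w0; rewrite /Rintegral.
have dF t : - k <= t <= k -> is_derive t 1 (fun t => w^-1 * sin (w * t)) (cos (w * t)).
  move=> _.
  have d1 : is_derive t 1 (w \*: id) (w *: 1) by exact: is_deriveZ.
  have d2 := is_derive1_comp (is_derive_sin (w * t)) d1.
  apply: is_derive_eq (is_deriveZ w^-1 d2) _.
  by rewrite /GRing.scale /=; field.
have cf : {within `[- k, k], continuous (fun t => cos (w * t))}.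
  apply: continuous_subspaceT => t; apply: (continuous_comp (f := *%R w)); last exact: continuous_cos.
  exact: mulrl_continuous.
have kk : - k < k by lra.
rewrite (FTC2_everywhere kk cf dF) -EFinB/= mulrN sinN; field; exact: w0.
Qed.

End RealIntegrals.

Section Bessel.
Context {R : realType}.
Local Notation mu := (@lebesgue_measure R).

(** The real part of [(A t + i B t) exp(i t u)]. *)
Definition osc (A B : R -> R) (u t : R) : R := A t * cos (t * u) - B t * sin (t * u).

Definition cut_fourier (A B : R -> R) (k u : R) : R :=
  \int[mu]_(t in `[- k, k]) osc A B u t.

Lemma measurable_cosM (u : R) D : measurable_fun D (fun t : R => cos (t * u)).
Proof.
apply: measurable_funTS; apply: continuous_measurable_fun => t.
apply: (@continuous_comp _ _ _ (fun t : R => t * u)); last exact: continuous_cos.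
exact: mulrr_continuous.
Qed.

Lemma measurable_sinM (u : R) D : measurable_fun D (fun t : R => sin (t * u)).
Proof.
apply: measurable_funTS; apply: continuous_measurable_fun => t.
apply: (@continuous_comp _ _ _ (fun t : R => t * u)); last exact: continuous_sin.
exact: mulrr_continuous.
Qed.

(** The deficit is the square of the imaginary part [a sin x + b cos x]. *)
Lemma osc_sqr_le (a b x : R) : (a * cos x - b * sin x) ^+ 2 <= a ^+ 2 + b ^+ 2.
Proof.
have := cos2Dsin2 x; have := sqr_ge0 (a * sin x + b * cos x).
by move=> h e; nra.
Qed.

Variables (A B : R -> R) (k : R).
Hypothesis k0 : 0 < k.
Local Notation D := (`[- k, k]%classic : set R).
Let mD : measurable (D : set (measurableTypeR R)).
Proof. exact: measurable_itv. Qed.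

Hypothesis mA : measurable_fun D A.
Hypothesis mB : measurable_fun D B.
Local Notation sq := (fun t => A t ^+ 2 + B t ^+ 2).
Hypothesis isq : mu.-integrable D (EFin \o sq).

Lemma measurable_osc u : measurable_fun D (osc A B u).
Proof.
apply: measurable_funB; apply: measurable_funM => //.
- exact: measurable_cosM.
- exact: measurable_sinM.
Qed.

Lemma integrable_cst_itv (r : R) : mu.-integrable D (EFin \o cst r).
Proof.
apply: continuous_compact_integrable; first exact: segment_compact.
by apply: continuous_subspaceT => x; exact: cst_continuous.
Qed.

Lemma integrable_sqD (r : R) : mu.-integrable D (EFin \o (fun t => r + sq t)).
Proof.
exact: (@integrableD _ _ _ mu D mD (EFin \o cst r) (EFin \o sq)
  (integrable_cst_itv r)).
Qed.

Lemma integrable_osc u : mu.-integrable D (EFin \o osc A B u).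
Proof.
apply: (@le_integrable _ _ _ mu D _ _ (EFin \o (fun t => 1 + sq t))) => //.
- by apply/measurable_EFinP; exact: measurable_osc.
- move=> t _ /=; rewrite lee_fin.
  have := osc_sqr_le (A t) (B t) (t * u); rewrite -/(osc A B u t) => h.
  have h0 : 0 <= A t ^+ 2 + B t ^+ 2 by rewrite addr_ge0// sqr_ge0.
  rewrite (ger0_norm (addr_ge0 ler01 h0)).
  by rewrite ler_norml; apply/andP; split; nra.
- exact: integrable_sqD.
Qed.

Lemma integrable_cos_itv u : mu.-integrable D (EFin \o (fun t => cos (t * u))).
Proof.
apply: (@le_integrable _ _ _ mu D _ _ (EFin \o cst 1)) => //.
- by apply/measurable_EFinP; exact: measurable_cosM.
- move=> t _ /=; rewrite lee_fin normr1 ler_norml cos_le1.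
  by rewrite cos_geN1.
- exact: integrable_cst_itv.
Qed.

(** With spacing [pi / k], the functions [exp(- i t (node u m))] are orthogonal on [[-k, k]]: the
    sines produced by integration are evaluated at multiples of [pi]. *)
Let node u (m : nat) := u + m%:R * (pi / k).

Lemma cos_orthogonal u (m l : nat) :
  \int[mu]_(t in D) cos (t * (node u m - node u l)) = if m == l then 2 * k else 0.
Proof.
have [->|ml] := eqVneq m l.
  under eq_Rintegral do rewrite subrr mulr0 cos0.
  rewrite Rintegral_cst//= mul1r lebesgue_measure_itv/= lte_fin.
  by rewrite gt0_cp ?oppr_lt0//= opprK; ring.
have w0 : (m%:R - l%:R) * (pi / k) != 0 :> R.
  apply: mulf_neq0; first by rewrite subr_eq0 eqr_nat.
  by rewrite gt_eqF// divr_gt0// pi_gt0.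
have -> : node u m - node u l = (m%:R - l%:R) * (pi / k) by rewrite /node; ring.
under eq_Rintegral do rewrite mulrC.
rewrite integral_cos_itv//.
have -> : (m%:R - l%:R) * (pi / k) * k = m%:R * pi - l%:R * pi.
  by field; rewrite gt_eqF.
by rewrite sinB !sin_natmul_pi !(mul0r, mulr0) subr0 mulr0 mul0r.
Qed.

(** Bessel's inequality in the real Hilbert space of complex functions on [[-k, k]] with product
    [Re (F conj H)]. The functions [exp(- i t (node u m))] have squared norm [2 k], and their
    products with [A + i B] are the values of [cut_fourier]. *)
Lemma bessel N u :
  \sum_(m < N) cut_fourier A B k (node u m) ^+ 2 <=
    2 * k * \int[mu]_(t in D) sq t.
Proof.
pose Hm (m : 'I_N) := cut_fourier A B k (node u m).
pose c m := Hm m / (2 * k).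
pose F1 (m : 'I_N) t := c m * osc A B (node u m) t.
pose F2 (ml : 'I_N * 'I_N) t := c ml.1 * c ml.2 * cos (t * (node u ml.1 - node u ml.2)).
have iF1 m : mu.-integrable D (EFin \o F1 m).
  exact: (integrableZl mD (c m) (integrable_osc _)).
have iF2 ml : mu.-integrable D (EFin \o F2 ml).
  exact: (integrableZl mD (c ml.1 * c ml.2) (integrable_cos_itv _)).
have [i1 e1] := Rintegral_sum (index_enum _) mD iF1.
have [i2 e2] := Rintegral_sum (index_enum _) mD iF2.
(* This is the squared modulus of [A + i B] minus its projection [\sum_m c m exp(- i t (node u m))],
   in expanded form; its integral is nonnegative. *)
pose G t := sq t - (2 * \sum_m F1 m t - \sum_ml F2 ml t).
have G0 t : 0 <= G t.
  have -> : G t = (A t - \sum_m c m * cos (t * node u m)) ^+ 2 +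
                  (B t + \sum_m c m * sin (t * node u m)) ^+ 2.
    rewrite sqrrB sqrrD /G.
    have -> : \sum_ml F2 ml t = (\sum_m c m * cos (t * node u m)) ^+ 2 +
                             (\sum_m c m * sin (t * node u m)) ^+ 2.
      rewrite -(pair_bigA _ (fun m l => F2 (m, l) t))/= !expr2 !big_distrl/= -big_split/=.
      apply: eq_bigr => m _; rewrite !big_distrr/= -big_split/=.
      by apply: eq_bigr => l _; rewrite /F2/= mulrBr cosB; ring.
    have -> : \sum_m F1 m t = A t * (\sum_m c m * cos (t * node u m)) -
                           B t * (\sum_m c m * sin (t * node u m)).
      rewrite !big_distrr/= -sumrB; apply: eq_bigr => m _.
      by rewrite /F1 /osc; ring.
    by ring.
  by rewrite addr_ge0 ?sqr_ge0.
have i1' := integrableZl mD 2 i1.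
have i12 := integrableB mD i1' i2.
have : 0 <= \int[mu]_(t in D) G t by exact: Rintegral_ge0.
rewrite /G RintegralB// RintegralB// RintegralZl// e1 e2.
have -> : \sum_i \int[mu]_(x in D) F1 i x = \sum_m c m * Hm m.
  by apply: eq_bigr => m _; rewrite RintegralZl//; exact: integrable_osc.
have -> : \sum_i \int[mu]_(x in D) F2 i x = \sum_m c m ^+ 2 * (2 * k).
  rewrite -(pair_bigA _ (fun m l => \int[mu]_(x in D) F2 (m, l) x))/=.
  apply: eq_bigr => m _; rewrite (bigD1 m)//= big1 ?addr0.
    rewrite RintegralZl//; last exact: integrable_cos_itv.
    by rewrite cos_orthogonal eqxx expr2.
  move=> l lm; rewrite RintegralZl//; last exact: integrable_cos_itv.
  by rewrite cos_orthogonal eq_sym (inj_eq val_inj) (negbTE lm) mulr0.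
have -> : \sum_m c m * Hm m = (\sum_m Hm m ^+ 2) / (2 * k).
  by rewrite mulr_suml; apply: eq_bigr => m _; rewrite /c; ring.
have -> : \sum_m c m ^+ 2 * (2 * k) = (\sum_m Hm m ^+ 2) / (2 * k).
  by rewrite mulr_suml; apply: eq_bigr => m _; rewrite /c; field; rewrite gt_eqF.
rewrite -/(Hm _) => h.
rewrite mulrC -ler_pdivrMr ?mulr_gt0//.
by rewrite -subr_ge0; move: h; rewrite /Hm; lra.
Qed.

Lemma cut_fourier_sqr_le u :
  cut_fourier A B k u ^+ 2 <= 2 * k * \int[mu]_(t in D) sq t.
Proof. by have := bessel 1 u; rewrite big_ord1 /node mul0r addr0. Qed.

End Bessel.

Section Plancherel.
Context {R : realType}.
Local Notation mu := (@lebesgue_measure R).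
Variables (A B : R -> R) (k : R).
Hypothesis k0 : 0 < k.
Local Notation D := (`[- k, k]%classic : set R).
Let mD : measurable (D : set (measurableTypeR R)).
Proof. exact: measurable_itv. Qed.
Hypothesis mA : measurable_fun D A.
Hypothesis mB : measurable_fun D B.
Hypothesis isq : mu.-integrable D (EFin \o (fun t => A t ^+ 2 + B t ^+ 2)).

(** Continuity gives measurability of the kernel in the observation. The dominating function
    [|A| + |B|] is integrable on a bounded interval because [a <= 1 + a ^+ 2]. *)
Lemma continuous_cut_fourier : continuous (cut_fourier A B k).
Proof.
move=> u.
pose g t := `|A t| + `|B t|.
have ig : mu.-integrable D (EFin \o g).
  apply: (@le_integrable _ _ _ mu D mD _
    (EFin \o (fun t => 2 + (A t ^+ 2 + B t ^+ 2)))).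
  - apply/measurable_EFinP; apply: measurable_funD; exact: measurableT_comp.
  - move=> t _ /=; rewrite lee_fin /g.
    rewrite (ger0_norm (addr_ge0 (normr_ge0 _) (normr_ge0 _))).
    rewrite (ger0_norm (addr_ge0 (ler0n R 2) (addr_ge0 (sqr_ge0 (A t)) (sqr_ge0 (B t))))).
    have := real_normK (num_real (A t)); have := real_normK (num_real (B t)).
    have h (a : R) : 0 <= a -> a <= 1 + a ^+ 2 by nra.
    have := h _ (normr_ge0 (A t)); have := h _ (normr_ge0 (B t)).
    by move=> + + <- <-; lra.
  - exact: integrable_sqD.
have := @continuity_under_integral R _ _ mu (fun u t => osc A B u t) D mD
  (u - 1) (u + 1) (fun u _ => integrable_osc mA mB isq u).
have cf : {ae mu, forall y, D y -> {in `](u - 1), (u + 1)[%classic, continuous (fun l => osc A B l y)}}.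
  apply: aeW => t _ l _.
  have cl : {for l, continuous (fun l : R => t * l)} by exact: mulrl_continuous.
  have ccos : {for l, continuous (fun l : R => cos (t * l))}.
    apply: (@continuous_comp _ _ _ (fun l : R => t * l)) => //; exact: continuous_cos.
  have csin : {for l, continuous (fun l : R => sin (t * l))}.
    apply: (@continuous_comp _ _ _ (fun l : R => t * l)) => //; exact: continuous_sin.
  rewrite /osc; apply: cvgB; apply: cvgM => //; exact: cvg_cst.
move=> /(_ cf g ig); apply; last first.
  by rewrite inE/= in_itv/=; apply/andP; split; lra.
move=> l _; apply: aeW => t _.
rewrite /osc /g (le_trans (ler_normB _ _))// lerD// normrM.
  by rewrite ler_piMr// ler_norml cos_le1 cos_geN1.
by rewrite ler_piMr// ler_norml sin_le1 sin_geN1.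
Qed.

Lemma measurable_cut_fourier_ln E : measurable_fun E (fun y => cut_fourier A B k (ln y)).
Proof.
apply: measurable_funTS; apply: (measurableT_comp (f := cut_fourier A B k)).
  by apply: continuous_measurable_fun; exact: continuous_cut_fourier.
exact: measurable_ln.
Qed.

Let Phi (y : R) := cut_fourier A B k (ln y) ^+ 2 * y `^ (-1).
(** The logarithmic length of a block is the spacing of the Bessel nodes, so that a fixed [u] meets
    successive blocks exactly at successive nodes. *)
Let dl := pi / k.

Let dl0 : 0 < dl. Proof. by rewrite divr_gt0// pi_gt0. Qed.

Let Phi_ge0 y : 0 <= Phi y. Proof. by rewrite mulr_ge0 ?sqr_ge0 ?powR_ge0. Qed.

Let mPhi E : measurable_fun E Phi.
Proof.
apply: measurable_funTS; apply: measurable_funM.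
  by apply: measurable_funX; exact: measurable_cut_fourier_ln.
exact: measurable_powR.
Qed.

(* The substitution [y = expR v * u] carries the block [[expR v, expR (v + dl))] to
   the fixed block [[1, expR dl)], where [bessel] applies pointwise in [u]. *)
Let slice v u : R := cut_fourier A B k (ln u + v) ^+ 2 * u `^ (-1).

Let mslice v E : measurable_fun E (slice v).
Proof.
apply: measurable_funTS; apply: measurable_funM.
  apply: measurable_funX; apply: (measurableT_comp (f := cut_fourier A B k)).
    by apply: continuous_measurable_fun; exact: continuous_cut_fourier.
  by apply: measurable_funD => //; exact: measurable_ln.
exact: measurable_powR.
Qed.

Let slice_ge0 v y : 0 <= slice v y. Proof. by rewrite mulr_ge0 ?sqr_ge0 ?powR_ge0. Qed.

Let block v : (\int[mu]_(y in `[expR v, expR (v + dl)[) (Phi y)%:E =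
  \int[mu]_(u in `[1%R, expR dl[) (slice v u)%:E)%E.
Proof.
rewrite integral_mkcond [RHS]integral_mkcond.
transitivity (\int[mu]_y (Phi y * \1_(`[expR v, expR (v + dl)[) y)%:E)%E.
  by apply: eq_integral => y _; rewrite restrict_EFin patch_indic.
rewrite -(@integral_scale R (expR v)) ?expR_gt0//; last first.
  by apply: measurable_funM => //; exact: measurable_indic.
apply: eq_integral => u _; rewrite restrict_EFin patch_indic; congr EFin.
rewrite /= mulrA !indicE !mem_setE.
rewrite !in_itv/= -[X in X <= _ * _](mulr1 (expR v)) expRD.
rewrite ler_pM2l ?expR_gt0// ltr_pM2l ?expR_gt0//.
have [/andP[u1 _]|_] := boolP (1 <= u < expR dl); last by rewrite !mulr0.
rewrite !mulr1.
have u0 : 0 < u by exact: lt_le_trans u1.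
rewrite /Phi /slice lnM ?posrE ?expR_gt0// expRK powRM ?expR_ge0 ?ltW//.
rewrite powR_inv1 ?expR_ge0// [v + _]addrC.
by field; rewrite gt_eqF// expR_gt0.
Qed.

Let blocks N v : (\int[mu]_(y in `[expR v, expR (v + N%:R * dl)[) (Phi y)%:E =
  \sum_(m < N) \int[mu]_(u in `[1%R, expR dl[) (slice (v + m%:R * dl) u)%:E)%E.
Proof.
elim: N => [|N IH].
  by rewrite mul0r addr0 set_itvco0 integral_set0 big_ord0.
rewrite big_ord_recr/= -IH -block.
have -> : v + N.+1%:R * dl = v + N%:R * dl + dl by rewrite -natr1; ring.
set I1 := (X in (\int[_]_(_ in X) _ + _)%E); set I2 := (X in (_ + \int[_]_(_ in X) _)%E).
have mI1 : measurable (I1 : set (measurableTypeR R)) by exact: measurable_itv.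
have mI2 : measurable (I2 : set (measurableTypeR R)) by exact: measurable_itv.
have I12 : [disjoint I1 & I2].
  apply/disj_setPS => y []; rewrite /I1 /I2/= !in_itv/= => /andP[_ h1] /andP[h2 _].
  by move: h1; rewrite ltNge h2.
have mPhi12 : measurable_fun (I1 `|` I2) (EFin \o Phi).
  by apply/measurable_EFinP; exact: mPhi.
rewrite -(@ge0_integral_setU _ _ _ mu I1 I2 mI1 mI2 (EFin \o Phi) mPhi12 _ I12); last first.
  by move=> y _; rewrite lee_fin; exact: Phi_ge0.
congr integral; rewrite /I1 /I2; apply: itv_bndbnd_setU.
- by rewrite bnd_simp ler_expR lerDl; apply: mulr_ge0; [exact: ler0n|exact: ltW].
- by rewrite bnd_simp ler_expR lerDl; exact: ltW.
Qed.

(** At each [u] of the reference block, [bessel] bounds the sum over blocks by [2 k S / u], with [S]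
    the integral on the right. The integral of [1 / u] over the block is [pi / k], so [k] cancels
    and [2 pi S] remains. *)
Lemma plancherel_le :
  (\int[mu]_(y in Rpos) (cut_fourier A B k (ln y) ^+ 2 * y `^ (-1))%:E <=
   (2 * pi * \int[mu]_(t in D) (A t ^+ 2 + B t ^+ 2))%:E)%E.
Proof.
pose F (n : nat) := (`[expR (- (n%:R * dl)), expR (n%:R * dl)[%classic : set R).
have FU : \bigcup_n F n = Rpos.
  apply/seteqP; split => y /=; rewrite /Rpos /F/= ?in_itv/= ?andbT.
    by move=> [n _] /=; rewrite in_itv/= => /andP[+ _]; apply: lt_le_trans; exact: expR_gt0.
  move=> y0; pose n := (Num.truncn (`|ln y| / dl)).+1.
  have hn : `|ln y| < n%:R * dl.
    by rewrite -ltr_pdivrMr// truncnS_gt.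
  exists n => //=; rewrite in_itv/= -{1}(lnK y0) -{2}(lnK y0) ler_expR ltr_expR.
  by move: hn; rewrite ltr_norml => /andP[/ltW -> ->].
have ndF : nondecreasing_seq F.
  move=> n m nm; apply/subsetPset => y; rewrite /F/= !in_itv/= => /andP[h1 h2].
  have hnm : n%:R * dl <= m%:R * dl by apply: ler_wpM2r; [exact: ltW | rewrite ler_nat].
  apply/andP; split; first by apply: le_trans h1; rewrite ler_expR lerN2.
  by apply: lt_le_trans h2 _; rewrite ler_expR.
have Fcvg := @ge0_nondecreasing_set_cvg_integral _ (measurableTypeR R) R F (EFin \o Phi) mu ndF.
have {}Fcvg : (\int[mu]_(y in F n) (Phi y)%:E @[n --> \oo] -->
    \int[mu]_(y in \bigcup_n F n) (Phi y)%:E)%E.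
  apply: Fcvg.
  - by move=> n; exact: measurable_itv.
  - by move=> n; apply/measurable_EFinP; exact: mPhi.
  - by move=> n y _; rewrite lee_fin.
rewrite -FU; rewrite -/(Phi _) -(cvg_lim (@ereal_hausdorff R) Fcvg).
apply: lime_le; first by apply/cvg_ex; eexists; exact: Fcvg.
(* [F n] is made of the [2 n] consecutive blocks that start at [expR (- (n dl))]. *)
apply: nearW => n; have := blocks (n + n) (- (n%:R * dl)).
have -> : - (n%:R * dl) + (n + n)%:R * dl = n%:R * dl by rewrite natrD; ring.
rewrite -/(F n) => ->.
have mI : measurable (`[1%R, expR dl[%classic : set (measurableTypeR R)).
  exact: measurable_itv.
pose h (m : 'I_(n + n)) u := (slice (- (n%:R * dl) + m%:R * dl) u)%:E.
have mh m : measurable_fun (`[1%R, expR dl[%classic : set (measurableTypeR R)) (h m).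
  by apply/measurable_EFinP; exact: mslice.
have h0 m u : `[1%R, expR dl[%classic u -> (0 <= h m u)%E.
  by move=> _; rewrite lee_fin; exact: slice_ge0.
have sumE := ge0_integral_sum mu mI mh h0 (index_enum _).
rewrite -sumE.
set S := \int[mu]_(t in D) _.
have S0 : 0 <= S by apply: Rintegral_ge0 => t _; rewrite addr_ge0 ?sqr_ge0.
apply: (@le_trans _ _ (\int[mu]_(u in `[1%R, expR dl[) ((2 * k * S)%:E * (u `^ (-1))%:E))%E).
  apply: ge0_le_integral => //.
  - by move=> u _; apply: sume_ge0 => m _; rewrite lee_fin.
  - by apply: emeasurable_sum => m; apply/measurable_EFinP; exact: mslice.
  - apply/measurable_EFinP; apply: measurable_funTS.
    by apply: measurable_funM => //; exact: measurable_powR.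
  - move=> u /=; rewrite in_itv/= => /andP[u1 _].
    have u0 : 0 < u by exact: lt_le_trans u1.
    rewrite sumEFin -EFinM lee_fin -mulr_suml ler_wpM2r ?powR_ge0//.
    by under eq_bigr do rewrite addrA; exact: bessel.
rewrite ge0_integralZl_EFin//; last 3 first.
- by move=> u _; rewrite lee_fin powR_ge0.
- by apply/measurable_EFinP; apply: measurable_funTS; exact: measurable_powR.
- by rewrite !mulr_ge0// ltW.
rewrite integral_itv_bndo_bndc; last first.
  by apply/measurable_EFinP; apply: measurable_funTS; exact: measurable_powR.
have -> : (\int[mu]_(u in `[1%R, expR dl]) (u `^ (-1))%:E =
           \int[mu]_(u in `[1%R, expR dl]) (u^-1)%:E)%E.
  apply: eq_integral => u; rewrite inE/= in_itv/= => /andP[u1 _].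
  by rewrite powR_inv1// (le_trans ler01).
have cinv : {within `[1%R, expR dl], continuous (fun u : R => u^-1)}.
  apply: continuous_in_subspaceT => u; rewrite inE/= in_itv/= => /andP[u1 _].
  by apply: inv_continuous; rewrite gt_eqF// (lt_le_trans ltr01).
have dln u : 1 <= u <= expR dl -> is_derive u 1 (@ln R) u^-1.
  by move=> /andP[u1 _]; apply: is_derive1_ln; exact: lt_le_trans u1.
rewrite (FTC2_everywhere _ cinv dln); last by rewrite expR_gt1.
rewrite expRK ln1 sube0 -EFinM lee_fin /dl.
by rewrite le_eqVlt; apply/orP; left; apply/eqP; field; rewrite gt_eqF.
Qed.

End Plancherel.

(** * The law of a product *)

Section Law.
Context {R : realType}.
Local Notation mu := (@lebesgue_measure R).
Variables (f g : R -> R).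
Hypothesis df : is_density f.
Hypothesis dg : is_density g.

(** Extension by zero moves all integrals to the whole line or plane, where Tonelli and the changes
    of variables are available. *)
Let fp := f \_ Rpos.
Let gp := g \_ Rpos.
Let W (z : R * R) := fp z.1 * gp z.2.

Let mRpos : measurable (Rpos : set (measurableTypeR R)).
Proof. exact: measurable_Rpos. Qed.

Let inRpos x : 0 < x -> (x \in (Rpos : set R)) = true.
Proof. by move=> x0; rewrite mem_set// /Rpos/= in_itv/= x0. Qed.

Let notinRpos x : x <= 0 -> (x \in (Rpos : set R)) = false.
Proof. by move=> x0; rewrite memNset// /Rpos/= in_itv/= andbT ltNge x0. Qed.

Let mpatch (h : R -> R) : measurable_fun Rpos h -> measurable_fun setT (h \_ Rpos).
Proof. by move=> mh; exact/(measurable_restrictT _ mRpos). Qed.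

Let patch_ge0 (h : R -> R) : (forall x, 0 < x -> 0 <= h x) -> forall x, 0 <= (h \_ Rpos) x.
Proof.
move=> h0 x; rewrite patchE; case: ifPn => //; rewrite inE/= /Rpos/= in_itv/= andbT.
exact: h0.
Qed.

Let patch_pos (h : R -> R) x : 0 < x -> (h \_ Rpos) x = h x.
Proof. by move=> x0; rewrite patchE inRpos. Qed.

Let patch_neg (h : R -> R) x : x <= 0 -> (h \_ Rpos) x = 0.
Proof. by move=> x0; rewrite patchE notinRpos. Qed.

Let fpN x : x <= 0 -> fp x = 0. Proof. exact: patch_neg. Qed.
Let gpN x : x <= 0 -> gp x = 0. Proof. exact: patch_neg. Qed.
Let fpP x : 0 < x -> fp x = f x. Proof. exact: patch_pos. Qed.
Let gpP x : 0 < x -> gp x = g x. Proof. exact: patch_pos. Qed.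

Let mfp : measurable_fun setT fp. Proof. by apply: mpatch; case: df. Qed.
Let mgp : measurable_fun setT gp. Proof. by apply: mpatch; case: dg. Qed.
Let fp0 x : 0 <= fp x. Proof. by apply: patch_ge0; case: df. Qed.
Let gp0 x : 0 <= gp x. Proof. by apply: patch_ge0; case: dg. Qed.

Let mW : measurable_fun setT (W : measurableTypeR R * measurableTypeR R -> R).
Proof.
by apply: measurable_funM; apply: measurableT_comp.
Qed.
Let W0 z : 0 <= W z. Proof. by rewrite mulr_ge0. Qed.

Local Notation M := (mu \x mu)%E.

(** After Tonelli, the substitution [y = x u] at fixed [x > 0] turns [f(x) g(y / x) / x dy] into
    [f(x) g(u) du]. *)
Lemma dens_Y_integral (phi : R -> R) : measurable_fun setT phi ->
  (forall y, 0 <= phi y) ->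
  (\int[mu]_(y in Rpos) ((phi y)%:E * dens_Y f g y) =
   \int[M]_z (W z * phi (z.1 * z.2))%:E)%E.
Proof.
move=> mphi phi0.
pose ka (yx : measurableTypeR R * measurableTypeR R) : R :=
  phi yx.1 * (fp yx.2 * gp (yx.1 * yx.2 `^ (-1)) * yx.2 `^ (-1)).
have ka0 yx : (0 <= (ka yx)%:E)%E.
  by rewrite lee_fin !mulr_ge0// powR_ge0.
have mpow : measurable_fun setT (fun yx : measurableTypeR R * measurableTypeR R =>
    yx.2 `^ (-1)).
  apply: (measurableT_comp (f := fun x : R => x `^ (-1))); first exact: measurable_powR.
  exact: measurable_snd.
have mka : measurable_fun setT (EFin \o ka).
  apply/measurable_EFinP; apply: measurable_funM.
    by apply: measurableT_comp => //; exact: measurable_fst.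
  apply: measurable_funM => //; apply: measurable_funM.
    by apply: measurableT_comp => //; exact: measurable_snd.
  apply: measurableT_comp => //; apply: measurable_funM => //; exact: measurable_fst.
transitivity (\int[mu]_y \int[mu]_x (EFin \o ka) (y, x))%E.
  rewrite integral_mkcond; apply: eq_integral => y _; rewrite patchE.
  have [y0|y0] := ltP 0 y; last first.
    rewrite notinRpos//.
    rewrite integral0_eq// => x _; rewrite /ka/=.
    have [x0|x0] := ltP 0 x; last by rewrite fpN// !(mul0r, mulr0).
    by rewrite gpN ?mulr_le0_ge0 ?powR_ge0// !(mul0r, mulr0).
  rewrite inRpos// /dens_Y -ge0_integralZl_EFin//.
  - rewrite integral_mkcond; apply: eq_integral => x _.
    rewrite patchE; have [x0|x0] := ltP 0 x; last first.
      by rewrite notinRpos// /ka/= fpN// !(mul0r, mulr0).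
    rewrite inRpos// -EFinM /ka/= fpP// powR_inv1 ?ltW//.
    by rewrite gpP ?divr_gt0.
  - move=> x; rewrite /Rpos /= in_itv/= andbT => x0; rewrite lee_fin.
    case: df => _ f0 _; case: dg => _ g0 _.
    by rewrite mulr_ge0 ?mulr_ge0 ?f0 ?g0 ?invr_ge0 ?divr_gt0 ?ltW.
  - apply/measurable_EFinP.
    apply: (@eq_measurable_fun _ _ _ _ _ (fun x => fp x * gp (y * x `^ (-1)) * x `^ (-1))).
      move=> x; rewrite inE/= /Rpos/= in_itv/= andbT => x0.
      by rewrite powR_inv1 ?ltW// fpP// gpP// divr_gt0.
    have mp : measurable_fun setT (fun x : R => x `^ (-1)) by exact: measurable_powR.
    apply: measurable_funTS; apply: measurable_funM => //; apply: measurable_funM => //.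
    by apply: measurableT_comp => //; exact: measurable_funM.
rewrite (fubini_tonelli (EFin \o ka))//.
rewrite (fubini_tonelli1 (fun z : measurableTypeR R * measurableTypeR R =>
  (W z * phi (z.1 * z.2))%:E)); last 2 first.
- apply/measurable_EFinP; apply: measurable_funM => //; apply: measurableT_comp => //.
  by apply: measurable_funM; [exact: measurable_fst|exact: measurable_snd].
- by move=> z; rewrite lee_fin mulr_ge0.
apply: eq_integral => x _; rewrite /fubini_F.
have [x0|x0] := ltP 0 x; last first.
  rewrite integral0_eq => [|u _]; last by rewrite /W/= fpN// !(mul0r, mulr0).
  by rewrite integral0_eq// => y _; rewrite /= /ka/= fpN// !(mul0r, mulr0).
have mkax : measurable_fun setT (fun y : R => ka (y, x)).
  by apply/measurable_EFinP; apply: (measurableT_comp mka); exact: measurable_pair2.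
have /= <- := integral_scale x0 mkax.
apply: eq_integral => u _; congr EFin.
rewrite /ka /W/= powR_inv1 ?ltW//.
have -> : x * u / x = u by field; rewrite gt_eqF.
by field; rewrite gt_eqF.
Qed.

Section LawMeasure.
Variable nu : {measure set R -> \bar R}.
Hypothesis nuE : forall A : set R, measurable A ->
  (nu A = \int[mu]_(y in A `&` Rpos) dens_Y f g y)%E.

Lemma law_transfer (phi : R -> R) : measurable_fun setT phi ->
  (\int[nu]_y (phi y)%:E = \int[M]_z (W z * phi (z.1 * z.2))%:E)%E.
Proof.
move=> mphi.
have mmul : measurable_fun setT (fun z : measurableTypeR R * measurableTypeR R => z.1 * z.2).
  by apply: measurable_funM; [exact: measurable_fst|exact: measurable_snd].
have tr := @weighted_transfer _ _ _ R (measurableTypeR R * measurableTypeR R)%type R R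
  nu M (cst 1) W id (fun z => z.1 * z.2) (measurable_cst _) mW (@measurable_id _ _ _)
  mmul (fun=> ler01) W0.
transitivity (\int[nu]_y (1 * phi y)%:E)%E.
  by apply: eq_integral => y _; rewrite mul1r.
apply: (tr _ phi mphi) => A mA.
have mi : measurable_fun setT (\1_A : R -> R) by exact: measurable_indic.
have i0 y : 0 <= (\1_A : R -> R) y by rewrite indicE.
rewrite -(dens_Y_integral mi i0).
under eq_integral do rewrite mul1r.
rewrite integral_indic// setIT nuE// setIC.
rewrite integral_mkcondr; apply: eq_integral => y _.
rewrite patchE indicE; case: ifPn => yA; first by rewrite mul1e.
by rewrite mul0e.
Qed.

End LawMeasure.
End Law.

(** * Moments, Mellin transform and domination for the law of the product *)

Section LawFacts.
Context {R : realType}.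
Local Notation mu := (@lebesgue_measure R).

Lemma mem_Rpos (x : R) : (x \in (Rpos : set R)) = (0 < x).
Proof.
by apply/idP/idP; rewrite ?inE /Rpos/= in_itv/= andbT.
Qed.

Lemma patch_Rpos (h : R -> R) (x : R) : (h \_ Rpos) x = if 0 < x then h x else 0.
Proof. by rewrite patchE mem_Rpos. Qed.

Let mRpos : measurable (Rpos : set (measurableTypeR R)).
Proof. exact: measurable_Rpos. Qed.

Lemma measurable_patch_Rpos (h : R -> R) : measurable_fun Rpos h ->
  measurable_fun setT (h \_ Rpos).
Proof. by move=> mh; exact/(measurable_restrictT _ mRpos). Qed.

Lemma patch_Rpos_ge0 (h : R -> R) : is_density h -> forall x, 0 <= (h \_ Rpos) x.
Proof. by case=> _ h0 _ x; rewrite patch_Rpos; case: ifPn => // /h0. Qed.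

Lemma measurable_patch_density (h : R -> R) : is_density h ->
  measurable_fun setT (h \_ Rpos).
Proof. by case=> mh _ _; exact: measurable_patch_Rpos. Qed.

Lemma integral_patch_Rpos (h p : R -> R) :
  (\int[mu]_x ((h \_ Rpos) x * p x)%:E = \int[mu]_(x in Rpos) (p x * h x)%:E)%E.
Proof.
rewrite [RHS]integral_mkcond; apply: eq_integral => x _.
by rewrite patch_Rpos patchE mem_Rpos; case: ifP => _; rewrite ?mul0r// mulrC.
Qed.

(** With [sink], the two components of [mellin_kernel]. *)
Definition cosk (c t y : R) : R := y `^ (c - 1) * cos (t * ln y).
Definition sink (c t y : R) : R := y `^ (c - 1) * sin (t * ln y).

Lemma measurable_cosk c t : measurable_fun setT (cosk c t).
Proof.
apply: measurable_funM; first exact: measurable_powR.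
apply: (measurableT_comp (f := cos)).
  by apply: continuous_measurable_fun; exact: continuous_cos.
by apply: measurable_funM => //; exact: measurable_ln.
Qed.

Lemma measurable_sink c t : measurable_fun setT (sink c t).
Proof.
apply: measurable_funM; first exact: measurable_powR.
apply: (measurableT_comp (f := sin)).
  by apply: continuous_measurable_fun; exact: continuous_sin.
by apply: measurable_funM => //; exact: measurable_ln.
Qed.

Lemma mellinE (c t : R) (h : R -> R) : mellin c h t =
  Complex (\int[mu]_(x in Rpos) (cosk c t x * h x))
          (\int[mu]_(x in Rpos) (sink c t x * h x)).
Proof.
rewrite /mellin /cintegral; congr Complex; apply: eq_Rintegral => x _ /=.
  by rewrite mulr0 subr0.
by rewrite mulr0 add0r.
Qed.

Lemma normr_cosk_le c t x : `|cosk c t x| <= x `^ (c - 1).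
Proof.
by rewrite normrM (ger0_norm (powR_ge0 _ _)) ler_piMr ?powR_ge0// ler_norml cos_le1 cos_geN1.
Qed.

Lemma normr_sink_le c t x : `|sink c t x| <= x `^ (c - 1).
Proof.
by rewrite normrM (ger0_norm (powR_ge0 _ _)) ler_piMr ?powR_ge0// ler_norml sin_le1 sin_geN1.
Qed.

Lemma integrable_weight (c : R) (h r : R -> R) : in_Lp 1 (c - 1) h ->
  measurable_fun setT r -> (forall x, `|r x| <= x `^ (c - 1)) ->
  mu.-integrable Rpos (fun x => (r x * h x)%:E).
Proof.
move=> [mh hlt] mr rle; apply/integrableP; split.
  by apply/measurable_EFinP; apply: measurable_funM => //; exact: measurable_funTS.
apply: le_lt_trans hlt; apply: ge0_le_integral => //.
- apply/measurable_EFinP; apply: measurableT_comp => //; apply: measurable_funM => //.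
  exact: measurable_funTS.
- apply/measurable_EFinP; apply: measurable_funM; last first.
    by apply: measurable_funTS; exact: measurable_powR.
  apply: (@measurableT_comp _ _ _ _ _ _ (fun x => x `^ 1)); first exact: measurable_powR.
  exact: measurableT_comp.
- move=> x _; rewrite abse_EFin lee_fin powRr1// normrM mulrC ler_wpM2l//.
Qed.

(** The weight is positive on the half-line, so a vanishing moment would make [h] vanish almost
    everywhere, against its total mass 1. *)
Lemma moment_gt0 (p : R) (h : R -> R) : is_density h -> (0 < moment p h)%E.
Proof.
move=> dh; have h0 := patch_Rpos_ge0 dh; have mh := measurable_patch_density dh.
rewrite /moment lt_neqAle; apply/andP; split; last first.
  apply: integral_ge0 => x; rewrite /Rpos/= in_itv/= andbT => x0.
  by rewrite lee_fin mulr_ge0 ?powR_ge0//; case: dh => _ + _; apply.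
apply/eqP => m0.
have e1 : (\int[mu]_x `|((h \_ Rpos) x * x `^ p)%:E| = 0)%E.
  rewrite m0 -integral_patch_Rpos; apply: eq_integral => x _.
  by rewrite gee0_abs// lee_fin mulr_ge0 ?powR_ge0.
have /(ae_eq_integral_abs _ measurableT) ae0 : measurable_fun setT
    (fun x : measurableTypeR R => ((h \_ Rpos) x * x `^ p)%:E).
  by apply/measurable_EFinP; apply: measurable_funM => //; exact: measurable_powR.
have {}ae0 := (ae0 mu).1 e1.
have e2 : (\int[mu]_x ((h \_ Rpos) x * 1)%:E = \int[mu]_x 0)%E.
  apply: ae_eq_integral => //.
    by apply/measurable_EFinP; exact: measurable_funM.
  apply: filterS ae0 => x /(_ I) /= [] + _; rewrite mulr1 patch_Rpos.
  case: ifPn => // x0 /eqP; rewrite mulf_eq0 (gt_eqF (powR_gt0 _ x0)) orbF => /eqP -> //.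
case: dh => _ _; move: e2; rewrite integral_patch_Rpos integral0.
under eq_integral do rewrite mul1r.
by move=> -> /eqP; rewrite eq_sym onee_eq0.
Qed.

Variables (f g : R -> R).
Hypothesis df : is_density f.
Hypothesis dg : is_density g.
Local Notation W z := ((f \_ Rpos) z.1 * (g \_ Rpos) z.2).
Local Notation M := (mu \x mu)%E.
Local Notation RR := (measurableTypeR R * measurableTypeR R)%type.

Let mfp := measurable_patch_density df.
Let mgp := measurable_patch_density dg.
Let fp0 := patch_Rpos_ge0 df.
Let gp0 := patch_Rpos_ge0 dg.

Let mWpq (p q : R -> R) : measurable_fun setT p -> measurable_fun setT q ->
  measurable_fun setT (fun z : RR => (W z * (p z.1 * q z.2))%:E).
Proof.
move=> mp mq; apply/measurable_EFinP.
by apply: measurable_funM; apply: measurable_funM; apply: measurableT_comp.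
Qed.

Lemma ge0_law_prod (p q : R -> R) :
  measurable_fun setT p -> measurable_fun setT q ->
  (forall x, 0 <= p x) -> (forall x, 0 <= q x) ->
  (\int[M]_z (W z * (p z.1 * q z.2))%:E =
   (\int[mu]_(x in Rpos) (p x * f x)%:E) * (\int[mu]_(x in Rpos) (q x * g x)%:E))%E.
Proof.
move=> mp mq p0 q0.
have mgq : measurable_fun setT (fun u : measurableTypeR R => ((g \_ Rpos) u * q u)%:E).
  by apply/measurable_EFinP; exact: measurable_funM.
have mfpp : measurable_fun setT (fun u : measurableTypeR R => ((f \_ Rpos) u * p u)%:E).
  by apply/measurable_EFinP; exact: measurable_funM.
rewrite (fubini_tonelli1 (fun z : RR => (W z * (p z.1 * q z.2))%:E)); last 2 first.
- exact: mWpq.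
- by move=> z; rewrite lee_fin !mulr_ge0.
rewrite -!integral_patch_Rpos -ge0_integralZr//; last 2 first.
- by move=> x _; rewrite lee_fin mulr_ge0.
- by apply: integral_ge0 => x _; rewrite lee_fin mulr_ge0.
apply: eq_integral => x _; rewrite /fubini_F/= -ge0_integralZl_EFin//; last 2 first.
- by move=> u _; rewrite lee_fin mulr_ge0.
- by rewrite mulr_ge0.
by apply: eq_integral => u _; rewrite -EFinM; congr EFin; ring.
Qed.

(** The nonnegative case, applied to [|p|] and [|q|], provides the integrability that Fubini asks
    for. *)
Lemma law_prod (p q : R -> R) :
  measurable_fun setT p -> measurable_fun setT q ->
  mu.-integrable Rpos (fun x => (p x * f x)%:E) ->
  mu.-integrable Rpos (fun x => (q x * g x)%:E) ->
  (M.-integrable setT (fun z => (W z * (p z.1 * q z.2))%:E) *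
  (\int[M]_z (W z * (p z.1 * q z.2))%:E =
   ((\int[mu]_(x in Rpos) (p x * f x)) * (\int[mu]_(x in Rpos) (q x * g x)))%:E)%E)%type.
Proof.
move=> mp mq ip iq.
have mab (h : R -> R) : measurable_fun setT h -> measurable_fun setT (fun x => `|h x|).
  by move=> mh; exact: measurableT_comp.
have lty (h r : R -> R) : is_density h -> mu.-integrable Rpos (fun x => (r x * h x)%:E) ->
    (\int[mu]_(x in Rpos) (`|r x| * h x)%:E < +oo)%E.
  move=> [_ h0 _] /integrableP[_]; congr (_ < _)%E; apply: eq_integral => x.
  by rewrite mem_Rpos => x0; rewrite abse_EFin normrM (ger0_norm (h0 _ x0)).
have patchint (h r : R -> R) : mu.-integrable Rpos (fun x => (r x * h x)%:E) ->
    mu.-integrable setT (fun x => ((h \_ Rpos) x * r x)%:E).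
  move=> /(integrable_mkcond _ mRpos); apply: eq_integrable => //.
  move=> x _; rewrite patchE mem_Rpos patch_Rpos.
  by case: ifP => _; rewrite ?mul0r// mulrC.
have iM : M.-integrable setT (fun z : RR => (W z * (p z.1 * q z.2))%:E).
  apply/integrableP; split; first exact: mWpq.
  have := ge0_law_prod (mab _ mp) (mab _ mq) (fun=> normr_ge0 _) (fun=> normr_ge0 _).
  under eq_integral => z _.
    rewrite -normrM -(ger0_norm (fp0 _)) -(ger0_norm (gp0 _)) -!normrM -abse_EFin.
    over.
  move=> ->; apply: lte_mul_pinfty.
  - apply: integral_ge0 => x; rewrite -inE mem_Rpos => x0; rewrite lee_fin mulr_ge0//.
    by case: df => _ + _; apply.
  - rewrite ge0_fin_numE; first exact: lty.
    apply: integral_ge0 => x; rewrite -inE mem_Rpos => x0; rewrite lee_fin mulr_ge0//.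
    by case: df => _ + _; apply.
  - exact: lty.
split=> //.
have := integral12_prod_meas1 iM; rewrite /= => <-.
have finE (h r : R -> R) : mu.-integrable Rpos (fun x => (r x * h x)%:E) ->
    (\int[mu]_x ((h \_ Rpos) x * r x)%:E = (\int[mu]_(x in Rpos) (r x * h x))%:E)%E.
  move=> ir; rewrite integral_patch_Rpos /Rintegral fineK//.
  exact: integrable_fin_num.
rewrite EFinM -(finE f p ip) -integralZr//; last exact: patchint.
apply: eq_integral => x _; rewrite /fubini_F/= -(finE g q iq) -integralZl//; last exact: patchint.
by apply: eq_integral => u _; rewrite -EFinM; congr EFin; ring.
Qed.

Section Measure.
Variable nu : {measure set R -> \bar R}.
Hypothesis nuE : forall A : set R, measurable A ->
  (nu A = \int[mu]_(y in A `&` Rpos) dens_Y f g y)%E.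

Let tr := law_transfer df dg nuE.

Lemma moment_law (p : R) : (\int[nu]_y (y `^ p)%:E = moment p f * moment p g)%E.
Proof.
rewrite tr; last exact: measurable_powR.
rewrite -(@ge0_law_prod (fun x => x `^ p) (fun x => x `^ p)); try exact: measurable_powR;
  try by move=> x; exact: powR_ge0.
apply: eq_integral => z _; congr EFin; rewrite !patch_Rpos.
case: ifPn => [z1|_]; last by rewrite !mul0r.
case: ifPn => [z2|_]; last by rewrite mulr0 !mul0r.
by rewrite powRM// ltW.
Qed.

Lemma moment_Y_law (p : R) : (moment_Y p f g = \int[nu]_y (y `^ p)%:E)%E.
Proof.
have mp : measurable_fun setT (fun y : R => y `^ p) by exact: measurable_powR.
by rewrite tr// /moment_Y (dens_Y_integral df dg mp)// => y; exact: powR_ge0.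
Qed.

(** The convolution theorem for the Mellin transform, in components: the kernel is multiplicative,
    by [powRM] and the addition formulas at [ln x + ln u], and the variables are independent. *)
Lemma law_char (c t : R) : in_Lp 1 (c - 1) f -> in_Lp 1 (c - 1) g ->
  (\int[nu]_y (cosk c t y)%:E = (complex.Re (mellin c f t * mellin c g t))%:E)%E /\
  (\int[nu]_y (sink c t y)%:E = (complex.Im (mellin c f t * mellin c g t))%:E)%E.
Proof.
move=> Lf Lg.
have [mc ms] := (measurable_cosk c t, measurable_sink c t).
have icf := integrable_weight Lf mc (normr_cosk_le c t).
have icg := integrable_weight Lg mc (normr_cosk_le c t).
have isf := integrable_weight Lf ms (normr_sink_le c t).
have isg := integrable_weight Lg ms (normr_sink_le c t).
have [icc ecc] := law_prod mc mc icf icg.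
have [iss ess] := law_prod ms ms isf isg.
have [ics ecs] := law_prod mc ms icf isg.
have [isc esc] := law_prod ms mc isf icg.
rewrite !mellinE /=; split.
  rewrite tr// EFinB -ecc -ess -integralB//.
  apply: eq_integral => z _; rewrite -EFinB; congr EFin; rewrite /cosk /sink !patch_Rpos.
  case: ifPn => [z1|_]; last by rewrite !mul0r subr0.
  case: ifPn => [z2|_]; last by rewrite mulr0 !mul0r subr0.
  by rewrite powRM ?(ltW z1) ?(ltW z2)// lnM// mulrDr cosD; ring.
rewrite tr// EFinD -ecs -esc -integralD//.
apply: eq_integral => z _; rewrite -EFinD; congr EFin; rewrite /cosk /sink !patch_Rpos.
case: ifPn => [z1|_]; last by rewrite !mul0r addr0.
case: ifPn => [z2|_]; last by rewrite mulr0 !mul0r addr0.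
by rewrite powRM ?(ltW z1) ?(ltW z2)// lnM// mulrDr sinD; ring.
Qed.

(** At fixed [x], bounding [g u] by [G u^(1-2c)] and substituting [y = x u] produces [G x^(2c-2)]
    times the integral of [phi(y) y^(1-2c)]. Integrating against [f] turns the power of [x] into
    [sg]. *)
Lemma law_le (c G sg I : R) (phi : R -> R) :
  measurable_fun setT phi -> (forall y, 0 <= phi y) ->
  0 <= G -> {ae mu, forall u, 0 < u -> u `^ (2 * c - 1) * g u <= G} ->
  moment (2 * (c - 1)) f = sg%:E ->
  (\int[mu]_(y in Rpos) (phi y * y `^ (1 - 2 * c))%:E <= I%:E)%E ->
  (\int[nu]_y (phi y)%:E <= (G * sg * I)%:E)%E.
Proof.
move=> mphi phi0 G0 aeG momf intI.
pose K (z : RR) := (W z * phi (z.1 * z.2))%:E.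
have mK : measurable_fun setT K.
  apply/measurable_EFinP; apply: measurable_funM.
    by apply: measurable_funM; apply: measurableT_comp.
  apply: measurableT_comp => //.
  by apply: measurable_funM; [exact: measurable_fst|exact: measurable_snd].
have K0 z : (0 <= K z)%E by rewrite lee_fin !mulr_ge0.
rewrite tr// (fubini_tonelli1 K)//.
pose Psi y : R := ((fun y => phi y * y `^ (1 - 2 * c)) \_ Rpos) y.
have mPsi : measurable_fun setT Psi.
  apply: measurable_patch_Rpos; apply: measurable_funTS; exact: measurable_funM.
have Psi0 y : 0 <= Psi y.
  by rewrite /Psi patch_Rpos; case: ifP => // _; rewrite mulr_ge0// powR_ge0.
have intPsi : (\int[mu]_y (Psi y)%:E <= I%:E)%E.
  apply: le_trans intI; rewrite [leRHS]integral_mkcond le_eqVlt; apply/orP; left.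
  by apply/eqP; apply: eq_integral => y _; rewrite /Psi !patchE; case: ifP.
have I0 : 0 <= I.
  by rewrite -lee_fin; apply: le_trans intPsi; apply: integral_ge0 => y _; rewrite lee_fin.
have key x : (\int[mu]_u (W (x, u) * phi (x * u))%:E <=
    ((f \_ Rpos) x * (x `^ (2 * (c - 1)) * (G * I)))%:E)%E.
  have [x0|x0] := ltP 0 x; last first.
    rewrite integral0_eq; last by move=> u _; rewrite /= !patch_Rpos ltNge x0/= !mul0r.
    by rewrite patch_Rpos ltNge x0/= mul0r.
  pose r := x `^ (2 * (c - 1)).
  have mx : measurable_fun setT (fun u : R => x * u) by exact: measurable_funM.
  have mphix : measurable_fun setT (fun u => phi (x * u)) by exact: measurableT_comp.
  have mPsix : measurable_fun setT (fun u => Psi (x * u)) by exact: measurableT_comp.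
  have mWx : measurable_fun setT (fun u => (f \_ Rpos) x * (g \_ Rpos) u * phi (x * u)).
    by apply: measurable_funM => //; exact: measurable_funM.
  have C0 : 0 <= (f \_ Rpos) x * (r * G) * x by rewrite !mulr_ge0 ?powR_ge0// ltW.
  apply: (@le_trans _ _ (\int[mu]_u (((f \_ Rpos) x * (r * G) * x) * Psi (x * u))%:E)%E).
    apply: ae_ge0_le_integral => //.
    - by move=> u _; rewrite lee_fin !mulr_ge0.
    - by apply/measurable_EFinP.
    - by move=> u _; rewrite lee_fin mulr_ge0.
    - by apply/measurable_EFinP; exact: measurable_funM.
    - case: aeG => N [mN N0 sub]; exists N; split => // u /= ngu; apply: sub => /= ug.
      apply: ngu => _; rewrite lee_fin /= /Psi !patch_Rpos.
      rewrite pmulr_rgt0// x0; case: ifPn => [u0|_]; last by rewrite !(mul0r, mulr0).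
      rewrite (powRM _ (ltW x0) (ltW u0)).
      have e1 : x `^ (1 - 2 * c) * (r * x) = 1.
        rewrite /r -[X in _ * (_ * X) = _](powRr1 (ltW x0)) -!powRD ?(gt_eqF x0) ?implybT//.
        by rewrite (_ : _ + _ = 0) ?powRr0//; ring.
      have e2 : u `^ (2 * c - 1) * u `^ (1 - 2 * c) = 1.
        rewrite -powRD ?(gt_eqF u0) ?implybT//.
        by rewrite (_ : _ + _ = 0) ?powRr0//; ring.
      have gu : g u <= G * u `^ (1 - 2 * c).
        have := ler_wpM2r (powR_ge0 u (1 - 2 * c)) (ug u0).
        by rewrite mulrAC e2 mul1r.
      have f0 : 0 <= f x by have := fp0 x; rewrite patch_Rpos x0.
      have := ler_wpM2l (mulr_ge0 f0 (phi0 (x * u))) gu.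
      rewrite mulrAC => /le_trans; apply.
      have -> (k b ph : R) : f x * (r * G) * x * (ph * (k * b)) =
          k * (r * x) * (f x * ph * (G * b)) by ring.
      by rewrite e1 mul1r.
  have -> : (\int[mu]_u (((f \_ Rpos) x * (r * G) * x) * Psi (x * u))%:E =
      ((f \_ Rpos) x * (r * G))%:E * \int[mu]_u (x * Psi (x * u))%:E)%E.
    rewrite -ge0_integralZl_EFin//.
    - by apply: eq_integral => u _; rewrite -EFinM; congr EFin; ring.
    - by move=> u _; rewrite lee_fin mulr_ge0// ltW.
    - by apply/measurable_EFinP; exact: measurable_funM.
    - by rewrite !mulr_ge0// powR_ge0.
  rewrite integral_scale//.
  rewrite (_ : _ x * (_ * (G * I)) = (f \_ Rpos) x * (r * G) * I); last by rewrite /r; ring.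
  rewrite [leRHS]EFinM; apply: lee_wpmul2l => //.
  by rewrite lee_fin !mulr_ge0// powR_ge0.
apply: (@le_trans _ _ (\int[mu]_x ((f \_ Rpos) x * (x `^ (2 * (c - 1)) * (G * I)))%:E)%E).
  apply: ge0_le_integral => //.
  - by move=> x _; apply: integral_ge0 => u _; exact: K0.
  - exact: measurable_fun_fubini_tonelli_F.
  - apply/measurable_EFinP; apply: measurable_funM => //; apply: measurable_funM => //.
  - by move=> x _; exact: key.
have -> : (G * sg * I = sg * (G * I)) by ring.
rewrite EFinM -momf /moment -integral_patch_Rpos.
rewrite -ge0_integralZr//.
- rewrite le_eqVlt; apply/orP; left; apply/eqP; apply: eq_integral => x _.
  by rewrite -EFinM mulrA.
- apply/measurable_EFinP; apply: measurable_funM => //.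
- by move=> x _; rewrite lee_fin mulr_ge0// powR_ge0.
- by rewrite lee_fin mulr_ge0.
Qed.
End Measure.
End LawFacts.

(** * The estimator as an empirical mean *)

Section MellinContinuity.
Context {R : realType}.
Local Notation mu := (@lebesgue_measure R).

(** Dominated convergence with the bound [x^(c-1) |h x|]; [trig] stands for [cosk] or [sink].
    Continuity is the route to measurability of [mellin] in [t]. *)
Lemma continuous_mellin_part (c : R) (h : R -> R) (trig : R -> R -> R) :
  in_Lp 1 (c - 1) h ->
  (forall t, measurable_fun setT (trig t)) ->
  (forall t x, `|trig t x| <= x `^ (c - 1)) ->
  (forall x, continuous (fun t => trig t x)) ->
  continuous (fun t => \int[mu]_(x in Rpos) (trig t x * h x)).
Proof.
move=> Lh mtrig letrig ctrig u.
have mD : measurable (Rpos : set (measurableTypeR R)) by exact: measurable_Rpos.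
have ii v := integrable_weight Lh (mtrig v) (letrig v).
have mpow : measurable_fun setT (fun x : R => x `^ (c - 1)) by exact: measurable_powR.
have lpow x : `|x `^ (c - 1)| <= x `^ (c - 1) by rewrite ger0_norm ?powR_ge0.
have ig : mu.-integrable Rpos (EFin \o (fun x => `|x `^ (c - 1) * h x|)).
  exact: integrable_norm (integrable_weight Lh mpow lpow).
have := @continuity_under_integral R _ _ mu (fun t x => trig t x * h x) Rpos mD
  (u - 1) (u + 1) (fun v _ => ii v) _ _ ig; apply; last first.
- by rewrite inE/= in_itv/=; apply/andP; split; lra.
- move=> v _; apply: aeW => x _ /=; rewrite !normrM ler_wpM2r//.
  by rewrite (le_trans (letrig v x))// ler_norm.
- apply: aeW => x _ v _ /=; apply: cvgM; last exact: cvg_cst.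
  exact: ctrig.
Qed.

Lemma continuous_cosk (c x : R) : continuous (fun t => cosk c t x).
Proof.
move=> t; apply: cvgM; first exact: cvg_cst.
apply: (@continuous_comp _ _ _ (fun t : R => t * ln x)); last exact: continuous_cos.
exact: mulrr_continuous.
Qed.

Lemma continuous_sink (c x : R) : continuous (fun t => sink c t x).
Proof.
move=> t; apply: cvgM; first exact: cvg_cst.
apply: (@continuous_comp _ _ _ (fun t : R => t * ln x)); last exact: continuous_sin.
exact: mulrr_continuous.
Qed.

Lemma measurable_mellin (c : R) (h : R -> R) : in_Lp 1 (c - 1) h ->
  cmeasurable setT (mellin c h).
Proof.
move=> Lh; split; apply: continuous_measurable_fun.
- have -> : (fun t => complex.Re (mellin c h t)) =
      (fun t => \int[mu]_(x in Rpos) (cosk c t x * h x)).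
    by apply/funext => t; rewrite mellinE.
  exact: (continuous_mellin_part Lh (measurable_cosk c) (normr_cosk_le c) (@continuous_cosk c)).
- have -> : (fun t => complex.Im (mellin c h t)) =
      (fun t => \int[mu]_(x in Rpos) (sink c t x * h x)).
    by apply/funext => t; rewrite mellinE.
  exact: (continuous_mellin_part Lh (measurable_sink c) (normr_sink_le c) (@continuous_sink c)).
Qed.

Lemma mellin_conj (c t : R) (h : R -> R) : in_Lp 1 (c - 1) h ->
  mellin c h (- t) = conjc (mellin c h t).
Proof.
move=> Lh; rewrite !mellinE /=; congr Complex.
  by apply: eq_Rintegral => x _; rewrite /cosk mulNr cosN.
rewrite -[RHS]mulN1r -RintegralZl.
- by apply: eq_Rintegral => x _; rewrite /sink mulNr sinN mulrN mulNr mulN1r.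
- exact: measurable_Rpos.
- exact: integrable_weight Lh (measurable_sink c t) (normr_sink_le c t).
Qed.

Lemma measurable_cmul (D : set R) (F G : R -> R[i]) :
  cmeasurable D F -> cmeasurable D G -> cmeasurable D (fun t => F t * G t).
Proof.
move=> [mF1 mF2] [mG1 mG2]; split.
- rewrite (_ : (fun t => _) = (fun t => complex.Re (F t) * complex.Re (G t) -
    complex.Im (F t) * complex.Im (G t))); last first.
    by apply/funext => t; case: (F t) (G t) => a b [].
  by apply: measurable_funB; exact: measurable_funM.
- rewrite (_ : (fun t => _) = (fun t => complex.Re (F t) * complex.Im (G t) +
    complex.Im (F t) * complex.Re (G t))); last first.
    by apply/funext => t; case: (F t) (G t) => a b [].
  by apply: measurable_funD; exact: measurable_funM.
Qed.

Lemma measurable_cinv (D : set R) (F : R -> R[i]) :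
  cmeasurable D F -> cmeasurable D (fun t => (F t)^-1).
Proof.
move=> [mF1 mF2].
have mn : measurable_fun D (fun t =>
    (complex.Re (F t) ^+ 2 + complex.Im (F t) ^+ 2) `^ (-1)).
  apply: (@measurableT_comp _ _ _ _ _ _ (fun x : R => x `^ (-1))); first exact: measurable_powR.
  by apply: measurable_funD; exact: measurable_funX.
split.
- rewrite (_ : (fun t => _) = (fun t => complex.Re (F t) *
      (complex.Re (F t) ^+ 2 + complex.Im (F t) ^+ 2) `^ (-1))).
    exact: measurable_funM.
  apply/funext => t; case: (F t) => a b /=.
  by rewrite powR_inv1// addr_ge0 ?sqr_ge0.
- rewrite (_ : (fun t => _) = (fun t => - complex.Im (F t) *
      (complex.Re (F t) ^+ 2 + complex.Im (F t) ^+ 2) `^ (-1))).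
    by apply: measurable_funM => //; exact: measurable_funN.
  apply/funext => t; case: (F t) => a b /=.
  by rewrite powR_inv1 ?addr_ge0 ?sqr_ge0// mulNr.
Qed.

End MellinContinuity.

Section Estimator.
Context {R : realType}.
Local Notation mu := (@lebesgue_measure R).

Lemma integral_reflect_sym (D : set R) (F : R -> R) :
  measurable (D : set (measurableTypeR R)) -> (forall t, D (- t) <-> D t) ->
  measurable_fun D F ->
  (\int[mu]_(t in D) (F (- t))%:E = \int[mu]_(t in D) (F t)%:E)%E.
Proof.
move=> mD symD mF; rewrite integral_mkcond [RHS]integral_mkcond.
have mFD : measurable_fun setT (F \_ D) by exact/(measurable_restrictT _ mD).
transitivity (\int[mu]_t ((F \_ D) t)%:E)%E; last first.
  by apply: eq_integral => t _; rewrite !patchE; case: ifP.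
rewrite -(integral_reflect mFD).
apply: eq_integral => t _; rewrite !patchE.
have -> : (- t \in D) = (t \in D); last by case: ifP.
by apply/idP/idP; rewrite !inE => /symD.
Qed.

Lemma odd_Rintegral (D : set R) (F : R -> R) :
  measurable (D : set (measurableTypeR R)) -> (forall t, D (- t) <-> D t) ->
  (forall t, F (- t) = - F t) -> mu.-integrable D (EFin \o F) ->
  \int[mu]_(t in D) F t = 0.
Proof.
move=> mD symD oddF iF.
have mF : measurable_fun D F by case/integrableP: iF => /measurable_EFinP.
have e : \int[mu]_(t in D) F t = \int[mu]_(t in D) (-1 * F t).
  rewrite /Rintegral -(integral_reflect_sym mD symD mF); congr fine.
  by apply: eq_integral => t _; rewrite oddF mulN1r.
rewrite RintegralZl// mulN1r in e.
by move: e => /eqP; rewrite -addr_eq0 -mulr2n mulrn_eq0 /= => /eqP.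
Qed.

Lemma normc_sqr (z : R[i]) : Normc.normc z ^+ 2 = complex.Re z ^+ 2 + complex.Im z ^+ 2.
Proof. by case: z => a b /=; rewrite sqr_sqrtr// addr_ge0 ?sqr_ge0. Qed.

Lemma normc_ge0 (z : R[i]) : 0 <= Normc.normc z.
Proof. by case: z => a b /=; rewrite sqrtr_ge0. Qed.

Lemma normc_conj (z : R[i]) : Normc.normc (conjc z) = Normc.normc z.
Proof. by case: z => a b /=; rewrite sqrrN. Qed.

Lemma Re_le_normc (z : R[i]) : `|complex.Re z| <= Normc.normc z.
Proof.
by case: z => a b /=; rewrite -sqrtr_sqr ler_wsqrtr// lerDl sqr_ge0.
Qed.

Lemma sym_itv (k t : R) : `[- k, k]%classic (- t) <-> `[- k, k]%classic t.
Proof. by rewrite /= !in_itv/=; split => /andP[h1 h2]; apply/andP; split; lra. Qed.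

Variables (c : R) (Psi : R -> R[i]) (g : R -> R).
Hypothesis Lg : in_Lp 1 (c - 1) g.
Hypothesis mPsi : cmeasurable setT Psi.
Hypothesis conjPsi : forall t, conjc (Psi t) = Psi (- t).

Definition ratio (t : R) : R[i] := Psi (- t) / mellin c g t.
Definition re_ratio (t : R) : R := complex.Re (ratio t).
Definition im_ratio (t : R) : R := complex.Im (ratio t).

(* The summand of [theta_hat]: its imaginary part vanishes because [im_ratio] is odd
   and [re_ratio] even. *)
Definition hker (k y : R) : R :=
  (2 * pi)^-1 * (y `^ (c - 1) * cut_fourier re_ratio im_ratio k (ln y)).

Lemma measurable_ratio : cmeasurable setT ratio.
Proof.
apply: (@measurable_cmul _ setT (fun t => Psi (- t)) (fun t => (mellin c g t)^-1)).
  case: mPsi => m1 m2.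
  by split; apply: (measurableT_comp (f := fun t => _ (Psi t))).
by apply: measurable_cinv; exact: measurable_mellin.
Qed.

Lemma ratioN t : ratio (- t) = conjc (ratio t).
Proof.
by rewrite /ratio mellin_conj// rmorphM fmorphV /= conjPsi.
Qed.

Lemma re_ratioN t : re_ratio (- t) = re_ratio t.
Proof. by rewrite /re_ratio ratioN; case: (ratio t). Qed.

Lemma im_ratioN t : im_ratio (- t) = - im_ratio t.
Proof. by rewrite /im_ratio ratioN; case: (ratio t). Qed.

Lemma sqr_ratio t : re_ratio t ^+ 2 + im_ratio t ^+ 2 =
  Normc.normc (Psi t / mellin c g t) ^+ 2.
Proof.
by rewrite -normc_sqr /ratio -conjPsi !Normc.normcM normc_conj.
Qed.

Section FixedCutoff.
Variable k : R.
Hypothesis k0 : 0 < k.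
Local Notation D := (`[- k, k]%classic : set R).
Hypothesis fin_Delta : Delta c Psi g k \is a fin_num.

Let mD : measurable (D : set (measurableTypeR R)).
Proof. exact: measurable_itv. Qed.

Let mA : measurable_fun D re_ratio.
Proof. by apply: measurable_funTS; exact: measurable_ratio.1. Qed.

Let mB : measurable_fun D im_ratio.
Proof. by apply: measurable_funTS; exact: measurable_ratio.2. Qed.

Let pi2 : 0 < 2 * pi :> R. Proof. by rewrite mulr_gt0// pi_gt0. Qed.

Let pin0 : pi != 0 :> R. Proof. by rewrite gt_eqF// pi_gt0. Qed.

Lemma integrable_sqr_ratio :
  mu.-integrable D (EFin \o (fun t => re_ratio t ^+ 2 + im_ratio t ^+ 2)).
Proof.
apply/integrableP; split.
  by apply/measurable_EFinP; apply: measurable_funD; exact: measurable_funX.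
move: fin_Delta; rewrite /Delta.
rewrite (_ : (\int[mu]_(t in D) (Normc.normc (Psi t / mellin c g t) ^+ 2)%:E)%E =
  (\int[mu]_(t in D) `|(EFin \o (fun t => re_ratio t ^+ 2 + im_ratio t ^+ 2)%R) t|)%E); last first.
  apply: eq_integral => t _; rewrite -sqr_ratio /= ger0_norm// addr_ge0 ?sqr_ge0//.
set J := (X in (_ * X)%E).
have J0 : (0 <= J)%E by apply: integral_ge0 => t _; exact: abse_ge0.
rewrite -[X in (X < _)%E]/J; case: J J0 => [r _ _|_|//]; first by rewrite ltry.
by rewrite gt0_muley// lte_fin invr_gt0.
Qed.

Lemma fine_Delta : fine (Delta c Psi g k) =
  (2 * pi)^-1 * \int[mu]_(t in D) (re_ratio t ^+ 2 + im_ratio t ^+ 2).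
Proof.
have ii := integrable_sqr_ratio.
rewrite /Delta; transitivity (fine ((2 * pi)^-1%:E *
  \int[mu]_(t in D) (EFin \o (fun t => re_ratio t ^+ 2 + im_ratio t ^+ 2)%R) t)%E).
  by congr (fine (_ * _)%E); apply: eq_integral => t _; rewrite -sqr_ratio.
by rewrite fineM//; exact: integrable_fin_num.
Qed.

(** The constant is [(2 pi)^-2] from the kernel, times [2 k] from Bessel, times [2 pi Delta] for the
    integral. *)
Lemma hker_sqr_le y : hker k y ^+ 2 <=
  (y `^ (c - 1)) ^+ 2 * (k * fine (Delta c Psi g k) / pi).
Proof.
have h := cut_fourier_sqr_le k0 mA mB integrable_sqr_ratio (ln y).
rewrite fine_Delta /hker exprMn exprMn; set S := \int[mu]_(t in _) _ in h *.
have -> : k * ((2 * pi)^-1 * S) / pi = ((2 * pi)^-1) ^+ 2 * (2 * k * S).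
  by move: (pi : R) pin0 => p p0; field.
rewrite mulrCA ler_wpM2l ?sqr_ge0// ler_wpM2l ?sqr_ge0//.
Qed.

Lemma measurable_hker : measurable_fun setT (hker k).
Proof.
apply: measurable_funM => //; apply: measurable_funM; first exact: measurable_powR.
exact: (measurable_cut_fourier_ln mA mB integrable_sqr_ratio).
Qed.

(** The weight is the one of [law_le]: multiplied by the factor [y^(2c-2)] of the squared kernel it
    leaves [1 / y], the weight of [plancherel_le]. *)
Lemma hker_plancherel :
  (\int[mu]_(y in Rpos) (hker k y ^+ 2 * y `^ (1 - 2 * c))%:E <=
   (fine (Delta c Psi g k))%:E)%E.
Proof.
have := plancherel_le k0 mA mB integrable_sqr_ratio.
set S := \int[mu]_(t in _) _ => h.
have mRpos : measurable (Rpos : set (measurableTypeR R)) by exact: measurable_Rpos.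
have pc : 0 <= ((2 * pi)^-1) ^+ 2 :> R by exact: sqr_ge0.
have := lee_wpmul2l (_ : (0 <= (((2 * pi)^-1) ^+ 2)%:E)%E) h; rewrite lee_fin => /(_ pc).
rewrite -ge0_integralZl_EFin//; last 2 first.
- by move=> y _; rewrite lee_fin mulr_ge0 ?sqr_ge0 ?powR_ge0.
- apply/measurable_EFinP; apply: measurable_funM.
    by apply: measurable_funX; exact: (measurable_cut_fourier_ln mA mB integrable_sqr_ratio).
  by apply: measurable_funTS; exact: measurable_powR.
rewrite fine_Delta -/S.
have -> : (((2 * pi)^-1 ^+ 2)%:E * (2 * pi * S)%:E)%E = ((2 * pi)^-1 * S)%:E.
  by rewrite -EFinM; congr EFin; move: (pi : R) pin0 => p p0; field.
apply: le_trans; rewrite le_eqVlt; apply/orP; left; apply/eqP; apply: eq_integral => y.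
rewrite mem_Rpos => y0; rewrite -EFinM; congr EFin; rewrite /hker !exprMn.
have -> : y `^ (-1) = (y `^ (c - 1)) ^+ 2 * y `^ (1 - 2 * c).
  rewrite -powR_mulrn ?powR_ge0// -powRrM -powRD ?(gt_eqF y0) ?implybT//.
  by congr (_ `^ _); ring.
by ring.
Qed.

End FixedCutoff.
End Estimator.

Local Open Scope complex_scope.

(** * Real form of the estimator and of the functional, and the bias *)

Section Targets.
Context {R : realType}.
Local Notation mu := (@lebesgue_measure R).
Variables (c : R) (Psi : R -> R[i]).
Hypothesis mPsi : cmeasurable setT Psi.
Hypothesis conjPsi : forall t, conjc (Psi t) = Psi (- t).

Let pi2 : 0 < 2 * pi :> R. Proof. by rewrite mulr_gt0// pi_gt0. Qed.

Lemma natc_inv (n : nat) : (n%:R^-1 : R[i]) = (n%:R^-1)%:C.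
Proof. by rewrite -(rmorph_nat (@real_complex R)) -fmorphV. Qed.

Lemma mellin_hatE (n : nat) (y : 'I_n -> R) t : mellin_hat y c t =
  Complex (n%:R^-1 * \sum_j cosk c t (y j)) (n%:R^-1 * \sum_j sink c t (y j)).
Proof.
rewrite /mellin_hat natc_inv.
have -> : \sum_(j < n) mellin_kernel c t (y j) =
    Complex (\sum_j cosk c t (y j)) (\sum_j sink c t (y j)).
  elim/big_rec3: _ => [|j a b z _ ->]; first by [].
  by [].
by rewrite /=; congr Complex; rewrite mul0r ?subr0 ?addr0.
Qed.

Section Hat.
Variables (g : R -> R).
Hypothesis Lg : in_Lp 1 (c - 1) g.

Lemma theta_hatE (n : nat) (y : 'I_n -> R) (k : R) : 0 < k ->
  Delta c Psi g k \is a fin_num ->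
  theta_hat y c Psi g k = (n%:R^-1 * \sum_j hker c Psi g k (y j))%:C.
Proof.
move=> k0 fD.
have mD : measurable (`[- k, k]%classic : set (measurableTypeR R)) by exact: measurable_itv.
have mA : measurable_fun `[- k, k]%classic (re_ratio c Psi g).
  by apply: measurable_funTS; exact: (measurable_ratio Lg mPsi).1.
have mB : measurable_fun `[- k, k]%classic (im_ratio c Psi g).
  by apply: measurable_funTS; exact: (measurable_ratio Lg mPsi).2.
have isq := integrable_sqr_ratio Lg mPsi conjPsi fD.
have iosc := integrable_osc mA mB isq.
pose F (j : 'I_n) t := y j `^ (c - 1) * osc (re_ratio c Psi g) (im_ratio c Psi g) (ln (y j)) t.
(* [F] and [G] are the real and imaginary parts of the summand: [osc B (- A)] is the imaginary part
   of [(A + i B) exp(i t u)]. Here it is odd in [t] and integrates to 0. *)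
pose G (j : 'I_n) t := y j `^ (c - 1) * osc (im_ratio c Psi g) (fun t => - re_ratio c Psi g t) (ln (y j)) t.
have iF j : mu.-integrable `[- k, k]%classic (EFin \o F j).
  exact: (integrableZl mD _ (iosc _)).
have isq' : mu.-integrable `[- k, k]%classic
    (EFin \o (fun t => im_ratio c Psi g t ^+ 2 + (- re_ratio c Psi g t) ^+ 2)).
  by apply: eq_integrable isq => // t _ /=; rewrite sqrrN addrC.
have mNA : measurable_fun `[- k, k]%classic (fun t => - re_ratio c Psi g t).
  exact: measurable_funN.
have iG j : mu.-integrable `[- k, k]%classic (EFin \o G j).
  exact: (integrableZl mD _ (integrable_osc mB mNA isq' _)).
have [i1 e1] := Rintegral_sum (index_enum _) mD iF.
have [i2 e2] := Rintegral_sum (index_enum _) mD iG.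
have e t : Psi (- t) * (mellin_hat y c t / mellin c g t) =
    Complex (n%:R^-1 * \sum_j F j t) (n%:R^-1 * \sum_j G j t).
  have -> : Psi (- t) * (mellin_hat y c t / mellin c g t) = ratio c Psi g t * mellin_hat y c t.
    by rewrite /ratio mulrA mulrAC.
  have -> : ratio c Psi g t = Complex (re_ratio c Psi g t) (im_ratio c Psi g t).
    by rewrite /re_ratio /im_ratio; case: (ratio _ _ _ _).
  rewrite mellin_hatE /=; congr Complex.
    rewrite !mulr_sumr -sumrB; apply: eq_bigr => j _; rewrite /F /osc /cosk /sink; ring.
  rewrite !mulr_sumr -big_split; apply: eq_bigr => j _; rewrite /= /G /osc /cosk /sink; ring.
rewrite /theta_hat /cintegral.
have -> : \int[mu]_(t in `[- k, k]) complex.Re (Psi (- t) * (mellin_hat y c t / mellin c g t)) =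
    n%:R^-1 * \sum_j y j `^ (c - 1) * cut_fourier (re_ratio c Psi g) (im_ratio c Psi g) k (ln (y j)).
  under eq_Rintegral do rewrite e/=.
  rewrite RintegralZl// e1; congr (_ * _); apply: eq_bigr => j _.
  by rewrite RintegralZl.
have -> : \int[mu]_(t in `[- k, k]) complex.Im (Psi (- t) * (mellin_hat y c t / mellin c g t)) = 0.
  under eq_Rintegral do rewrite e/=.
  rewrite RintegralZl// e2 big1 ?mulr0// => j _; rewrite RintegralZl//; last exact: integrable_osc mB mNA isq' _.
  rewrite odd_Rintegral ?mulr0//.
  - exact: sym_itv.
  - by move=> t; rewrite /osc im_ratioN// re_ratioN// !mulNr cosN sinN; ring.
  - exact: integrable_osc.
have -> : \sum_j hker c Psi g k (y j) = (2 * pi)^-1 *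
    \sum_j y j `^ (c - 1) * cut_fourier (re_ratio c Psi g) (im_ratio c Psi g) k (ln (y j)).
  by rewrite mulr_sumr.
rewrite mulrCA; set S := n%:R^-1 * _.
by apply/eqP; rewrite eq_complex /= !(mulr0, mul0r, subr0, addr0) !eqxx.
Qed.

End Hat.

Variables (f : R -> R).
Hypothesis Lf : in_Lp 1 (c - 1) f.
Hypothesis iPf : cintegrable setT (fun t => Psi t * mellin c f t).

Definition mass (t : R) : R := Normc.normc (Psi t * mellin c f t).
Definition target (t : R) : R := complex.Re (Psi (- t) * mellin c f t).
(** The functional restricted to frequencies in [D]: the whole line gives [theta], and [[-k, k]]
    gives the mean of the estimator with cut-off [k]. *)
Definition theta_on (D : set R) : R := (2 * pi)^-1 * \int[mu]_(t in D) target t.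

Let cm : cmeasurable setT (fun t => Psi t * mellin c f t).
Proof. by apply: measurable_cmul => //; exact: measurable_mellin. Qed.

Lemma massN t : mass (- t) = mass t.
Proof. by rewrite /mass mellin_conj// -conjPsi -rmorphM normc_conj. Qed.

Lemma normc_targetE t : Normc.normc (Psi (- t) * mellin c f t) = mass t.
Proof. by rewrite /mass !Normc.normcM -conjPsi normc_conj. Qed.

Lemma mass_ge0 t : 0 <= mass t. Proof. exact: normc_ge0. Qed.

Lemma measurable_mass D : measurable_fun D mass.
Proof.
apply: measurable_funTS.
have -> : mass = fun t => (complex.Re (Psi t * mellin c f t) ^+ 2 +
    complex.Im (Psi t * mellin c f t) ^+ 2) `^ (2^-1).
  apply/funext => t; rewrite -normc_sqr powR12_sqrt ?sqr_ge0// sqrtr_sqr ger0_norm//.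
  exact: normc_ge0.
apply: (@measurableT_comp _ _ _ _ _ _ (fun x => x `^ 2^-1)); first exact: measurable_powR.
by case: cm => m1 m2; apply: measurable_funD; exact: measurable_funX.
Qed.

Lemma normc_le (z : R[i]) : Normc.normc z <= `|complex.Re z| + `|complex.Im z|.
Proof.
rewrite -(ler_pXn2r (n := 2))// ?nnegrE ?normc_ge0 ?addr_ge0//.
rewrite normc_sqr sqrrD !real_normK ?num_real// -subr_ge0.
by have : 0 <= `|complex.Re z| * `|complex.Im z|; [exact: mulr_ge0|lra].
Qed.

Lemma integrable_mass : mu.-integrable setT (EFin \o mass).
Proof.
have [i1 i2] := iPf.
have i12 := integrableD measurableT (integrable_abse i1) (integrable_abse i2).
apply: le_integrable i12 => //; first by apply/measurable_EFinP; exact: measurable_mass.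
move=> t _ /=; rewrite lee_fin.
rewrite ger0_norm ?mass_ge0// ger0_norm ?addr_ge0//.
exact: normc_le.
Qed.

Let ctarget : cmeasurable setT (fun t => Psi (- t) * mellin c f t).
Proof.
apply: (@measurable_cmul _ setT (fun t => Psi (- t)) (fun t => mellin c f t)).
  case: mPsi => m1 m2.
  by split; apply: (measurableT_comp (f := fun t => _ (Psi t))).
exact: measurable_mellin.
Qed.

Lemma integrable_target D : measurable (D : set (measurableTypeR R)) ->
  mu.-integrable D (EFin \o target).
Proof.
move=> mD; apply: (@integrableS _ _ _ mu setT) => //.
apply: le_integrable integrable_mass => //.
  by apply/measurable_EFinP; case: ctarget.
move=> t _ /=; rewrite lee_fin [leRHS]ger0_norm ?mass_ge0// -normc_targetE.
exact: Re_le_normc.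
Qed.

Lemma thetaE : theta c Psi f = (theta_on setT)%:C.
Proof.
rewrite /theta /cintegral.
have -> : \int[mu]_t complex.Im (Psi (- t) * mellin c f t) = 0.
  apply: odd_Rintegral => //.
  - move=> t; rewrite -(conjPsi (- t)) mellin_conj// -rmorphM.
    by case: (Psi (- t) * _).
  - apply: le_integrable integrable_mass => //.
      by apply/measurable_EFinP; case: ctarget.
    move=> t _ /=; rewrite lee_fin [leRHS]ger0_norm ?mass_ge0// -normc_targetE.
    by case: (_ * _) => a b /=; rewrite -sqrtr_sqr ler_wsqrtr// lerDr sqr_ge0.
by apply/eqP; rewrite eq_complex /= !(mulr0, mul0r, subr0, addr0) !eqxx.
Qed.

Lemma tail_fin k : tail_norm c Psi f k \is a fin_num.
Proof.
apply: (@integrable_fin_num _ _ _ mu) => //.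
exact: integrableS integrable_mass.
Qed.

Lemma mass_outside k : 0 < k ->
  (\int[mu]_(t in ~` `[(- k)%R, k]%classic) (mass t)%:E <= 2%:E * tail_norm c Psi f k)%E.
Proof.
move=> k0.
pose E := (`]-oo, - k]%classic : set R); pose F := (`[k, +oo[%classic : set R).
have mE : measurable (E : set (measurableTypeR R)) by exact: measurable_itv.
have mF : measurable (F : set (measurableTypeR R)) by exact: measurable_itv.
have mm D : measurable_fun D (EFin \o mass).
  by apply/measurable_EFinP; exact: measurable_mass.
apply: (@le_trans _ _ (\int[mu]_(t in E `|` F) (mass t)%:E)%E).
  apply: ge0_subset_integral => //.
  - by apply: measurableC; exact: measurable_itv.
  - exact: measurableU.
  - exact: mm.
  - by move=> t _; rewrite lee_fin mass_ge0.
  - move=> t /=; rewrite /E /F /= !in_itv/= andbT => /negP; rewrite negb_and -!ltNge.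
    by move=> /orP[/ltW|/ltW]; [left|right].
rewrite (@ge0_integral_setU _ _ _ mu E F mE mF (EFin \o mass) (mm _)); last 2 first.
- by move=> t _; rewrite lee_fin mass_ge0.
- apply/disj_setPS => t []; rewrite /E /F/= !in_itv/= andbT => h1 h2.
  by have := le_trans h2 h1; rewrite leNgt; move/negP; apply; lra.
have -> : (\int[mu]_(t in E) (EFin \o mass) t = \int[mu]_(t in F) (EFin \o mass) t)%E.
  rewrite integral_mkcond [RHS]integral_mkcond.
  have mFm : measurable_fun setT (mass \_ F).
    by apply/(measurable_restrictT _ mF); exact: measurable_mass.
  transitivity (\int[mu]_t ((mass \_ F) t)%:E)%E; last first.
    by apply: eq_integral => t _; rewrite !patchE; case: ifP.
  rewrite -(integral_reflect mFm); apply: eq_integral => t _; rewrite !patchE massN.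
  have -> : (- t \in F) = (t \in E); last by case: ifP.
  by apply/idP/idP; rewrite !inE /E /F/= !in_itv/= andbT; lra.
have -> : (\int[mu]_(t in F) (EFin \o mass) t = tail_norm c Psi f k)%E by [].
by rewrite -(fineK (tail_fin k)) -EFinD -EFinM lee_fin; lra.
Qed.

(** The two symmetric tails carry the same mass; the resulting factor 2 is absorbed by [1 / (2 pi)].
    The set [D] is the whole line for the bias at [k], and a longer interval when two cut-offs are
    compared. *)
Lemma bias_le (D : set R) (k : R) : 0 < k ->
  measurable (D : set (measurableTypeR R)) -> `[- k, k]%classic `<=` D ->
  `|theta_on D - theta_on `[- k, k]| <= fine (tail_norm c Psi f k).
Proof.
move=> k0 mD sub.
pose I := (`[- k, k]%classic : set R).
have mI : measurable (I : set (measurableTypeR R)) by exact: measurable_itv.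
have mDI : measurable (D `\` I : set (measurableTypeR R)) by exact: measurableD.
have DE : D = I `|` (D `\` I) by rewrite setDUK.
have -> : theta_on D - theta_on I = (2 * pi)^-1 * \int[mu]_(t in D `\` I) target t.
  rewrite /theta_on -mulrBr; congr (_ * _); rewrite {1}DE Rintegral_setU//.
  - by rewrite addrAC subrr add0r.
  - by rewrite -DE; exact: integrable_target.
  - by rewrite disj_set2E setDIK.
have h : `|\int[mu]_(t in D `\` I) target t| <= 2 * fine (tail_norm c Psi f k).
  apply: le_trans (le_normr_Rintegral mDI (integrable_target mDI)) _.
  rewrite -lee_fin EFinM (fineK (tail_fin k)); apply: (le_trans _ (mass_outside k0)).
  rewrite /Rintegral fineK; last first.
    exact: (integrable_fin_num mDI (integrable_norm (integrable_target mDI))).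
  apply: (@le_trans _ _ (\int[mu]_(t in D `\` I) (mass t)%:E)%E).
    apply: ge0_le_integral => //.
    - by apply/measurable_EFinP; case/integrableP: (integrable_norm (integrable_target mDI)) => /measurable_EFinP.
    - by apply/measurable_EFinP; exact: measurable_mass.
    - move=> t _; rewrite lee_fin -normc_targetE; exact: Re_le_normc.
  apply: ge0_subset_integral => //.
  - exact: measurableC.
  - by apply/measurable_EFinP; exact: measurable_mass.
  - by move=> t _; rewrite lee_fin mass_ge0.
rewrite normrM gtr0_norm ?invr_gt0//.
apply: le_trans (ler_wpM2l _ h) _; first by rewrite invr_ge0 ltW.
have t0 : 0 <= fine (tail_norm c Psi f k).
  by apply: fine_ge0; apply: integral_ge0 => t _; rewrite lee_fin normc_ge0.
rewrite mulrA ler_piMl// mulrC ler_pdivrMr// mul1r ler_pMr//.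
by rewrite (le_trans _ (pi_ge2 R))// ler1n.
Qed.

End Targets.

(** * The mean of the kernel *)

Section LawKernel.
Context {R : realType}.
Local Notation mu := (@lebesgue_measure R).
Variables (c : R) (Psi : R -> R[i]) (f g : R -> R).
Hypothesis df : is_density f.
Hypothesis dg : is_density g.
Hypothesis Lf : in_Lp 1 (c - 1) f.
Hypothesis Lg : in_Lp 1 (c - 1) g.
Hypothesis g_neq0 : forall t, mellin c g t != 0.
Hypothesis mPsi : cmeasurable setT Psi.
Hypothesis conjPsi : forall t, conjc (Psi t) = Psi (- t).
Hypothesis iPf : cintegrable setT (fun t => Psi t * mellin c f t).
Variable nu : probability R R.
Hypothesis nuE : forall A : set R, measurable A ->
  (nu A = \int[mu]_(y in A `&` Rpos) dens_Y f g y)%E.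

Lemma moment_lty (h : R -> R) : is_density h -> in_Lp 1 (c - 1) h ->
  (moment (c - 1) h < +oo)%E.
Proof.
move=> [_ h0 _] [_]; congr (_ < _)%E; apply: eq_integral => x.
rewrite mem_Rpos => x0; rewrite powRr1// mulrC ger0_norm//; exact: h0.
Qed.

Lemma moment_law_fin : (\int[nu]_y (y `^ (c - 1))%:E \is a fin_num)%E.
Proof.
rewrite (moment_law df dg nuE) fin_numM// ge0_fin_numE ?moment_lty//.
- exact: ltW (moment_gt0 _ df).
- exact: ltW (moment_gt0 _ dg).
Qed.

Variable k : R.
Hypothesis k0 : 0 < k.
Hypothesis fin_Delta : Delta c Psi g k \is a fin_num.
Local Notation D := (`[- k, k]%classic : set R).
Local Notation A := (re_ratio c Psi g).
Local Notation B := (im_ratio c Psi g).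

Let mD : measurable (D : set (measurableTypeR R)).
Proof. exact: measurable_itv. Qed.

Let mA : measurable_fun D A.
Proof. by apply: measurable_funTS; exact: (measurable_ratio Lg mPsi).1. Qed.

Let mB : measurable_fun D B.
Proof. by apply: measurable_funTS; exact: (measurable_ratio Lg mPsi).2. Qed.

Let isq := integrable_sqr_ratio Lg mPsi conjPsi fin_Delta.

Let F (z : R * measurableTypeR R) : R :=
  (A \_ D) z.2 * cosk c z.2 z.1 - (B \_ D) z.2 * sink c z.2 z.1.

Let mF : measurable_fun setT (EFin \o F).
Proof.
have mtl : measurable_fun setT (fun z : R * measurableTypeR R => z.2 * ln z.1).
  apply: measurable_funM; first exact: measurable_snd.
  by apply: measurableT_comp => //; exact: measurable_ln.
have mpow : measurable_fun setT (fun z : R * measurableTypeR R => z.1 `^ (c - 1)).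
  by apply: (@measurableT_comp _ _ _ _ _ _ (fun x => x `^ (c - 1))) => //; exact: measurable_powR.
have mcos : measurable_fun setT (@cos R).
  by apply: continuous_measurable_fun; exact: continuous_cos.
have msin : measurable_fun setT (@sin R).
  by apply: continuous_measurable_fun; exact: continuous_sin.
have mAD : measurable_fun setT (A \_ D) by exact/(measurable_restrictT _ mD).
have mBD : measurable_fun setT (B \_ D) by exact/(measurable_restrictT _ mD).
apply/measurable_EFinP; apply: measurable_funB; apply: measurable_funM.
- by apply: measurableT_comp.
- by apply: measurable_funM => //; exact: measurableT_comp.
- by apply: measurableT_comp.
- by apply: measurable_funM => //; exact: measurableT_comp.
Qed.

Let FE y t : F (y, t) = if t \in D then y `^ (c - 1) * osc A B (ln y) t else 0.
Proof.
rewrite /F /= !patchE; case: ifP => _; last by rewrite !mul0r subr0.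
by rewrite /osc /cosk /sink; ring.
Qed.

(** The integrand is dominated by [y^(c-1) (1 + A ^+ 2 + B ^+ 2)], where the variables separate; the
    first factor has a finite mean by [moment_law_fin]. *)
Let iF : (nu \x mu)%E.-integrable setT (EFin \o F).
Proof.
apply/integrable12ltyP => //.
pose K := \int[mu]_(t in D) (1 + (A t ^+ 2 + B t ^+ 2)).
have iK := integrable_sqD isq 1.
have mpow : measurable_fun setT (fun x : R => x `^ (c - 1)) by exact: measurable_powR.
apply: (@le_lt_trans _ _ (\int[nu]_y ((y `^ (c - 1))%:E * K%:E))%E).
  apply: ge0_le_integral => //.
  - by move=> y _; apply: integral_ge0 => t _; exact: abse_ge0.
  - apply: (measurable_fun_fubini_tonelli_F (abse \o (EFin \o F))) => //.
    exact: measurableT_comp.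
    by move=> z; exact: abse_ge0.
  - by apply: emeasurable_funM => //; exact/measurable_EFinP.
  - move=> y _; rewrite /K /Rintegral fineK; last exact: integrable_fin_num.
    rewrite -ge0_integralZl_EFin ?powR_ge0//; last 2 first.
    + by move=> t _; rewrite lee_fin addr_ge0 ?addr_ge0 ?sqr_ge0.
    + by case/integrableP : iK.
    rewrite [leRHS]integral_mkcond; apply: ge0_le_integral => //.
    + apply: measurableT_comp => //; apply: (measurableT_comp mF); exact: measurable_pair1.
    + apply/(measurable_restrictT _ mD); apply: measurable_funeM.
      by case/integrableP : iK.
    + move=> t _; rewrite /= FE patchE; case: ifP => _; last by rewrite normr0.
      rewrite -EFinM lee_fin normrM (ger0_norm (powR_ge0 _ _)) ler_wpM2l ?powR_ge0//.
      have := osc_sqr_le (A t) (B t) (t * ln y); rewrite -/(osc A B (ln y) t) => h.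
      have h0 : 0 <= A t ^+ 2 + B t ^+ 2 by rewrite addr_ge0// sqr_ge0.
      by rewrite ler_norml; apply/andP; split; nra.
have K0 : (0 <= K%:E)%E.
  by rewrite lee_fin Rintegral_ge0// => t _; rewrite addr_ge0 ?addr_ge0 ?sqr_ge0.
rewrite ge0_integralZr//; first by rewrite ltey_eq fin_numM ?moment_law_fin.
  by apply/measurable_EFinP; exact: measurable_powR.
by move=> y _; rewrite lee_fin powR_ge0.
Qed.

Let hkerE y : ((hker c Psi g k y)%:E = (2 * pi)^-1%:E * \int[mu]_t (EFin \o F) (y, t))%E.
Proof.
rewrite /hker EFinM; congr (_ * _)%E.
rewrite /cut_fourier -RintegralZl//; last exact: integrable_osc.
rewrite /Rintegral fineK; last first.
  apply: integrable_fin_num => //.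
  exact: (integrableZl mD (y `^ (c - 1)) (integrable_osc mA mB isq (ln y))).
rewrite integral_mkcond; apply: eq_integral => t _.
by rewrite patchE /= FE; case: ifP.
Qed.

(** After Fubini, [law_char] supplies the factor [mellin c f t * mellin c g t], and the nonzero
    transform of [g] cancels against the denominator of [ratio]. *)
Lemma law_hker : (\int[nu]_y (hker c Psi g k y)%:E = (theta_on c Psi f D)%:E)%E.
Proof.
under eq_integral do rewrite hkerE.
rewrite integralZl//; last exact: (integrable_fubini_F iF).
rewrite (Fubini iF) /theta_on EFinM; congr (_ * _)%E.
transitivity (\int[mu]_(t in D) (target c Psi f t)%:E)%E; last first.
  rewrite /Rintegral fineK//; apply: integrable_fin_num => //.
  exact: integrable_target.
rewrite [RHS]integral_mkcond; apply: eq_integral => t _.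
have [cE sE] := law_char df dg nuE t Lf Lg.
have mc := measurable_cosk c t; have ms := measurable_sink c t.
have ib (r : R -> R) : measurable_fun setT r -> (forall y, `|r y| <= y `^ (c - 1)) ->
    nu.-integrable setT (EFin \o r).
  move=> mr hr; apply/integrableP; split; first exact/measurable_EFinP.
  apply: le_lt_trans (_ : (\int[nu]_y (y `^ (c - 1))%:E < +oo)%E); last first.
    by rewrite ltey_eq moment_law_fin.
  apply: ge0_le_integral => //.
  - by apply: measurableT_comp => //; exact/measurable_EFinP.
  - by apply/measurable_EFinP; exact: measurable_powR.
  - by move=> y _ /=; rewrite lee_fin.
have ic := ib _ mc (normr_cosk_le c t).
have is_ := ib _ ms (normr_sink_le c t).
rewrite patchE /F /=.
have -> : (\int[nu]_x ((A \_ D) t * cosk c t x - (B \_ D) t * sink c t x)%:E =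
  ((A \_ D) t)%:E * \int[nu]_x (cosk c t x)%:E - ((B \_ D) t)%:E * \int[nu]_x (sink c t x)%:E)%E.
  rewrite -integralZl// -integralZl// -integralB//; exact: integrableZl.
rewrite cE sE -!EFinM -EFinB !patchE; case: ifP => _; last by rewrite !mul0r subr0.
congr EFin; rewrite /target.
have -> : Psi (- t) = ratio c Psi g t * mellin c g t by rewrite /ratio mulfVK.
rewrite /re_ratio /im_ratio.
by case: (ratio _ _ _ _) (mellin c f t) (mellin c g t) => a b [a1 b1] [a2 b2] /=; ring.
Qed.

End LawKernel.

(** * Moment bounds for independent samples *)

Section Independence.
Context d (T : measurableType d) (R : realType) (P : probability T R) (n : nat).
Variable Y : 'I_n -> {RV P >-> R}.
Hypothesis indY : mutually_independent Y.

Let good (j : 'I_n) (phi : R -> R) := [/\ measurable_fun setT phi,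
  forall y, 0 <= phi y & (\int[P]_w (phi (Y j w))%:E < +oo)%E].

Let mphiY (j : 'I_n) (phi : R -> R) : measurable_fun setT phi ->
  measurable_fun setT (fun w => phi (Y j w)).
Proof. by move=> mphi; apply: measurableT_comp. Qed.

Let finE j phi : good j phi ->
  (\int[P]_w (phi (Y j w))%:E = (\int[P]_w phi (Y j w))%:E)%E.
Proof.
move=> [mphi phi0 ltphi]; rewrite /Rintegral fineK// ge0_fin_numE//.
by apply: integral_ge0 => w _; rewrite lee_fin.
Qed.

(* The indicators are traded for general functions one coordinate at a time. *)
Let integral_prod_step (m : nat) : forall phi : 'I_n -> R -> R,
  (forall j, good j (phi j)) ->
  (forall j : 'I_n, (m <= j)%N -> exists2 A : set R, measurable A & phi j = \1_A) ->
  (\int[P]_w (\prod_j phi j (Y j w))%:E = (\prod_j \int[P]_w phi j (Y j w))%:E)%E.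
Proof.
elim: m => [|m IH] phi gphi indphi.
  (* When every factor is an indicator, the claim is independence over the full index set. *)
  have /choice[A AP] : forall j : 'I_n, exists A : set R, measurable A /\ phi j = \1_A.
    by move=> j; have [A mA e] := indphi j isT; exists A.
  have mA j := (AP j).1.
  have := @indY [set: 'I_n]%SET A mA.
  have -> : \bigcap_(j in [set` [set: 'I_n]%SET]) (Y j @^-1` A j) =
      [set w | forall j, A j (Y j w)].
    apply/seteqP; split => w /=; first by move=> h j; apply: (h j); rewrite /= inE.
    by move=> h j _; exact: h.
  set E := [set w | _] => PE.
  have EE : E = \bigcap_(j in [set: 'I_n]) (Y j @^-1` A j).
    by apply/seteqP; split => w /= h j; [move=> _; exact: h|exact: (h j Logic.I)].
  have mE : measurable E.
    rewrite EE; apply: fin_bigcap_measurable => [|j _]; first exact: finite_finset.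
    by rewrite -[_ @^-1` _]setTI; apply: (measurable_funP (Y j)).
  transitivity (\int[P]_w (\1_E w)%:E)%E.
    apply: eq_integral => w _; congr EFin; rewrite indicE.
    case: (boolP (w \in E)).
      rewrite inE => wE; rewrite big1// => j _; rewrite (AP j).2 indicE mem_set//.
    move=> wE; have [j nA] : exists j, ~ A j (Y j w).
      by apply/existsNP => h; move: wE; rewrite notin_setE; apply.
    by rewrite (bigD1 j)//= (AP j).2 indicE memNset// mul0r.
  rewrite integral_indic// setIT -[LHS]/(P E) PE -prodEFin; apply: eq_big => [j|j _]; first by rewrite inE.
  rewrite -finE// (AP j).2 -[in RHS]/(\int[P]_w (\1_(Y j @^-1` A j) w)%:E)%E.
  rewrite integral_indic ?setIT//.
  have := measurable_funP (Y j) measurableT _ (mA j); rewrite setTI.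
  by apply.
have [mn|nm] := ltnP m n; last first.
  apply: IH => // j mj; apply: indphi; have := leq_trans nm mj.
  by rewrite leqNgt ltn_ord.
pose i := Ordinal mn.
pose phiA (A : set R) j : R -> R := if j == i then \1_A else phi j.
pose W1 w := \prod_(j | j != i) phi j (Y j w).
pose c := \prod_(j | j != i) \int[P]_w phi j (Y j w).
have mW1 : measurable_fun setT W1.
  have -> : W1 = fun w => \prod_(j <- [seq j <- index_enum 'I_n | j != i]) phi j (Y j w).
    by apply/funext => w; rewrite big_filter.
  by apply: measurable_prod => j _; apply: mphiY; case: (gphi j).
have W10 w : 0 <= W1 w by apply: prodr_ge0 => j _; case: (gphi j).
have c0 : 0 <= c.
  by apply: prodr_ge0 => j _; apply: Rintegral_ge0 => w _; case: (gphi j).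
have [mi i0 _] := gphi i.
(* The weight is the product of the other coordinates on one side and the product of their means on
   the other; the two sides agree on indicators of [Y i] by the induction hypothesis. *)
have := @weighted_transfer _ _ _ T T R R P P W1 (cst c) (Y i) (Y i) mW1
  (measurable_cst _) (measurable_funP (Y i)) (measurable_funP (Y i)) W10 (fun=> c0) _
  (phi i) mi.
have -> : (\int[P]_x (W1 x * phi i (Y i x))%:E = \int[P]_w (\prod_j phi j (Y j w))%:E)%E.
  by apply: eq_integral => w _; rewrite [in RHS](bigD1 i)//= mulrC.
have cE phi' : good i phi' -> (\int[P]_x (cst c x * phi' (Y i x))%:E =
    (c * \int[P]_w phi' (Y i w))%:E)%E.
  move=> gphi'; have [m' p0 _] := gphi'.
  rewrite EFinM -finE// -ge0_integralZl_EFin//.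
    by move=> w _; rewrite lee_fin.
  by apply/measurable_EFinP; exact: mphiY.
rewrite cE//; rewrite [in X in _ -> X](bigD1 i)//= mulrC; apply.
move=> A mA.
have gA : good i \1_A.
  split; [exact: measurable_indic|by move=> y; rewrite indicE|].
  apply: (@le_lt_trans _ _ (\int[P]_w 1)%E); last first.
    by rewrite integral_cst// mul1e ltey_eq fin_num_measure.
  apply: ge0_le_integral => //.
  - by apply/measurable_EFinP; apply: mphiY; exact: measurable_indic.
  - by move=> w _; rewrite lee_fin indicE; case: (_ \in _).
rewrite cE//.
have -> : c * \int[P]_w \1_A (Y i w) = \prod_j \int[P]_w phiA A j (Y j w).
  rewrite [RHS](bigD1 i)//= /phiA eqxx mulrC; congr (_ * _).
  by apply: eq_bigr => j /negbTE ->.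
rewrite -IH.
- apply: eq_integral => w _; rewrite [in RHS](bigD1 i)//= /phiA eqxx mulrC.
  by congr (_ * _)%:E; apply: eq_bigr => j /negbTE ->.
- by move=> j; rewrite /phiA; case: eqP => [->|_].
- move=> j mj; rewrite /phiA; case: eqVneq => [_|ji]; first by exists A.
  apply: indphi; rewrite ltn_neqAle mj andbT; apply: contra ji => /eqP e.
  by apply/eqP/val_inj.
Qed.

Lemma integral_prod_independent (phi : 'I_n -> R -> R) :
  (forall j, measurable_fun setT (phi j)) -> (forall j y, 0 <= phi j y) ->
  (forall j, (\int[P]_w (phi j (Y j w))%:E < +oo)%E) ->
  (\int[P]_w (\prod_j phi j (Y j w))%:E = (\prod_j \int[P]_w phi j (Y j w))%:E)%E.
Proof.
move=> mphi phi0 phiy; apply: (integral_prod_step (m := n)); first by move=> j; split.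
by move=> j; rewrite leqNgt ltn_ord.
Qed.

End Independence.

(** * Elementary exponential inequalities *)

Section ExponentialBounds.
Context {R : realType}.
Implicit Types x s l : R.

(* [(1 + x + x ^+ 2) * (1 - x / 2) ^+ 2 >= 1] on [[0, 1/3]], while
   [expR x * (1 - x / 2) ^+ 2 <= 1]. *)
Lemma expR_le_quad x : x <= 3^-1 -> expR x <= 1 + x + x ^+ 2.
Proof.
move=> x3.
have [x0|x0] := leP x 0.
  have h : 0 < 1 - x by lra.
  have h2 : expR x * (1 - x) <= 1.
    by have := ler_wpM2l (expR_ge0 x) (expR_ge1Dx (- x)); rewrite -expRD subrr expR0.
  have := expR_gt0 x => h3.
  rewrite -(ler_pM2r h); apply: le_trans h2 _; nra.
have h : 0 < 1 - x / 2 by lra.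
have h2 : expR (x / 2) * (1 - x / 2) <= 1.
  by have := ler_wpM2l (expR_ge0 (x / 2)) (expR_ge1Dx (- (x / 2))); rewrite -expRD subrr expR0.
have h3 : expR x * (1 - x / 2) ^+ 2 <= 1.
  have -> : expR x = expR (x / 2) ^+ 2 by rewrite expr2 -expRD; congr expR; field.
  rewrite -exprMn; apply: exprn_ile1 => //.
  by rewrite mulr_ge0 ?expR_ge0// ltW.
have hp : 0 < (1 - x / 2) ^+ 2 by rewrite exprn_gt0.
rewrite -(ler_pM2r hp); apply: le_trans h3 _.
have -> : (1 + x + x ^+ 2) * (1 - x / 2) ^+ 2 = 1 + x ^+ 2 / 4 * (1 - 3 * x + x ^+ 2) by field.
rewrite lerDl mulr_ge0//; first by rewrite divr_ge0 ?sqr_ge0.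
by have := sqr_ge0 x; lra.
Qed.

(** Where [|s|] exceeds [x] by [u], the excess is [u ^+ 2 + 2 x u], and both [l u] and
    [(l u) ^+ 2 / 2] are at most [expR (l u)]. The two exponentials serve the two signs of [s].
    Moment generating functions thus bound the mean excess directly, with no integration of a
    tail. *)
Lemma sqr_excess_le s x l : 0 < l -> 0 <= x ->
  Num.max (s ^+ 2 - x ^+ 2) 0 <=
  (2 / l ^+ 2 + 2 * x / l) * (expR (l * s - l * x) + expR (- (l * s) - l * x)).
Proof.
move=> l0 x0.
have C0 : 0 <= 2 / l ^+ 2 + 2 * x / l.
  by rewrite addr_ge0// divr_ge0 ?mulr_ge0// ltW// exprn_gt0.
have E0 y : 0 <= expR y := expR_ge0 y.
rewrite ge_max; apply/andP; split; last by rewrite mulr_ge0// addr_ge0.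
have key u : 0 <= u -> (u + x) ^+ 2 - x ^+ 2 <= (2 / l ^+ 2 + 2 * x / l) * expR (l * u).
  move=> u0; have lu0 : 0 <= l * u by rewrite mulr_ge0// ltW.
  have e1 : l * u <= expR (l * u) by apply: le_trans (expR_ge1Dx _); lra.
  have e2 : (l * u) ^+ 2 / 2 <= expR (l * u).
    have := expR_ge1Dxn 1 lu0; rewrite (_ : 2`!%:R = 2 :> R)//; lra.
  have -> : (u + x) ^+ 2 - x ^+ 2 = 2 / l ^+ 2 * ((l * u) ^+ 2 / 2) + 2 * x / l * (l * u).
    by field; rewrite gt_eqF.
  have p1 : 0 <= 2 / l ^+ 2 by rewrite divr_ge0// sqr_ge0.
  have p2 : 0 <= 2 * x / l by rewrite divr_ge0 ?mulr_ge0// ltW.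
  by rewrite [leRHS]mulrDl; apply: lerD; exact: ler_wpM2l.
have [s0|s0] := leP 0 s.
  have [sx|sx] := leP x s.
    have := key (s - x) (_ : 0 <= s - x); rewrite subr_ge0 subrK => /(_ sx) h.
    apply: le_trans h _; rewrite ler_wpM2l// mulrBr lerDl//.
  apply: (@le_trans _ _ 0); last by rewrite mulr_ge0// addr_ge0.
  by nra.
have [sx|sx] := leP x (- s).
  have := key (- s - x) (_ : 0 <= - s - x); rewrite subr_ge0 subrK sqrrN => /(_ sx) h.
  apply: le_trans h _; rewrite ler_wpM2l// mulrBr mulrN lerDr//.
apply: (@le_trans _ _ 0); last by rewrite mulr_ge0// addr_ge0.
by nra.
Qed.

End ExponentialBounds.

Section Concentration.
Context d (T : measurableType d) (R : realType) (P : probability T R) (n : nat).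
Variable Y : 'I_n -> {RV P >-> R}.
Hypothesis indY : mutually_independent Y.
Variable nu : probability R R.
Hypothesis lawY : forall j (A : set R), measurable A -> distribution P (Y j) A = nu A.

Lemma integral_lawY j (phi : R -> R) : measurable_fun setT phi ->
  (\int[P]_w (phi (Y j w))%:E = \int[nu]_y (phi y)%:E)%E.
Proof.
move=> mphi.
have tr := @weighted_transfer _ _ _ T R R R P nu (cst 1) (cst 1) (Y j) id
  (measurable_cst _) (measurable_cst _) (measurable_funP (Y j)) (@measurable_id _ _ _)
  (fun=> ler01) (fun=> ler01).
transitivity (\int[P]_w (1 * phi (Y j w))%:E)%E.
  by apply: eq_integral => w _; rewrite mul1r.
transitivity (\int[nu]_w (1 * phi w)%:E)%E; last first.
  by apply: eq_integral => w _; rewrite mul1r.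
apply: (tr _ phi mphi) => A mA.
transitivity (P (Y j @^-1` A)); last transitivity (nu A).
- transitivity (\int[P]_x (\1_(Y j @^-1` A) x)%:E)%E.
    by apply: eq_integral => w _; rewrite mul1r.
  rewrite integral_indic ?setIT//.
  by have := measurable_funP (Y j) measurableT _ mA; rewrite setTI.
- exact: lawY.
- transitivity (\int[nu]_x (\1_A x)%:E)%E; first by rewrite integral_indic ?setIT.
  by apply: eq_integral => w _; rewrite mul1r.
Qed.

Lemma integral_prod_law (phi : 'I_n -> R -> R) :
  (forall j, measurable_fun setT (phi j)) -> (forall j y, 0 <= phi j y) ->
  (forall j, (\int[nu]_y (phi j y)%:E < +oo)%E) ->
  (\int[P]_w (\prod_j phi j (Y j w))%:E = (\prod_j \int[nu]_y phi j y)%:E)%E.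
Proof.
move=> mphi phi0 phiy.
rewrite (integral_prod_independent indY)//; last by move=> j; rewrite integral_lawY.
congr EFin; apply: eq_bigr => j _.
by rewrite /Rintegral integral_lawY.
Qed.

End Concentration.

(** * Bernstein-type bounds and second moments of empirical means *)

Section Deviation.
Context d (T : measurableType d) (R : realType) (P : probability T R) (n : nat).
Variable Y : 'I_n -> {RV P >-> R}.
Hypothesis indY : mutually_independent Y.
Variable nu : probability R R.
Hypothesis lawY : forall j (A : set R), measurable A -> distribution P (Y j) A = nu A.
Hypothesis n0 : (0 < n)%N.

Let n0' : 0 < n%:R :> R. Proof. by rewrite ltr0n. Qed.

Lemma bounded_integrable (h : R -> R) (C : R) : measurable_fun setT h ->
  (forall y, `|h y| <= C) -> nu.-integrable setT (EFin \o h).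
Proof.
move=> mh hC; apply: (@le_integrable _ _ _ nu setT _ _ (EFin \o cst C)) => //.
- exact/measurable_EFinP.
- by move=> y _ /=; rewrite lee_fin (le_trans (hC y))// ler_norm.
- exact: finite_measure_integrable_cst.
Qed.

Lemma integrable_ge0_lty (h : R -> R) : measurable_fun setT h -> (forall y, 0 <= h y) ->
  (\int[nu]_y (h y)%:E < +oo)%E -> nu.-integrable setT (EFin \o h).
Proof.
move=> mh h0 hy; apply/integrableP; split; first exact/measurable_EFinP.
by under eq_integral do rewrite /= ger0_norm//.
Qed.

Let prodX (phi : R -> R) : measurable_fun setT phi -> (forall y, 0 <= phi y) ->
  (\int[nu]_y (phi y)%:E < +oo)%E ->
  (\int[P]_w (\prod_j phi (Y j w))%:E = ((\int[nu]_y phi y) ^+ n)%:E)%E.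
Proof.
move=> mphi phi0 phiy; rewrite (integral_prod_law indY lawY (phi := fun=> phi))//.
by rewrite prodr_const card_ord.
Qed.

(** The bound on [mu * W] is one-sided, so the estimate serves both bounded [W] and nonnegative
    unbounded [W] with negative [mu]. *)
Let le_expR_quad (W : R -> R) (mu e v : R) : measurable_fun setT W ->
  (forall y, mu * W y <= 3^-1) ->
  nu.-integrable setT (EFin \o W) -> nu.-integrable setT (EFin \o (fun y => W y ^+ 2)) ->
  \int[nu]_y W y = e -> \int[nu]_y W y ^+ 2 <= v ->
  nu.-integrable setT (EFin \o (fun y => expR (mu * W y))) ->
  \int[nu]_y expR (mu * W y) <= expR (mu * e + mu ^+ 2 * v).
Proof.
move=> mW muW iW iW2 We W2v iE.
have i1 : nu.-integrable setT (EFin \o cst 1) by exact: finite_measure_integrable_cst.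
have i2 : nu.-integrable setT (EFin \o (fun y => mu * W y)) by exact: (integrableZl measurableT mu iW).
have i3 : nu.-integrable setT (EFin \o (fun y => mu ^+ 2 * W y ^+ 2)).
  exact: (integrableZl measurableT (mu ^+ 2) iW2).
have i12 : nu.-integrable setT (EFin \o (fun y => 1 + mu * W y)) by exact: (integrableD measurableT i1 i2).
have i123 : nu.-integrable setT (EFin \o (fun y => 1 + mu * W y + mu ^+ 2 * W y ^+ 2)).
  exact: (integrableD measurableT i12 i3).
apply: (@le_trans _ _ (\int[nu]_y (1 + mu * W y + mu ^+ 2 * W y ^+ 2))).
  apply: le_Rintegral => // y _; rewrite -exprMn; exact: expR_le_quad.
rewrite RintegralD// RintegralD// RintegralZl// RintegralZl// We.
rewrite Rintegral_cst//= probability_setT/= mul1r.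
apply: le_trans (expR_ge1Dx _); rewrite -addrA lerD2l lerD2l.
by rewrite ler_wpM2l// sqr_ge0.
Qed.

(** Centring cancels the linear term of the exponent exactly, so a bound on the uncentred second
    moment is enough. *)
Lemma mgf_bound (W : R -> R) (b v mu : R) : measurable_fun setT W ->
  (forall y, `|W y| <= b) -> `|mu| * b <= 3^-1 ->
  \int[nu]_y W y ^+ 2 <= v ->
  (\int[P]_w (expR (mu * \sum_j (W (Y j w) - \int[nu]_y W y)))%:E <=
   (expR (n%:R * (mu ^+ 2 * v)))%:E)%E.
Proof.
move=> mW Wb mub W2v; set e := \int[nu]_y W y.
pose phi y := expR (mu * W y).
have mphi : measurable_fun setT phi.
  by apply: measurableT_comp => //; exact: measurable_funM.
have muW y : mu * W y <= 3^-1.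
  apply: le_trans mub; apply: le_trans (ler_norm _) _.
  by rewrite normrM ler_wpM2l.
have iphi : nu.-integrable setT (EFin \o phi).
  apply: (bounded_integrable (C := expR 3^-1)) => // y.
  by rewrite ger0_norm ?expR_ge0// ler_expR.
have iW := bounded_integrable mW Wb.
have iW2 : nu.-integrable setT (EFin \o (fun y => W y ^+ 2)).
  apply: (bounded_integrable (C := b ^+ 2)); first exact: measurable_funX.
  move=> y; rewrite normrX; apply: lerXn2r => //; rewrite nnegrE//.
  exact: le_trans (Wb y).
have le1 := le_expR_quad mW muW iW iW2 erefl W2v iphi.
have phiy : (\int[nu]_y (phi y)%:E < +oo)%E.
  by rewrite ltey_eq (integrable_fin_num measurableT iphi).
have E1 : (\int[P]_w (expR (mu * \sum_j (W (Y j w) - e)))%:E =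
    (expR (- (n%:R * (mu * e))) * (\int[nu]_y phi y) ^+ n)%:E)%E.
  rewrite EFinM -prodX//; last by move=> y; exact: expR_ge0.
  rewrite -ge0_integralZl_EFin ?expR_ge0//; last 2 first.
  - by move=> w _; rewrite lee_fin prodr_ge0// => j _; exact: expR_ge0.
  - apply/measurable_EFinP; apply: measurable_prod => j _.
    by apply: measurableT_comp.
  apply: eq_integral => w _; rewrite -EFinM -expR_sum -expRD; congr (expR _)%:E.
  rewrite sumrB sumr_const card_ord -mulr_natl mulrBr mulr_sumr; ring.
rewrite E1 lee_fin.
have p0 : 0 <= \int[nu]_y phi y by apply: Rintegral_ge0 => y _; exact: expR_ge0.
apply: (@le_trans _ _ (expR (- (n%:R * (mu * e))) * expR (mu * e + mu ^+ 2 * v) ^+ n)).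
  rewrite ler_wpM2l ?expR_ge0//; apply: lerXn2r => //; rewrite nnegrE//; exact: expR_ge0.
by rewrite -expRM_natl -expRD ler_expR le_eqVlt; apply/orP; left; apply/eqP; ring.
Qed.

Lemma concentration (W : R -> R) (b v x : R) : measurable_fun setT W ->
  (forall y, `|W y| <= b) -> 0 < v -> 0 < x -> x / (2 * v) * b <= 3^-1 ->
  \int[nu]_y W y ^+ 2 <= v ->
  (\int[P]_w (Num.max ((n%:R^-1 * \sum_j (W (Y j w) - \int[nu]_y W y)) ^+ 2 - x ^+ 2) 0)%:E <=
   (2 * (8 * v ^+ 2 / (n%:R * x) ^+ 2 + 4 * (v / n%:R)) * expR (- (n%:R * x ^+ 2 / (4 * v))))%:E)%E.
Proof.
move=> mW Wb v0 x0 xb W2v; set e := \int[nu]_y W y.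
(* This [mu] minimises [mu ^+ 2 v - mu x], whose minimum is [- x ^+ 2 / (4 v)]. *)
pose mu := x / (2 * v); pose l := n%:R * mu.
have mu0 : 0 < mu by rewrite divr_gt0// mulr_gt0.
have l0 : 0 < l by rewrite mulr_gt0.
pose S w := \sum_j (W (Y j w) - e).
have mS : measurable_fun setT S.
  by apply: measurable_sum => j; apply: measurable_funB => //; exact: measurableT_comp.
have mE (a : R) : measurable_fun setT (fun w => (expR (a * S w))%:E).
  by apply/measurable_EFinP; apply: measurableT_comp => //; exact: measurable_funM.
have E0 (a : R) w : (0 <= (expR (a * S w))%:E)%E by rewrite lee_fin expR_ge0.
pose C := (2 / l ^+ 2 + 2 * x / l) * expR (- (l * x)).
have C0 : 0 <= C.
  have p1 : 0 <= 2 / l ^+ 2 by rewrite divr_ge0// sqr_ge0.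
  have p2 : 0 <= 2 * x / l by apply: divr_ge0; [apply: mulr_ge0 => //; exact: ltW|exact: ltW].
  by rewrite mulr_ge0 ?expR_ge0// addr_ge0.
have h1 := mgf_bound (mu := mu) mW Wb; have h2 := mgf_bound (mu := - mu) mW Wb.
rewrite normrN in h2; rewrite (gtr0_norm mu0) in h1 h2.
have {}h1 := h1 _ xb W2v; have {}h2 := h2 _ xb W2v.
apply: (@le_trans _ _ (C%:E * ((\int[P]_w (expR (mu * S w))%:E) + (\int[P]_w (expR (- mu * S w))%:E)))%E).
  rewrite -ge0_integralD// -ge0_integralZl_EFin//; last 2 first.
  - by move=> w _; rewrite adde_ge0.
  - exact: emeasurable_funD.
  apply: ge0_le_integral => //.
  - by move=> w _; rewrite lee_fin le_max lexx orbT.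
  - apply/measurable_EFinP; apply: measurable_maxr => //; apply: measurable_funB => //.
    by apply: measurable_funX; exact: measurable_funM.
  - apply: measurable_funeM; exact: emeasurable_funD.
  - move=> w _; rewrite -EFinD -EFinM lee_fin -/(S w).
    apply: le_trans (sqr_excess_le _ l0 (ltW x0)) _.
    have -> : l * (n%:R^-1 * S w) = mu * S w by rewrite /l; field; rewrite gt_eqF.
    rewrite expRD expRD -mulrDl /C -[leRHS]mulrA [expR (- (l * x)) * _]mulrC mulNr.
    by rewrite mulrA.
apply: (@le_trans _ _ (C%:E * ((expR (n%:R * (mu ^+ 2 * v)))%:E + (expR (n%:R * (mu ^+ 2 * v)))%:E))%E).
  apply: lee_wpmul2l; first by rewrite lee_fin.
  by apply: leeD; [exact: h1|move: h2; rewrite sqrrN].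
rewrite -EFinD -EFinM lee_fin /C.
have -> : expR (- (n%:R * x ^+ 2 / (4 * v))) = expR (- (l * x)) * expR (n%:R * (mu ^+ 2 * v)).
  by rewrite -expRD; congr expR; rewrite /l /mu; field; rewrite gt_eqF.
rewrite le_eqVlt; apply/orP; left; apply/eqP; rewrite /l /mu; field.
by rewrite !gt_eqF.
Qed.

Lemma lower_tail (Z : R -> R) (s q : R) : measurable_fun setT Z ->
  (forall y, 0 <= Z y) -> 0 < s -> 0 < q ->
  (\int[nu]_y (Z y)%:E = s%:E)%E -> (\int[nu]_y (Z y ^+ 2)%:E <= q%:E)%E ->
  (\int[P]_w ((n%:R^-1 * \sum_j Z (Y j w) < s / 2)%R%:R)%:E <=
   (expR (- (n%:R * (s ^+ 2 / (16 * q)))))%:E)%E.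
Proof.
(* Exponential Markov at [- mu] gives the exponent [n (mu ^+ 2 q - mu s / 2)]; this [mu] minimises
   it, with value [- n s ^+ 2 / (16 q)]. *)
move=> mZ Z0 s0 q0 Zs Zq; pose mu := s / (4 * q).
have mu0 : 0 < mu by rewrite divr_gt0// mulr_gt0.
pose phi y := expR (- mu * Z y).
have mphi : measurable_fun setT phi.
  by apply: measurableT_comp => //; exact: measurable_funM.
have phi0 y : 0 <= phi y by exact: expR_ge0.
have iphi : nu.-integrable setT (EFin \o phi).
  apply: (bounded_integrable (C := 1)) => // y.
  by rewrite ger0_norm// /phi expR_le1 mulNr oppr_le0 mulr_ge0// ltW.
have iZ : nu.-integrable setT (EFin \o Z).
  by apply: integrable_ge0_lty => //; rewrite Zs ltry.
have iZ2 : nu.-integrable setT (EFin \o (fun y => Z y ^+ 2)).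
  apply: integrable_ge0_lty; first exact: measurable_funX.
    by move=> y; exact: sqr_ge0.
  exact: le_lt_trans Zq (ltry _).
have muZ y : - mu * Z y <= 3^-1.
  by rewrite mulNr (@le_trans _ _ 0)// oppr_le0 mulr_ge0// ltW.
have Zs' : \int[nu]_y Z y = s by rewrite /Rintegral Zs.
have Zq' : \int[nu]_y Z y ^+ 2 <= q.
  by rewrite -lee_fin /Rintegral fineK//; exact: (integrable_fin_num measurableT iZ2).
have le1 := le_expR_quad mZ muZ iZ iZ2 Zs' Zq' iphi.
have phiy : (\int[nu]_y (phi y)%:E < +oo)%E.
  by rewrite ltey_eq (integrable_fin_num measurableT iphi).
apply: (@le_trans _ _ (\int[P]_w ((expR (n%:R * (mu * (s / 2))))%:E * (\prod_j phi (Y j w))%:E))%E).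
  apply: ge0_le_integral => //.
  - apply/measurable_EFinP; apply: (@measurableT_comp _ _ _ _ _ _ (fun b : bool => b%:R : R)) => //.
    apply: measurable_fun_ltr => //; apply: measurable_funM => //.
    by apply: measurable_sum => j; exact: measurableT_comp.
  - apply: measurable_funeM; apply/measurable_EFinP; apply: measurable_prod => j _.
    exact: measurableT_comp.
  - move=> w _; rewrite -EFinM lee_fin -expR_sum -expRD.
    case: ltP => [h|_]; last exact: expR_ge0.
    apply: le_trans (expR_ge1Dx _); rewrite lerDl -mulr_sumr mulNr subr_ge0.
    rewrite mulrCA ler_wpM2l ?(ltW mu0)// mulrC -ler_pdivrMr// mulrC; exact: ltW.
rewrite ge0_integralZl_EFin ?expR_ge0//; last 2 first.
- by move=> w _; rewrite lee_fin prodr_ge0.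
- by apply/measurable_EFinP; apply: measurable_prod => j _; exact: measurableT_comp.
rewrite prodX// -EFinM lee_fin.
have p0 : 0 <= \int[nu]_y phi y by apply: Rintegral_ge0 => y _; exact: expR_ge0.
apply: (@le_trans _ _ (expR (n%:R * (mu * (s / 2))) * expR (- mu * s + (- mu) ^+ 2 * q) ^+ n)).
  rewrite ler_wpM2l ?expR_ge0//; apply: lerXn2r => //; rewrite nnegrE//; exact: expR_ge0.
rewrite -expRM_natl -expRD ler_expR le_eqVlt; apply/orP; left; apply/eqP.
by rewrite /mu; field; rewrite gt_eqF.
Qed.

Lemma second_moment (X : R -> R) (e1 e2 : R) : measurable_fun setT X ->
  (forall y, 0 <= X y) ->
  (\int[nu]_y (X y)%:E <= e1%:E)%E -> (\int[nu]_y (X y ^+ 2)%:E <= e2%:E)%E ->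
  (\int[P]_w ((n%:R^-1 * \sum_j X (Y j w)) ^+ 2)%:E <= (e2 / n%:R + e1 ^+ 2)%:E)%E.
Proof.
move=> mX X0 Xe1 Xe2.
have mXY j : measurable_fun setT (fun w => X (Y j w)) by exact: measurableT_comp.
have e10 : 0 <= e1.
  by rewrite -lee_fin; apply: le_trans Xe1; apply: integral_ge0 => y _; rewrite lee_fin.
have e20 : 0 <= e2.
  by rewrite -lee_fin; apply: le_trans Xe2; apply: integral_ge0 => y _; rewrite lee_fin sqr_ge0.
have Xlt : (\int[nu]_y (X y)%:E < +oo)%E by exact: le_lt_trans Xe1 (ltry _).
have mixed i j : (\int[P]_w (X (Y i w) * X (Y j w))%:E <=
    ((if i == j then e2 else 0) + e1 ^+ 2)%:E)%E.
  case: eqVneq => [<-|ij].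
    apply: (@le_trans _ _ e2%:E); last by rewrite lee_fin lerDl sqr_ge0.
    rewrite -(integral_lawY lawY i) in Xe2; last exact: measurable_funX.
    by under eq_integral do rewrite -expr2.
  (* Padding with the constant 1 writes the product of two coordinates as a product over all of
     them. *)
  pose phi k : R -> R := if (k == i) || (k == j) then X else cst 1.
  have prodE w : \prod_k phi k (Y k w) = X (Y i w) * X (Y j w).
    rewrite (bigD1 i)//= (bigD1 j) 1?eq_sym//= big1 ?mulr1 /phi.
      by rewrite !eqxx orbT.
    by move=> k /andP[/negbTE -> /negbTE ->].
  under eq_integral do rewrite -prodE.
  have nu1 : (\int[nu]_y 1 = 1)%E by rewrite integral_cst//= probability_setT mule1.
  rewrite (integral_prod_law indY lawY (phi := phi)).
  - rewrite (bigD1 i)//= (bigD1 j) 1?eq_sym//= big1 ?mulr1 /phi.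
      rewrite !eqxx orbT add0r lee_fin expr2.
      have hX : \int[nu]_y X y <= e1.
        rewrite -lee_fin /Rintegral fineK// ge0_fin_numE//.
        by apply: integral_ge0 => y _; rewrite lee_fin.
      by apply: ler_pM => //; apply: Rintegral_ge0.
    by move=> k /andP[/negbTE -> /negbTE ->]; rewrite /= /Rintegral nu1.
  - by move=> k; rewrite /phi; case: ifP.
  - by move=> k y; rewrite /phi; case: ifP.
  - by move=> k; rewrite /phi; case: ifP => // _; rewrite nu1 ltry.
have -> : (\int[P]_w ((n%:R^-1 * \sum_j X (Y j w)) ^+ 2)%:E =
   ((n%:R^-1) ^+ 2)%:E * \sum_i \sum_j \int[P]_w (X (Y i w) * X (Y j w))%:E)%E.
  pose F i j w := (X (Y i w) * X (Y j w))%:E.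
  have F0 i j w : (0 <= F i j w)%E by rewrite lee_fin mulr_ge0.
  have mF i j : measurable_fun setT (F i j) by apply/measurable_EFinP; exact: measurable_funM.
  have mFs i : measurable_fun setT (fun w => \sum_j F i j w)%E by exact: emeasurable_sum.
  transitivity (\int[P]_w (((n%:R^-1) ^+ 2)%:E * \sum_i \sum_j F i j w)%E)%E.
    apply: eq_integral => w _; rewrite /F.
    under [in RHS]eq_bigr do rewrite sumEFin.
    rewrite sumEFin -EFinM; congr EFin; rewrite exprMn; congr (_ * _).
    by rewrite expr2 big_distrl; apply: eq_bigr => i _; rewrite big_distrr.
  rewrite ge0_integralZl_EFin ?sqr_ge0//; last 2 first.
  - by move=> w _; apply: sume_ge0 => i _; apply: sume_ge0.
  - exact: emeasurable_sum.
  congr (_ * _)%E; rewrite ge0_integral_sum//; last first.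
    by move=> i w _; apply: sume_ge0.
  by apply: eq_bigr => i _; rewrite ge0_integral_sum.
apply: (@le_trans _ _ (((n%:R^-1) ^+ 2)%:E * (\sum_(i < n) \sum_(j < n) ((if i == j then e2 else 0) + e1 ^+ 2)%:E))%E).
  apply: lee_wpmul2l; first by rewrite lee_fin sqr_ge0.
  by apply: lee_sum => i _; apply: lee_sum => j _; exact: mixed.
under eq_bigr do rewrite sumEFin.
rewrite sumEFin -EFinM lee_fin.
have -> : \sum_(i < n) \sum_(j < n) ((if i == j then e2 else 0) + e1 ^+ 2) =
    n%:R * e2 + n%:R ^+ 2 * e1 ^+ 2.
  under eq_bigr => i _.
    rewrite big_split/= sumr_const card_ord (bigD1 i)//= eqxx big1; last first.
      by move=> j; rewrite eq_sym => /negbTE ->.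
    over.
  by rewrite sumr_const card_ord addr0 -(mulr_natl (e1 ^+ 2) n) -(mulr_natl (_ + _) n); ring.
by rewrite le_eqVlt; apply/orP; left; apply/eqP; field; rewrite gt_eqF.
Qed.

End Deviation.

(** * Fluctuations of the estimators *)

Section NoiseConstants.
Context {R : realType}.
Local Notation mu := (@lebesgue_measure R).
Variables (c : R) (g : R -> R).
Hypothesis dg : is_density g.
Hypothesis wlt : (wsup c g < +oo)%E.

Lemma wsup_ae : {ae mu, forall u, 0 < u -> ((u `^ (2 * c - 1) * g u)%:E <= wsup c g)%E}.
Proof.
have [N [mN N0 sub]] := ess_sup_ge (mrestr mu (@measurable_Rpos R))
  (fun x => (x `^ (2 * c - 1) * g x)%:E).
exists (N `&` Rpos); split => //.
  exact: measurableI (measurable_Rpos).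
move=> u /= nu; split; last first.
  by rewrite -inE mem_Rpos; apply: contra_notT nu => /negP u0.
by apply: sub => /= h; apply: nu => _.
Qed.

(** Otherwise the moment of [g] of order [2c - 1] would be nonpositive. Positivity is what makes
    [Delta] finite on the index set. *)
Lemma wsup_gt0 : (0 < wsup c g)%E.
Proof.
rewrite ltNge; apply/negP => w0.
have := moment_gt0 (2 * c - 1) dg; rewrite ltNge => /negP; apply.
have mg : measurable_fun Rpos g by case: dg.
have mRpos : measurable (Rpos : set (measurableTypeR R)) by exact: measurable_Rpos.
apply: (@le_trans _ _ (\int[mu]_(x in Rpos) 0)%E); last by rewrite integral0.
apply: ae_ge0_le_integral => //.
- move=> x; rewrite -inE mem_Rpos => x0; rewrite lee_fin mulr_ge0 ?powR_ge0//.
  by case: dg => _ + _; apply.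
- apply/measurable_EFinP; apply: measurable_funM => //.
  by apply: measurable_funTS; exact: measurable_powR.
- case: wsup_ae => N [mN N0 sub]; exists N; split => // u /= h; apply: sub => /= h'.
  apply: h; rewrite -inE mem_Rpos => u0; exact: le_trans (h' u0) w0.
Qed.

Lemma wsup_fin : wsup c g = (fine (wsup c g))%:E.
Proof.
by rewrite fineK// ge0_fin_numE ?wlt// ltW// wsup_gt0.
Qed.

Lemma fine_wsup_gt0 : 0 < fine (wsup c g).
Proof. by rewrite -lte_fin -wsup_fin wsup_gt0. Qed.

Lemma fine_wsup_ae :
  {ae mu, forall u, 0 < u -> u `^ (2 * c - 1) * g u <= fine (wsup c g)}.
Proof.
case: wsup_ae => N [mN N0 sub]; exists N; split => // u /= h; apply: sub => /= h'.
by apply: h => u0; rewrite -lee_fin -wsup_fin h'.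
Qed.

Section Indices.
Variable Psi : R -> R[i].

Lemma Delta_ge0 k : (0 <= Delta c Psi g k)%E.
Proof.
rewrite /Delta mule_ge0 ?lee_fin ?invr_ge0 ?mulr_ge0 ?pi_ge0//.
by apply: integral_ge0 => t _; rewrite lee_fin sqr_ge0.
Qed.

Hypothesis Lg : in_Lp 1 (c - 1) g.
Hypothesis mPsi : cmeasurable setT Psi.
Hypothesis conjPsi : forall t, conjc (Psi t) = Psi (- t).

Lemma le_Delta k l : k <= l -> (Delta c Psi g k <= Delta c Psi g l)%E.
Proof.
move=> kl; rewrite /Delta lee_wpmul2l ?lee_fin ?invr_ge0 ?mulr_ge0 ?pi_ge0//.
apply: ge0_subset_integral.
- exact: measurable_itv.
- exact: measurable_itv.
- apply/measurable_EFinP.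
  have -> : (fun t => Normc.normc (Psi t / mellin c g t) ^+ 2) =
     (fun t => re_ratio c Psi g t ^+ 2 + im_ratio c Psi g t ^+ 2).
    by apply/funext => t; rewrite sqr_ratio.
  have [m1 m2] := measurable_ratio Lg mPsi.
  by apply: measurable_funD; apply: measurable_funX; exact: measurable_funTS.
- by move=> t _; rewrite lee_fin sqr_ge0.
- by move=> t; rewrite /= !in_itv/= => /andP[h1 h2]; apply/andP; split; lra.
Qed.

Variable n : nat.
Local Notation K := (index_set c Psi g n).

Lemma index_fin k : K k -> Delta c Psi g k%:R \is a fin_num.
Proof.
move=> [_ h _]; rewrite ge0_fin_numE ?Delta_ge0// ltNge; apply/negP.
by rewrite leye_eq => /eqP e; move: h; rewrite e gt0_muley ?wsup_gt0.
Qed.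

Lemma index_le k : K k ->
  fine (wsup c g) * fine (Delta c Psi g k%:R) <= n%:R.
Proof.
move=> Kk; have [_ + _] := Kk.
by rewrite wsup_fin -(fineK (index_fin Kk)) -EFinM lee_fin.
Qed.

(** Both constraints are monotone in the cut-off, so the index set is an initial segment of the
    positive integers. *)
Lemma index_down k l : K k -> (0 < l)%N -> (l <= k)%N -> K l.
Proof.
move=> [_ h1 h2] l0 lk; split; first exact: l0.
  apply: le_trans h1; apply: lee_wpmul2l; first exact: ltW wsup_gt0.
  by apply: le_Delta; rewrite ler_nat.
by apply: le_trans h2; rewrite ler_nat.
Qed.

End Indices.
End NoiseConstants.

(** * Moments of the observations and bounds on the logarithm *)

Section Moments.
Context {R : realType}.
Local Notation mu := (@lebesgue_measure R).

Lemma powR_natM (k : nat) (a y : R) : y `^ (k%:R * a) = (y `^ a) ^+ k.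
Proof. by rewrite mulrC powRrM powR_mulrn// powR_ge0. Qed.

(** A fixed lower bound turns every negative power of the logarithm into a constant, uniformly over
    [n >= 2]. *)
Lemma ln_ge_half (n : nat) : (2 <= n)%N -> 2^-1 <= ln (n%:R : R).
Proof.
move=> n2; have n0 : 0 < n%:R :> R by rewrite ltr0n (leq_trans _ n2).
rewrite -ler_expR lnK ?posrE//.
apply: (@le_trans _ _ 2); last by rewrite ler_nat.
have h := expR_ge1Dx (- (2^-1) : R).
have e : expR (2^-1) * expR (- 2^-1) = 1 :> R by rewrite -expRD subrr expR0.
have p := expR_gt0 (2^-1 : R); nra.
Qed.

Lemma ln_le_nat (n : nat) : (0 < n)%N -> ln (n%:R : R) <= n%:R.
Proof.
move=> n0; rewrite -ler_expR lnK ?posrE ?ltr0n//.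
by apply: le_trans (expR_ge1Dx _); rewrite lerDr.
Qed.

Variables (c m : R) (f g : R -> R).
Hypothesis df : is_density f.
Hypothesis dg : is_density g.
Variable nu : probability R R.
Hypothesis nuE : forall A : set R, measurable A ->
  (nu A = \int[mu]_(y in A `&` Rpos) dens_Y f g y)%E.
Hypothesis mY : moment_Y (8 * (c - 1)) f g = m%:E.

Lemma law_moment8 : (\int[nu]_y ((y `^ (c - 1)) ^+ 8)%:E = m%:E)%E.
Proof.
rewrite -mY (moment_Y_law df dg nuE); apply: eq_integral => y _.
by rewrite -powR_natM.
Qed.

Lemma moment8_ge0 : 0 <= m.
Proof.
by rewrite -lee_fin -law_moment8; apply: integral_ge0 => y _; rewrite lee_fin exprn_ge0// powR_ge0.
Qed.

Lemma law_moment_le (k : nat) : (k <= 8)%N ->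
  (\int[nu]_y ((y `^ (c - 1)) ^+ k)%:E <= (1 + m)%:E)%E.
Proof.
move=> k8; have mp : measurable_fun setT (fun y : R => y `^ (c - 1)) by exact: measurable_powR.
apply: (@le_trans _ _ (\int[nu]_y (1%:E + ((y `^ (c - 1)) ^+ 8)%:E))%E).
  apply: ge0_le_integral => //.
  - by move=> y _; rewrite lee_fin exprn_ge0// powR_ge0.
  - by apply/measurable_EFinP; exact: measurable_funX.
  - by apply: emeasurable_funD => //; apply/measurable_EFinP; exact: measurable_funX.
  - move=> y _; rewrite -EFinD lee_fin.
    have p0 : 0 <= y `^ (c - 1) by exact: powR_ge0.
    have [p1|p1] := leP (y `^ (c - 1)) 1.
      by rewrite (@le_trans _ _ 1) ?lerDl ?exprn_ge0// exprn_ile1.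
    by rewrite (@le_trans _ _ ((y `^ (c - 1)) ^+ 8)) ?lerDr// ler_weXn2l// ltW.
rewrite ge0_integralD//; last 2 first.
- by move=> y _; rewrite lee_fin exprn_ge0// powR_ge0.
- by apply/measurable_EFinP; exact: measurable_funX.
by rewrite law_moment8 integral_cst//= probability_setT mule1.
Qed.

(** The product of the two moments is a moment of the observation, hence finite; both factors are
    positive, so neither can be infinite. *)
Lemma moment2_fin : moment (2 * (c - 1)) f \is a fin_num /\ moment (2 * (c - 1)) g \is a fin_num.
Proof.
have := law_moment_le (isT : (2 <= 8)%N).
have -> : (\int[nu]_y ((y `^ (c - 1)) ^+ 2)%:E = \int[nu]_y (y `^ (2 * (c - 1)))%:E)%E.
  by apply: eq_integral => y _; rewrite -powR_natM.
rewrite (moment_law df dg nuE).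
have := moment_gt0 (2 * (c - 1)) df; have := moment_gt0 (2 * (c - 1)) dg.
case: (moment _ f) (moment _ g) => [a||] [b||] //=; rewrite ?lte_fin => b0 a0.
- by rewrite gt0_muley// leye_eq.
- by rewrite gt0_mulye// leye_eq.
Qed.

Lemma sigma_gt0 : 0 < sigma c f.
Proof.
rewrite /sigma -lte_fin fineK; first exact: moment_gt0.
by case: moment2_fin.
Qed.

Lemma law_moment2 : (\int[nu]_y ((y `^ (c - 1)) ^+ 2)%:E =
  (sigma c f * fine (moment (2 * (c - 1)) g))%:E)%E.
Proof.
have [ff fg] := moment2_fin.
rewrite EFinM /sigma !fineK// -(moment_law df dg nuE).
by apply: eq_integral => y _; rewrite -powR_natM.
Qed.

End Moments.

(** * Main fluctuation, truncation remainder and deficit of the estimated penalty *)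

Section Stochastic.
Context {R : realType}.
Local Notation mu := (@lebesgue_measure R).
Variables (c m : R) (Psi : R -> R[i]) (f g : R -> R).
Hypothesis df : is_density f.
Hypothesis dg : is_density g.
Hypothesis Lg : in_Lp 1 (c - 1) g.
Hypothesis mPsi : cmeasurable setT Psi.
Hypothesis conjPsi : forall t, conjc (Psi t) = Psi (- t).
Hypothesis wlt : (wsup c g < +oo)%E.
Hypothesis mY : moment_Y (8 * (c - 1)) f g = m%:E.
Context d (T : measurableType d) (P : probability T R) (n : nat).
Variable Y : 'I_n -> {RV P >-> R}.
Hypothesis indY : mutually_independent Y.
Variable nu : probability R R.
Hypothesis lawY : forall j (A : set R), measurable A -> distribution P (Y j) A = nu A.
Hypothesis nuE : forall A : set R, measurable A ->
  (nu A = \int[mu]_(y in A `&` Rpos) dens_Y f g y)%E.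
Hypothesis n2 : (2 <= n)%N.
Variable Kn : nat.
Hypothesis KKn : index_set c Psi g n Kn.

Local Notation G := (fine (wsup c g)).
Local Notation sg := (sigma c f).
Local Notation L := (ln (n%:R : R)).
Local Notation rn := (Num.sqrt (n%:R : R)).
Local Notation Dl l := (fine (Delta c Psi g l%:R)).
Local Notation v l := (G * sg * Dl l).

(* With this level the truncated summands have size at most [v l / (3 x)] at the
   deviation scale [x ^+ 2 = 6 * v l * L / n]. *)
Definition level : R := 2 * pi * G * sg / 27 * (rn * L).

(** The truncation acts on [y^(2c-2)] rather than on the kernel, so the same event serves every
    index [l] and a single function [excess] dominates all the truncation errors. *)
Definition trunc_hker (l : nat) (y : R) : R :=
  hker c Psi g l%:R y * ((y `^ (c - 1)) ^+ 2 <= level)%R%:R.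

Definition excess (y : R) : R := y `^ (c - 1) * (level < (y `^ (c - 1)) ^+ 2)%R%:R.

Let n0 : (0 < n)%N. Proof. exact: leq_trans n2. Qed.
Let n0' : 0 < n%:R :> R. Proof. by rewrite ltr0n. Qed.
Let G0 : 0 < G. Proof. exact: fine_wsup_gt0. Qed.
Let sg0 : 0 < sg. Proof. exact (sigma_gt0 df dg nuE mY). Qed.
Let L2 : 2^-1 <= L. Proof. exact: ln_ge_half. Qed.
Let L0 : 0 < L. Proof. by apply: lt_le_trans L2; rewrite invr_gt0. Qed.
Let rn0 : 0 < rn. Proof. by rewrite sqrtr_gt0. Qed.
Let rnn : rn ^+ 2 = n%:R. Proof. by rewrite sqr_sqrtr// ltW. Qed.
Let pi0 : 0 < pi :> R. Proof. exact: pi_gt0. Qed.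
Let m0 : 0 <= m. Proof. exact (moment8_ge0 df dg nuE mY). Qed.

Lemma level_gt0 : 0 < level.
Proof. by rewrite /level !mulr_gt0// ?invr_gt0// mulr_gt0. Qed.

Let mpow : measurable_fun setT (fun y : R => (y `^ (c - 1)) ^+ 2).
Proof. by apply: measurable_funX; exact: measurable_powR. Qed.

Let mnatb : measurable_fun setT (fun b : bool => b%:R : R). Proof. by []. Qed.

Lemma measurable_excess : measurable_fun setT excess.
Proof.
apply: measurable_funM; first exact: measurable_powR.
by apply: (measurableT_comp mnatb); exact: measurable_fun_ltr.
Qed.

Lemma excess_ge0 y : 0 <= excess y.
Proof. by rewrite mulr_ge0// powR_ge0. Qed.

Section Cutoff.
Variable l : nat.
Hypothesis l0 : (0 < l)%N.
Hypothesis lK : (l <= Kn)%N.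

Let Kl : index_set c Psi g n l.
Proof. exact: index_down KKn l0 lK. Qed.

Let fD := index_fin dg Kl.
Let l0' : 0 < l%:R :> R. Proof. by rewrite ltr0n. Qed.

Let Dl0 : 0 <= Dl l. Proof. by rewrite fine_ge0// Delta_ge0. Qed.

Lemma measurable_trunc_hker : measurable_fun setT (trunc_hker l).
Proof.
apply: measurable_funM; first exact: measurable_hker.
by apply: (measurableT_comp mnatb); exact: measurable_fun_ler.
Qed.

Lemma hker_bound y : (hker c Psi g l%:R y) ^+ 2 <=
  (y `^ (c - 1)) ^+ 2 * (l%:R * Dl l / pi).
Proof. exact: hker_sqr_le. Qed.

Lemma law_hker_sqr : (\int[nu]_y ((hker c Psi g l%:R y) ^+ 2)%:E <= (v l)%:E)%E.
Proof.
apply: (law_le df dg nuE (c := c)).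
- by apply: measurable_funX; exact: measurable_hker.
- by move=> y; exact: sqr_ge0.
- exact: ltW.
- exact: fine_wsup_ae.
- by rewrite /sigma fineK//; case: (moment2_fin df dg nuE mY).
- exact: hker_plancherel.
Qed.

Lemma trunc_hker_bound y : `|trunc_hker l y| <= Num.sqrt (level * (l%:R * Dl l / pi)).
Proof.
have b0 : 0 <= l%:R * Dl l / pi by rewrite divr_ge0 ?mulr_ge0// ltW.
rewrite -sqrtr_sqr ler_wsqrtr// /trunc_hker.
have [h|h] := leP ((y `^ (c - 1)) ^+ 2) level; last first.
  by rewrite /= mulr0n mulr0 expr0n/= mulr_ge0// ltW// level_gt0.
by rewrite /= mulr1n mulr1; apply: le_trans (hker_bound y) _; exact: ler_wpM2r.
Qed.

Let trunc_sqr y : trunc_hker l y ^+ 2 <= hker c Psi g l%:R y ^+ 2.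
Proof.
rewrite /trunc_hker; have [_|_] := leP ((y `^ (c - 1)) ^+ 2) level => /=.
  by rewrite mulr1n mulr1.
by rewrite mulr0n mulr0 expr0n/= sqr_ge0.
Qed.

Let ih2 : nu.-integrable setT (EFin \o (fun y => hker c Psi g l%:R y ^+ 2)).
Proof.
apply: integrable_ge0_lty.
- by apply: measurable_funX; exact: measurable_hker.
- by move=> y; exact: sqr_ge0.
- exact: le_lt_trans law_hker_sqr (ltry _).
Qed.

Lemma law_trunc_sqr : \int[nu]_y trunc_hker l y ^+ 2 <= v l.
Proof.
rewrite -lee_fin; apply: (le_trans _ law_hker_sqr).
have iW2 : nu.-integrable setT (EFin \o (fun y => trunc_hker l y ^+ 2)).
  apply: le_integrable ih2 => //.
    by apply/measurable_EFinP; apply: measurable_funX; exact: measurable_trunc_hker.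
  by move=> y _; rewrite /= lee_fin !ger0_norm ?sqr_ge0// trunc_sqr.
rewrite /Rintegral fineK; last exact: (integrable_fin_num measurableT iW2).
apply: ge0_le_integral => //.
- by move=> y _; rewrite lee_fin sqr_ge0.
- by apply/measurable_EFinP; apply: measurable_funX; exact: measurable_trunc_hker.
- by apply/measurable_EFinP; apply: measurable_funX; exact: measurable_hker.
- by move=> y _; rewrite lee_fin trunc_sqr.
Qed.

(** The exponential contributes [n ^ (-3/2)]. Since [v l / n <= sg] by the index constraint and
    [1 / L <= 2], the prefactor is at most [2 (8/3 + 4) sg], below [14 sg]. *)
Lemma main_fluctuation :
  (\int[P]_w (Num.max ((n%:R^-1 * \sum_j (trunc_hker l (Y j w) - \int[nu]_y trunc_hker l y)) ^+ 2
     - 6 * v l * L / n%:R) 0)%:E <= (14 * sg / (n%:R * rn))%:E)%E.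
Proof.
(* [concentration] asks for a positive [v]; if [Delta] vanishes, so does the kernel, by
   [hker_bound]. *)
have := Dl0; rewrite le_eqVlt => /orP[/eqP D0|Dpos].
  have t0 y : trunc_hker l y = 0.
    apply/eqP; rewrite -sqrf_eq0 eq_le sqr_ge0 andbT.
    by apply: le_trans (trunc_sqr y) _; apply: le_trans (hker_bound y) _; rewrite -D0 mulr0 mul0r mulr0.
  rewrite integral0_eq.
    by rewrite lee_fin divr_ge0 ?mulr_ge0// ltW.
  move=> w _; have -> : \int[nu]_y trunc_hker l y = 0.
    by under eq_Rintegral do rewrite t0; rewrite Rintegral_cst// mul0r.
  rewrite big1; last by move=> j _; rewrite t0 subr0.
  by rewrite -D0 !(mulr0, mul0r) expr0n/= subrr maxxx.
have v0 : 0 < v l by rewrite !mulr_gt0.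
pose x := Num.sqrt (6 * v l * L / n%:R).
have x2 : x ^+ 2 = 6 * v l * L / n%:R.
  by rewrite sqr_sqrtr// divr_ge0 ?mulr_ge0// ltW.
have x0 : 0 < x by rewrite sqrtr_gt0 divr_gt0// !mulr_gt0.
rewrite -x2.
(* The square of the left side is [1 / 9] times [l L ^+ 2 / sqrt n], which is where the constraint
   [l <= sqrt n / L ^+ 2] is used. *)
have cond : x / (2 * v l) * Num.sqrt (level * (l%:R * Dl l / pi)) <= 3^-1.
  rewrite -(ler_pXn2r (n := 2))// ?nnegrE ?invr_ge0//; last first.
    by rewrite mulr_ge0 ?sqrtr_ge0// divr_ge0 ?ltW// mulr_gt0.
  rewrite exprMn expr_div_n x2 sqr_sqrtr; last first.
    by rewrite mulr_ge0 ?divr_ge0 ?mulr_ge0// ltW// level_gt0.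
  have [_ _ lrn] := Kl.
  have -> : 6 * v l * L / n%:R / (2 * v l) ^+ 2 * (level * (l%:R * Dl l / pi)) =
      3^-1 ^+ 2 * (l%:R / (rn / L ^+ 2)).
    have gen (p a b r M D k : R) : p != 0 -> a != 0 -> b != 0 -> r != 0 -> M != 0 -> D != 0 ->
        6 * (a * b * D) * M / r ^+ 2 / (2 * (a * b * D)) ^+ 2 *
        (2 * p * a * b / 27 * (r * M) * (k * D / p)) = 3^-1 ^+ 2 * (k / (r / M ^+ 2)).
      move=> p0 a0 b0 r0 M0 D0; field.
      by rewrite p0 a0 b0 r0 M0 D0.
    by rewrite -[X in _ * L / X]rnn /level gen// gt_eqF.
  rewrite ler_piMr ?sqr_ge0// ler_pdivrMr ?mul1r//.
  by rewrite divr_gt0// exprn_gt0.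
apply: le_trans (concentration indY lawY n0 measurable_trunc_hker trunc_hker_bound v0 x0 cond law_trunc_sqr) _.
rewrite lee_fin.
have -> : expR (- (n%:R * x ^+ 2 / (4 * v l))) = (n%:R * rn)^-1.
  have -> : n%:R * x ^+ 2 / (4 * v l) = L + 2^-1 * L.
    have gen (V N M : R) : V != 0 -> N != 0 ->
        N * (6 * V * M / N) / (4 * V) = M + 2^-1 * M.
      by move=> V0 N0; field; rewrite V0 N0.
    by rewrite x2 gen// gt_eqF.
  by rewrite expRN expRD [2^-1 * L]mulrC expRM lnK ?posrE// powR12_sqrt// ltW.
have hv : v l / n%:R <= sg.
  have -> : v l = sg * (G * Dl l) by ring.
  rewrite ler_pdivrMr//; apply: ler_wpM2l; first exact: ltW.
  exact: (index_le dg wlt Kl).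
have -> : 8 * v l ^+ 2 / (n%:R * x) ^+ 2 = 8 / 6 * (v l / n%:R) / L.
  have gen (V N M : R) : V != 0 -> N != 0 -> M != 0 ->
      8 * V ^+ 2 / (N ^+ 2 * (6 * V * M / N)) = 8 / 6 * (V / N) / M.
    by move=> V0 N0 M0; field; rewrite V0 N0 M0.
  by rewrite [(n%:R * x) ^+ 2]exprMn x2 gen// gt_eqF.
apply: ler_wpM2r; first by rewrite invr_ge0 mulr_ge0// ltW.
have hL : L^-1 <= 2 by rewrite invf_ple ?posrE.
have vn0 : 0 <= v l / n%:R by rewrite divr_ge0// ltW.
have hvL : v l / n%:R / L <= 2 * (v l / n%:R) by rewrite mulrC ler_wpM2r.
by move: hvL hv vn0; move: (v l / n%:R) => a; rewrite -mulrA; lra.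
Qed.

Let ih : nu.-integrable setT (EFin \o (fun y => hker c Psi g l%:R y)).
Proof.
have i1 : nu.-integrable setT (EFin \o cst 1) by exact: finite_measure_integrable_cst.
apply: le_integrable (integrableD measurableT i1 ih2) => //.
  by apply/measurable_EFinP; exact: measurable_hker.
move=> y _; rewrite /= lee_fin [leRHS]ger0_norm ?addr_ge0 ?sqr_ge0//.
by rewrite ler_norml; apply/andP; split; nra.
Qed.

Let iW : nu.-integrable setT (EFin \o trunc_hker l).
Proof. exact: bounded_integrable measurable_trunc_hker trunc_hker_bound. Qed.

Lemma trunc_error y : `|hker c Psi g l%:R y - trunc_hker l y| <=
  Num.sqrt (Kn%:R * Dl Kn / pi) * excess y.
Proof.
have e0 := excess_ge0 y.
have b0 : 0 <= Kn%:R * Dl Kn / pi.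
  by rewrite divr_ge0 ?mulr_ge0 ?fine_ge0 ?Delta_ge0// ltW.
rewrite -(ger0_norm (mulr_ge0 (sqrtr_ge0 _) e0)) -!sqrtr_sqr ler_wsqrtr//.
rewrite exprMn sqr_sqrtr// /trunc_hker /excess.
have [h|h] := leP ((y `^ (c - 1)) ^+ 2) level => /=.
  by rewrite mulr1n mulr0n mulr1 subrr mulr0 expr0n/= mulr0.
rewrite mulr1n mulr0n mulr0 subr0 mulr1 [leRHS]mulrC.
apply: le_trans (hker_bound y) _; rewrite ler_wpM2l ?sqr_ge0//.
rewrite ler_wpM2r ?invr_ge0 ?(ltW pi0)//; apply: ler_pM => //.
  by rewrite ler_nat.
apply: fine_le => //; first exact: (index_fin dg KKn).
by apply: le_Delta => //; rewrite ler_nat.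
Qed.

(** The kernel is its truncation plus a remainder dominated by a multiple of [excess]; the mean of
    [excess] accounts for the shift in the centring. Squares are split twice by
    [(a + b) ^+ 2 <= 2 a ^+ 2 + 2 b ^+ 2]. *)
Lemma estimator_split w :
  nu.-integrable setT (EFin \o excess) ->
  (n%:R^-1 * \sum_j hker c Psi g l%:R (Y j w) - \int[nu]_y hker c Psi g l%:R y) ^+ 2 <=
  2 * (n%:R^-1 * \sum_j (trunc_hker l (Y j w) - \int[nu]_y trunc_hker l y)) ^+ 2 +
  2 * (Kn%:R * Dl Kn / pi *
    (2 * ((n%:R^-1 * \sum_j excess (Y j w)) ^+ 2 + (\int[nu]_y excess y) ^+ 2))).
Proof.
move=> iX.
pose C := Num.sqrt (Kn%:R * Dl Kn / pi).
have C0 : 0 <= C by exact: sqrtr_ge0.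
have C2 : C ^+ 2 = Kn%:R * Dl Kn / pi.
  by rewrite sqr_sqrtr// divr_ge0 ?mulr_ge0 ?fine_ge0 ?Delta_ge0// ltW.
rewrite -C2.
pose rem y := hker c Psi g l%:R y - trunc_hker l y.
have irem : nu.-integrable setT (EFin \o rem) by exact: (integrableB measurableT ih iW).
have remE : \int[nu]_y hker c Psi g l%:R y = \int[nu]_y trunc_hker l y + \int[nu]_y rem y.
  by rewrite [X in _ + X]RintegralB// addrC subrK.
set A := n%:R^-1 * \sum_j (trunc_hker l (Y j w) - _).
set t := n%:R^-1 * \sum_j excess (Y j w); set tb := \int[nu]_y excess y.
pose B := n%:R^-1 * \sum_j rem (Y j w) - \int[nu]_y rem y.
have -> : n%:R^-1 * \sum_j hker c Psi g l%:R (Y j w) - \int[nu]_y hker c Psi g l%:R y = A + B.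
  rewrite remE /A /B /rem !sumrB sumr_const card_ord.
  rewrite -(mulr_natl (\int[nu]_y trunc_hker l y) n) !mulrBr.
  by rewrite mulKf ?gt_eqF//; ring.
have Bt : `|B| <= C * (t + tb).
  apply: le_trans (ler_normB _ _) _; rewrite mulrDr; apply: lerD.
    rewrite normrM (ger0_norm (_ : 0 <= n%:R^-1)) ?invr_ge0 ?(ltW n0')// mulrCA ler_wpM2l ?invr_ge0 ?(ltW n0')//.
    rewrite mulr_sumr; apply: le_trans (ler_norm_sum _ _ _) _.
    by apply: ler_sum => j _; exact: trunc_error.
  apply: le_trans (le_normr_Rintegral measurableT irem) _.
  rewrite -RintegralZl//; apply: le_Rintegral => //.
  - exact: integrable_norm.
  - exact: (integrableZl measurableT C iX).
  - by move=> y _; exact: trunc_error.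
have t0 : 0 <= t by rewrite mulr_ge0 ?invr_ge0 ?(ltW n0')// sumr_ge0// => j _; exact: excess_ge0.
have tb0 : 0 <= tb by apply: Rintegral_ge0 => y _; exact: excess_ge0.
have B2 : B ^+ 2 <= (C * (t + tb)) ^+ 2.
  rewrite -(real_normK (num_real B)); apply: lerXn2r => //; rewrite nnegrE//.
  by rewrite mulr_ge0// addr_ge0.
have h1 : (A + B) ^+ 2 <= 2 * A ^+ 2 + 2 * B ^+ 2 by have := sqr_ge0 (A - B); nra.
have h2 : (t + tb) ^+ 2 <= 2 * (t ^+ 2 + tb ^+ 2) by have := sqr_ge0 (t - tb); nra.
have h3 := ler_wpM2l (sqr_ge0 C) h2.
by apply: le_trans h1 _; rewrite lerD2l ler_wpM2l//; apply: le_trans B2 _; rewrite exprMn.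
Qed.

End Cutoff.

Definition deviation (l : nat) (w : T) : R :=
  Num.max ((n%:R^-1 * \sum_j (trunc_hker l (Y j w) - \int[nu]_y trunc_hker l y)) ^+ 2
     - 6 * v l * L / n%:R) 0.

Definition fluctuation (w : T) : R := \sum_(i < Kn) deviation i.+1 w.

Lemma measurable_deviation l : (0 < l)%N -> (l <= Kn)%N ->
  measurable_fun setT (deviation l).
Proof.
move=> l0 lK.
apply: measurable_maxr => //; apply: measurable_funB => //; apply: measurable_funX.
apply: measurable_funM => //; apply: measurable_sum => j; apply: measurable_funB => //.
by apply: measurableT_comp => //; exact: measurable_trunc_hker.
Qed.

Lemma deviation_ge0 l w : 0 <= deviation l w.
Proof. by rewrite le_max lexx orbT. Qed.

Lemma fluctuation_ge0 w : 0 <= fluctuation w.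
Proof. by apply: sumr_ge0 => l _; exact: deviation_ge0. Qed.

Lemma measurable_fluctuation : measurable_fun setT fluctuation.
Proof. by apply: measurable_sum => i; exact: measurable_deviation. Qed.

Lemma deviation_le_fluctuation l w : (0 < l)%N -> (l <= Kn)%N ->
  deviation l w <= fluctuation w.
Proof.
case: l => // l _ lK; rewrite /fluctuation (bigD1 (Ordinal lK))//= lerDl.
by apply: sumr_ge0 => i _; exact: deviation_ge0.
Qed.

(** The number of indices is at most [sqrt n / L ^+ 2 <= 4 sqrt n], and [56 = 4 * 14]. *)
Lemma integral_fluctuation :
  (\int[P]_w (fluctuation w)%:E <= (56 * sg / n%:R)%:E)%E.
Proof.
pose F (i : 'I_Kn) w := (deviation i.+1 w)%:E.
have -> : (\int[P]_w (fluctuation w)%:E = \sum_i \int[P]_w F i w)%E.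
  rewrite -ge0_integral_sum//.
  - by apply: eq_integral => w _; rewrite sumEFin.
  - by move=> i; apply/measurable_EFinP; exact: measurable_deviation.
  - by move=> i w _; rewrite lee_fin deviation_ge0.
apply: (@le_trans _ _ (\sum_(i < Kn) (14 * sg / (n%:R * rn))%:E)%E).
  by apply: lee_sum => i _; exact: main_fluctuation.
rewrite sumEFin lee_fin sumr_const card_ord -(mulr_natl (14 * sg / (n%:R * rn)) Kn).
have [_ _ hK] := KKn.
have h4 : Kn%:R <= 4 * rn.
  apply: le_trans hK _; rewrite ler_pdivrMr ?exprn_gt0//.
  rewrite -[leLHS]mulr1 mulrAC mulrC ler_wpM2r ?(ltW rn0)//.
  by move: L2 => h; nra.
have -> : 56 * sg / n%:R = 4 * rn * (14 * sg / (n%:R * rn)).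
  by field; rewrite !gt_eqF.
by apply: ler_wpM2r => //; rewrite divr_ge0// mulr_ge0// ltW.
Qed.

(** Where [excess] is nonzero, [y^(c-1)] exceeds [sqrt level], so missing powers up to the eighth
    can be bought with powers of the level. *)
Let excess8 y : excess y <= (y `^ (c - 1)) ^+ 8 / Num.sqrt level ^+ 7 /\
  excess y ^+ 2 <= (y `^ (c - 1)) ^+ 8 / level ^+ 3.
Proof.
have l0 := level_gt0.
have s0 : 0 < Num.sqrt level by rewrite sqrtr_gt0.
have p0 := powR_ge0 y (c - 1).
rewrite /excess; have [h|h] := ltP level ((y `^ (c - 1)) ^+ 2) => /=; last first.
  rewrite mulr0n mulr0 expr0n/=.
  by split; rewrite divr_ge0 ?exprn_ge0// ltW.
rewrite mulr1n mulr1; split.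
  rewrite ler_pdivlMr ?exprn_gt0// [leRHS]exprS; apply: ler_wpM2l => //.
  apply: lerXn2r; rewrite ?nnegrE// ?sqrtr_ge0//.
  by rewrite -(ger0_norm p0) -sqrtr_sqr ler_wsqrtr// ltW.
rewrite ler_pdivlMr ?exprn_gt0//.
have -> : (y `^ (c - 1)) ^+ 8 = (y `^ (c - 1)) ^+ 2 * ((y `^ (c - 1)) ^+ 2) ^+ 3 by ring.
apply: ler_wpM2l; first exact: sqr_ge0.
by apply: lerXn2r; rewrite ?nnegrE ?sqr_ge0// ltW.
Qed.

Let law_scaled (r : R) : 0 <= r ->
  (\int[nu]_y ((y `^ (c - 1)) ^+ 8 / r)%:E = (m / r)%:E)%E.
Proof.
move=> r0; rewrite mulrC EFinM -(law_moment8 df dg nuE mY) -ge0_integralZl_EFin ?invr_ge0//.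
- by apply: eq_integral => y _; rewrite mulrC EFinM.
- by move=> y _; rewrite lee_fin exprn_ge0// powR_ge0.
- by apply/measurable_EFinP; apply: measurable_funX; exact: measurable_powR.
Qed.

Let m8 (r : R) : measurable_fun setT (fun y : R => ((y `^ (c - 1)) ^+ 8 / r)%:E).
Proof.
apply/measurable_EFinP; apply: measurable_funM => //.
by apply: measurable_funX; exact: measurable_powR.
Qed.

Let law_excess : (\int[nu]_y (excess y)%:E <= (m / Num.sqrt level ^+ 7)%:E)%E.
Proof.
rewrite -law_scaled ?exprn_ge0 ?sqrtr_ge0//; apply: ge0_le_integral => //.
- by move=> y _; rewrite lee_fin excess_ge0.
- by apply/measurable_EFinP; exact: measurable_excess.
- by move=> y _; rewrite lee_fin; case: (excess8 y).
Qed.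

Let law_excess2 : (\int[nu]_y (excess y ^+ 2)%:E <= (m / level ^+ 3)%:E)%E.
Proof.
rewrite -law_scaled ?exprn_ge0 ?(ltW level_gt0)//; apply: ge0_le_integral => //.
- by move=> y _; rewrite lee_fin sqr_ge0.
- by apply/measurable_EFinP; apply: measurable_funX; exact: measurable_excess.
- by move=> y _; rewrite lee_fin; case: (excess8 y).
Qed.

Lemma integrable_excess : nu.-integrable setT (EFin \o excess).
Proof.
apply: integrable_ge0_lty; [exact: measurable_excess|exact: excess_ge0|].
exact: le_lt_trans law_excess (ltry _).
Qed.

(* Bounds the error of truncating simultaneously for all indices [l <= Kn], since
   [hker_sqr_le] is increasing in [l]. *)
Definition remainder (w : T) : R := Kn%:R * Dl Kn / pi *
  (2 * ((n%:R^-1 * \sum_j excess (Y j w)) ^+ 2 + (\int[nu]_y excess y) ^+ 2)).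

Lemma measurable_remainder : measurable_fun setT remainder.
Proof.
apply: measurable_funM => //; apply: measurable_funM => //; apply: measurable_funD => //.
apply: measurable_funX; apply: measurable_funM => //; apply: measurable_sum => j.
by apply: measurableT_comp => //; exact: measurable_excess.
Qed.

Lemma remainder_ge0 w : 0 <= remainder w.
Proof.
rewrite mulr_ge0// ?mulr_ge0// ?addr_ge0 ?sqr_ge0// ?invr_ge0 ?(ltW pi0)//.
by rewrite fine_ge0// Delta_ge0.
Qed.

(** Here [be] is [level / (sqrt n L)]. Bounding [1 / L] by 2 gives [64 = 2 * 2 ^ 5] for the variance
    term and [2048 = 4 * 2 ^ 9] for the squared mean of [excess]. *)
Definition remainder_cst : R :=
  let be := 2 * pi * G * sg / 27 in
  64 * m / (pi * G * be ^+ 3) + 2048 * m ^+ 2 / (pi * G * be ^+ 7).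

Lemma integral_remainder : (\int[P]_w (remainder w)%:E <= (remainder_cst / n%:R)%:E)%E.
Proof.
set e1 := m / Num.sqrt level ^+ 7; set e2 := m / level ^+ 3.
have sm := second_moment indY lawY n0 measurable_excess excess_ge0 law_excess law_excess2.
pose tb := \int[nu]_y excess y.
have tb0 : 0 <= tb by apply: Rintegral_ge0 => y _; exact: excess_ge0.
have tb1 : tb <= e1.
  rewrite -lee_fin /tb /Rintegral fineK ?law_excess//.
  exact: (integrable_fin_num measurableT integrable_excess).
pose C := Kn%:R * Dl Kn / pi.
have D0 : 0 <= Dl Kn by rewrite fine_ge0// Delta_ge0.
have C0 : 0 <= C by rewrite divr_ge0 ?mulr_ge0// ltW.
have mt : measurable_fun setT (fun w => (n%:R^-1 * \sum_j excess (Y j w)) ^+ 2).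
  apply: measurable_funX; apply: measurable_funM => //; apply: measurable_sum => j.
  by apply: measurableT_comp => //; exact: measurable_excess.
have -> : (\int[P]_w (remainder w)%:E = (2 * C)%:E *
    (\int[P]_w ((n%:R^-1 * \sum_j excess (Y j w)) ^+ 2)%:E + (tb ^+ 2)%:E))%E.
  have -> : (tb ^+ 2)%:E = (\int[P]_w (tb ^+ 2)%:E)%E.
    by rewrite integral_cst//= probability_setT mule1.
  pose t w := ((n%:R^-1 * \sum_j excess (Y j w)) ^+ 2)%:E.
  have t0 w : (0 <= t w)%E by rewrite lee_fin sqr_ge0.
  have mt' : measurable_fun setT t by apply/measurable_EFinP.
  have tbt w : (0 <= t w + (tb ^+ 2)%:E)%E by rewrite adde_ge0// lee_fin sqr_ge0.
  rewrite -(ge0_integralD P measurableT (fun w _ => t0 w) mt'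
    (fun w _ => (sqr_ge0 tb : (0 <= (tb ^+ 2)%:E)%E)) (measurable_cst _)).
  rewrite -(ge0_integralZl_EFin P measurableT (fun w _ => tbt w)
    (emeasurable_funD mt' (measurable_cst _)) (mulr_ge0 (ler0n R 2) C0)).
  by apply: eq_integral => w _; rewrite /t -EFinD -EFinM; congr EFin; rewrite /remainder -/C -/tb; ring.
apply: (@le_trans _ _ ((2 * C)%:E * ((e2 / n%:R + e1 ^+ 2)%:E + (e1 ^+ 2)%:E))%E).
  apply: lee_wpmul2l; first by rewrite lee_fin mulr_ge0.
  apply: leeD; first exact: sm.
  by rewrite lee_fin; apply: lerXn2r; rewrite ?nnegrE//; exact: le_trans tb1.
rewrite -EFinD -EFinM lee_fin.
have lv0 := level_gt0.
have e1E : e1 ^+ 2 = m ^+ 2 / level ^+ 7.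
  rewrite /e1 expr_div_n -exprM mulnC exprM sqr_sqrtr//; exact: ltW.
have e20 : 0 <= e2 by rewrite divr_ge0// exprn_ge0// ltW.
have [_ _ hK] := KKn; have hG := index_le dg wlt KKn.
(* Both constraints of the index set at [Kn] enter here, one for each factor. *)
have C1 : C <= rn / L ^+ 2 * (n%:R / G) / pi.
  apply: ler_wpM2r; first by rewrite invr_ge0 ltW.
  apply: ler_pM => //.
  by rewrite ler_pdivlMr// mulrC.
have s0 : 0 <= e2 / n%:R + e1 ^+ 2 + e1 ^+ 2.
  by rewrite !addr_ge0 ?sqr_ge0// divr_ge0// ltW.
apply: (@le_trans _ _ (2 * (rn / L ^+ 2 * (n%:R / G) / pi) *
    (e2 / n%:R + e1 ^+ 2 + e1 ^+ 2))).
  by apply: ler_wpM2r => //; apply: ler_wpM2l.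
rewrite e1E /e2 /level /remainder_cst.
pose be := 2 * pi * G * sg / 27; rewrite -/be.
have be0 : 0 < be by rewrite !mulr_gt0// invr_gt0.
have gen (M r N a b p q : R) : M != 0 -> r != 0 -> a != 0 -> b != 0 -> p != 0 -> N = r ^+ 2 ->
    2 * (r / M ^+ 2 * (N / a) / p) * (q / (b * (r * M)) ^+ 3 / N +
      q ^+ 2 / (b * (r * M)) ^+ 7 + q ^+ 2 / (b * (r * M)) ^+ 7) =
    2 * q / (p * a * b ^+ 3) / N * M^-1 ^+ 5 +
    4 * q ^+ 2 / (p * a * b ^+ 7) / N * M^-1 ^+ 9 / N.
  by move=> M0 r0 a0 b0 p0 ->; field; rewrite M0 r0 a0 b0 p0.
rewrite (@gen L rn n%:R G be pi m) ?gt_eqF//.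
have iL : L^-1 <= 2 by rewrite invf_ple ?posrE.
have iL0 : 0 <= L^-1 by rewrite invr_ge0 ltW.
have iL5 : L^-1 ^+ 5 <= 2 ^+ 5 by apply: lerXn2r; rewrite ?nnegrE.
have iL9 : L^-1 ^+ 9 <= 2 ^+ 9 by apply: lerXn2r; rewrite ?nnegrE.
have in1 : (n%:R : R)^-1 <= 1 by rewrite invf_le1// ler1n.
have in0 : 0 <= (n%:R : R)^-1 by rewrite invr_ge0 ltW.
have pc3 : 0 < pi * G * be ^+ 3 by rewrite mulr_gt0 ?exprn_gt0// mulr_gt0.
have pc7 : 0 < pi * G * be ^+ 7 by rewrite mulr_gt0 ?exprn_gt0// mulr_gt0.
have a0 : 0 <= 2 * m / (pi * G * be ^+ 3) / n%:R.
  by apply: divr_ge0; [apply: divr_ge0; [exact: mulr_ge0|exact: ltW]|exact: ltW].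
have b0 : 0 <= 4 * m ^+ 2 / (pi * G * be ^+ 7) / n%:R.
  apply: divr_ge0; [apply: divr_ge0; [|exact: ltW]|exact: ltW].
  by rewrite mulr_ge0// sqr_ge0.
have h1 := ler_wpM2l a0 iL5.
have h2 : 4 * m ^+ 2 / (pi * G * be ^+ 7) / n%:R * L^-1 ^+ 9 / n%:R <=
    4 * m ^+ 2 / (pi * G * be ^+ 7) / n%:R * 2 ^+ 9.
  rewrite -mulrA; apply: ler_wpM2l => //; rewrite -[leRHS]mulr1.
  by apply: ler_pM => //; exact: exprn_ge0.
apply: le_trans (lerD h1 h2) _.
move: a0 b0 => _ _; rewrite le_eqVlt; apply/orP; left; apply/eqP; ring.
Qed.

Definition squared_ratio (y : R) : R := y `^ (2 * (c - 1)) / fine (moment (2 * (c - 1)) g).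

Let eU0 : 0 < fine (moment (2 * (c - 1)) g).
Proof.
rewrite -lte_fin fineK; first exact: moment_gt0.
by case: (moment2_fin df dg nuE mY).
Qed.

Lemma measurable_squared_ratio : measurable_fun setT squared_ratio.
Proof. by apply: measurable_funM => //; exact: measurable_powR. Qed.

Lemma squared_ratio_ge0 y : 0 <= squared_ratio y.
Proof. by rewrite divr_ge0 ?powR_ge0// ltW. Qed.

Lemma law_squared_ratio : (\int[nu]_y (squared_ratio y)%:E = sg%:E)%E.
Proof.
have eU := gt_eqF eU0.
transitivity ((fine (moment (2 * (c - 1)) g))^-1%:E * \int[nu]_y ((y `^ (c - 1)) ^+ 2)%:E)%E.
  rewrite -ge0_integralZl_EFin ?invr_ge0 ?(ltW eU0)//.
  - by apply: eq_integral => y _; rewrite /squared_ratio -powR_natM mulrC EFinM.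
  - by move=> y _; rewrite lee_fin sqr_ge0.
  - by apply/measurable_EFinP; exact: mpow.
rewrite (law_moment2 df dg nuE mY) -EFinM; congr EFin.
by rewrite mulrCA mulVf ?mulr1// eU.
Qed.

(** The exponent [s ^+ 2 / (16 q)] of [lower_tail], with [q] bounding the second moment of
    [squared_ratio] by way of [p ^+ 4 <= 1 + p ^+ 8]. *)
Definition rate : R := sg ^+ 2 / (16 * ((1 + m) / fine (moment (2 * (c - 1)) g) ^+ 2)).

Let rate0 : 0 < rate.
Proof. by rewrite divr_gt0 ?exprn_gt0// mulr_gt0// divr_gt0 ?exprn_gt0// ltr_pwDl. Qed.

(** The exponential is weakened to quadratic decay by [expR x >= x ^+ 2 / 2]: [penalty_gap]
    multiplies it by [L <= n], and [1 / n] still remains. *)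
Lemma sigma_hat_tail :
  (\int[P]_w ((sigma_hat (fun j => Y j w) c g < sg / 2)%R%:R)%:E <=
   (2 / (rate * n%:R) ^+ 2)%:E)%E.
Proof.
pose q := (1 + m) / fine (moment (2 * (c - 1)) g) ^+ 2.
have q0 : 0 < q by rewrite divr_gt0 ?exprn_gt0// ltr_pwDl.
have Zq : (\int[nu]_y (squared_ratio y ^+ 2)%:E <= q%:E)%E.
  have -> : (\int[nu]_y (squared_ratio y ^+ 2)%:E =
     ((fine (moment (2 * (c - 1)) g) ^+ 2)^-1)%:E * \int[nu]_y ((y `^ (c - 1)) ^+ 4)%:E)%E.
    rewrite -ge0_integralZl_EFin ?invr_ge0 ?sqr_ge0//.
    - apply: eq_integral => y _; rewrite -EFinM /squared_ratio powR_natM; congr EFin.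
      by rewrite expr_div_n -exprM mulrC.
    - by move=> y _; rewrite lee_fin exprn_ge0// powR_ge0.
    - by apply/measurable_EFinP; apply: measurable_funX; exact: measurable_powR.
  rewrite /q [X in (_ <= X%:E)%E]mulrC EFinM; apply: lee_wpmul2l.
    by rewrite lee_fin invr_ge0 sqr_ge0.
  exact: (law_moment_le df dg nuE mY (isT : (4 <= 8)%N)).
have := lower_tail indY lawY n0 measurable_squared_ratio squared_ratio_ge0 sg0 q0 law_squared_ratio Zq.
move=> /le_trans; apply; rewrite lee_fin -/rate.
have r0 : 0 < rate * n%:R by rewrite mulr_gt0.
have -> : n%:R * (sg ^+ 2 / (16 * q)) = rate * n%:R by rewrite mulrC.
rewrite expRN -[leRHS]invrK lef_pV2 ?posrE ?expR_gt0 ?invr_gt0 ?divr_gt0 ?exprn_gt0//.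
have := expR_ge1Dxn 1 (ltW r0); rewrite (_ : 2`!%:R = 2 :> R)// => h.
by rewrite invf_div; lra.
Qed.

(** If [sigma_hat] is at least [sg / 2], the factor 2 in [Vhat] gives [V <= Vhat]; otherwise [V]
    itself is at most [chi * sg * L], because [G Delta <= n] on the index set. *)
Definition penalty_gap (chi : R) (w : T) : R :=
  chi * sg * L * (sigma_hat (fun j => Y j w) c g < sg / 2)%R%:R.

Lemma measurable_sigma_hat : measurable_fun setT (fun w => sigma_hat (fun j => Y j w) c g).
Proof.
apply: measurable_funM => //; apply: measurable_sum => j.
by apply: (measurableT_comp measurable_squared_ratio).
Qed.

Lemma measurable_penalty_gap chi : measurable_fun setT (penalty_gap chi).
Proof.
apply: measurable_funM => //; apply: (measurableT_comp mnatb).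
by apply: measurable_fun_ltr => //; exact: measurable_sigma_hat.
Qed.

Lemma penalty_gap_ge0 chi w : 0 <= chi -> 0 <= penalty_gap chi w.
Proof. by move=> chi0; rewrite !mulr_ge0// ltW. Qed.

Lemma integral_penalty_gap chi : 0 <= chi ->
  (\int[P]_w (penalty_gap chi w)%:E <= (2 * chi * sg / rate ^+ 2 / n%:R)%:E)%E.
Proof.
move=> chi0; have C0 : 0 <= chi * sg * L by rewrite !mulr_ge0// ltW.
have -> : (\int[P]_w (penalty_gap chi w)%:E = (chi * sg * L)%:E *
    \int[P]_w ((sigma_hat (fun j => Y j w) c g < sg / 2)%R%:R)%:E)%E.
  rewrite -ge0_integralZl_EFin//.
  apply/measurable_EFinP; apply: (measurableT_comp mnatb).
  by apply: measurable_fun_ltr => //; exact: measurable_sigma_hat.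
apply: (@le_trans _ _ ((chi * sg * L)%:E * (2 / (rate * n%:R) ^+ 2)%:E)%E).
  by apply: lee_wpmul2l => //; exact: sigma_hat_tail.
rewrite -EFinM lee_fin.
have hL : L <= n%:R by exact: ln_le_nat.
have -> : 2 * chi * sg / rate ^+ 2 / n%:R = chi * sg * n%:R * (2 / (rate * n%:R) ^+ 2).
  by field; rewrite !gt_eqF.
apply: ler_wpM2r; first by rewrite divr_ge0// sqr_ge0.
by apply: ler_wpM2l => //; rewrite mulr_ge0// ltW.
Qed.

Lemma integral_sigma_hat :
  (\int[P]_w (sigma_hat (fun j => Y j w) c g)%:E = sg%:E)%E.
Proof.
have mZ j : measurable_fun setT (fun w => (squared_ratio (Y j w))%:E).
  by apply/measurable_EFinP; apply: measurableT_comp => //; exact: measurable_squared_ratio.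
have Z0 j w : (0 <= (squared_ratio (Y j w))%:E)%E by rewrite lee_fin squared_ratio_ge0.
transitivity (\int[P]_w ((n%:R^-1)%:E * \sum_j (squared_ratio (Y j w))%:E))%E.
  by apply: eq_integral => w _; rewrite sumEFin -EFinM.
rewrite ge0_integralZl_EFin ?invr_ge0 ?(ltW n0')//; last 2 first.
- by move=> w _; exact: sume_ge0.
- exact: emeasurable_sum.
rewrite ge0_integral_sum//.
under eq_bigr do rewrite (integral_lawY lawY _ measurable_squared_ratio) law_squared_ratio.
rewrite sumEFin sumr_const card_ord -EFinM -(mulr_natl sg n) mulKf// gt_eqF//.
Qed.

End Stochastic.

(** * The oracle inequality *)

Section Oracle.
Context {R : realType}.

Lemma sqr_distD (x y z t : R) :
  (x - t) ^+ 2 <= 3 * ((x - y) ^+ 2 + (y - z) ^+ 2 + (t - z) ^+ 2).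
Proof.
have h1 := sqr_ge0 ((x - y) - (y - z)); have h2 := sqr_ge0 ((x - y) + (t - z)).
have h3 := sqr_ge0 ((y - z) + (t - z)); nra.
Qed.

Definition oracle_stat (Th Vh : nat -> R) (Kn k : nat) : R :=
  \big[Num.max/0]_(k.+1 <= l < Kn.+1) Num.max ((Th l - Th k) ^+ 2 - Vh l) 0.

(* [th k] is the mean of [Th k], [b] bounds the bias at [k], [q] the fluctuations in
   excess of the penalty and [J] the deficit of the estimated penalty. *)
Lemma oracle_pointwise (Th th V Vh : nat -> R) (tr b q J : R) (Kn k kh : nat) :
  (0 < k <= Kn)%N -> (0 < kh <= Kn)%N ->
  oracle_stat Th Vh Kn kh + Vh kh <= oracle_stat Th Vh Kn k + Vh k ->
  (forall l, 0 <= Vh l) ->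
  (forall l, (0 < l <= Kn)%N -> (Th l - th l) ^+ 2 <= V l / 6 + q) ->
  (forall l, (k < l <= Kn)%N -> (th l - th k) ^+ 2 <= b ^+ 2) ->
  (forall l, (k < l <= Kn)%N -> V k <= V l) ->
  (forall l, (0 < l <= Kn)%N -> V l - Vh l <= J) ->
  0 <= J -> 0 <= q -> (tr - th k) ^+ 2 <= b ^+ 2 ->
  (tr - Th kh) ^+ 2 <= 16 * b ^+ 2 + 2 / 3 * V k + 28 * q + 4 * J + 4 * Vh k.
Proof.
move=> kK khK hA Vh0 hT hb hV hJ J0 q0 htr.
have A0 j : 0 <= oracle_stat Th Vh Kn j by exact: bigmax_ge_id.
have Age j l : (j < l <= Kn)%N -> (Th l - Th j) ^+ 2 - Vh l <= oracle_stat Th Vh Kn j.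
  move=> jl; apply: (bigmax_sup_seq _ l) => //; last by rewrite le_max lexx.
  by rewrite mem_index_iota ltnS.
(* Two deviations and one bias under the factor 3 cost [3 (V l / 6 + V k / 6) <= V l], since [V]
   increases; [V l] is then paid for by [Vh l + J]. *)
have Ale : oracle_stat Th Vh Kn k <= 3 * b ^+ 2 + 6 * q + J.
  rewrite /oracle_stat big_nat_cond; apply: bigmax_le => [|l /andP[kl _]].
    by have := sqr_ge0 b; lra.
  rewrite ge_max; apply/andP; split; last by have := sqr_ge0 b; lra.
  rewrite ltnS in kl; have l0 : (0 < l <= Kn)%N.
    by case/andP: kl => kl ->; rewrite (leq_ltn_trans _ kl).
  have h1 := hT _ l0; have h2 := hT _ kK; have h3 := hb _ kl.
  have h4 := hV _ kl; have h5 := hJ _ l0; have h6 := sqr_distD (Th l) (th l) (th k) (Th k).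
  lra.
(* The statistic at the smaller of the two indices and the penalty at the larger one bound the
   difference; minimality of [kh] removes whatever refers to [kh]. *)
have step : (Th kh - Th k) ^+ 2 <= 2 * (oracle_stat Th Vh Kn k + Vh k).
  have hk := Vh0 k; have hkh := Vh0 kh; have Ak := A0 k; have Akh := A0 kh.
  have [lt|lt|e] := ltngtP k kh.
  - by have := Age k kh; rewrite lt /=; case/andP: khK => _ -> /(_ isT) h; lra.
  - have := Age kh k; rewrite lt /=; case/andP: kK => _ -> /(_ isT).
    by rewrite -sqrrN opprB => h; lra.
  - by rewrite e subrr expr0n/=; subst kh; lra.
(* The total is four times the bias and deviation at [k] plus four times [oracle_stat + Vh] at [k],
   so [16 = 4 + 4 * 3], [28 = 4 + 4 * 6] and [2 / 3 = 4 / 6]. *)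
have hk := hT _ kK.
have h1 : (tr - Th k) ^+ 2 <= 2 * ((tr - th k) ^+ 2 + (Th k - th k) ^+ 2).
  by have := sqr_ge0 ((tr - th k) + (Th k - th k)); nra.
have h2 : (tr - Th kh) ^+ 2 <= 2 * ((tr - Th k) ^+ 2 + (Th kh - Th k) ^+ 2).
  by have := sqr_ge0 ((tr - Th k) + (Th kh - Th k)); nra.
lra.
Qed.

End Oracle.

(** * From the pointwise comparison to the risk *)

Section Risk.
Context {R : realType}.
Local Notation mu := (@lebesgue_measure R).
Variables (c chi m : R) (Psi : R -> R[i]) (f g : R -> R).
Hypothesis chi72 : 72 <= chi.
Hypothesis df : is_density f.
Hypothesis dg : is_density g.
Hypothesis Lf : in_Lp 1 (c - 1) f.
Hypothesis Lg : in_Lp 1 (c - 1) g.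
Hypothesis g_neq0 : forall t, mellin c g t != 0.
Hypothesis wlt : (wsup c g < +oo)%E.
Hypothesis mPsi : cmeasurable setT Psi.
Hypothesis conjPsi : forall t, conjc (Psi t) = Psi (- t).
Hypothesis iPf : cintegrable setT (fun t => Psi t * mellin c f t).
Hypothesis mY : moment_Y (8 * (c - 1)) f g = m%:E.
Context d (T : measurableType d) (P : probability T R) (n : nat).
Variable Y : 'I_n -> {RV P >-> R}.
Variable khat : {RV P >-> nat}.
Hypothesis n2 : (2 <= n)%N.
Variable Kn : nat.
Hypothesis KKn : index_set c Psi g n Kn.
Hypothesis Kmax : forall k, index_set c Psi g n k -> (k <= Kn)%N.
Hypothesis iidY : iid_with_density Y (dens_Y f g).
Hypothesis argminP : forall w, is_argmin (fun j => Y j w) c chi Psi g Kn (khat w).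

Local Notation G := (fine (wsup c g)).
Local Notation sg := (sigma c f).
Local Notation L := (ln (n%:R : R)).
Local Notation Dl l := (fine (Delta c Psi g l%:R)).
Local Notation nu := (distribution P (Y (Ordinal (ltnW n2)))).

Let indY : mutually_independent Y. Proof. by case: iidY. Qed.
Let nuE (A : set R) : measurable A ->
  (nu A = \int[mu]_(y in A `&` Rpos) dens_Y f g y)%E.
Proof. by case: iidY => _; apply. Qed.
Let lawY j (A : set R) : measurable A -> distribution P (Y j) A = nu A.
Proof. by move=> mA; rewrite nuE//; case: iidY => _; apply. Qed.

Let n0' : 0 < n%:R :> R. Proof. by rewrite ltr0n (leq_trans _ n2). Qed.
Let chi0 : 0 <= chi. Proof. by apply: le_trans chi72. Qed.
Let G0 : 0 < G. Proof. exact: fine_wsup_gt0. Qed.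
Let sg0 : 0 < sg. Proof. exact (sigma_gt0 df dg nuE mY). Qed.
Let L0 : 0 < L.
Proof. by apply: (lt_le_trans _ (ln_ge_half n2)); rewrite invr_gt0. Qed.
Let Dl0 l : 0 <= Dl l. Proof. by rewrite fine_ge0// Delta_ge0. Qed.

Let index l : (0 < l <= Kn)%N -> index_set c Psi g n l.
Proof. by case/andP => l0 lK; exact: index_down KKn l0 lK. Qed.

Definition estimate (l : nat) (w : T) : R := n%:R^-1 * \sum_j hker c Psi g l%:R (Y j w).

Let centre (l : nat) : R := theta_on c Psi f `[- l%:R, l%:R].

Lemma theta_hat_estimate l w : (0 < l <= Kn)%N ->
  theta_hat (fun j => Y j w) c Psi g l%:R = (estimate l w)%:C%C.
Proof.
move=> lK; apply: theta_hatE => //; first by rewrite ltr0n; case/andP: lK.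
exact: (index_fin dg (index lK)).
Qed.

Lemma measurable_estimate l : (0 < l <= Kn)%N -> measurable_fun setT (estimate l).
Proof.
move=> lK; apply: measurable_funM => //; apply: measurable_sum => j.
apply: measurableT_comp => //; apply: measurable_hker => //.
exact: (index_fin dg (index lK)).
Qed.

Let qw w := 2 * fluctuation c Psi f g Y nu Kn w + 2 * remainder c Psi f g Y nu Kn w.

Let qw0 w : 0 <= qw w.
Proof. by rewrite addr_ge0// mulr_ge0// ?fluctuation_ge0 ?remainder_ge0. Qed.

Let VE l : V c chi Psi f g n l = chi * G * sg * Dl l * (L / n%:R).
Proof. by []. Qed.

Lemma estimate_deviation l w : (0 < l <= Kn)%N ->
  (estimate l w - centre l) ^+ 2 <= V c chi Psi f g n l / 6 + qw w.
Proof.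
move=> lK; have /andP[l0 lK'] := lK.
have fD := index_fin dg (index lK).
have -> : centre l = \int[nu]_y hker c Psi g l%:R y.
  by rewrite /Rintegral (law_hker df dg Lf Lg g_neq0 mPsi conjPsi iPf nuE fD).
have ie := integrable_excess df dg wlt mY nuE n2.
have h1 := estimator_split df dg Lg mPsi conjPsi wlt mY Y nuE n2 KKn l0 lK' w ie.
have h2 := deviation_le_fluctuation c Psi f g Y nu w l0 lK'.
have h3 : (n%:R^-1 * \sum_j (trunc_hker c Psi f g n l (Y j w) - \int[nu]_y trunc_hker c Psi f g n l y)) ^+ 2
    - 6 * (G * sg * Dl l) * L / n%:R <= deviation c Psi f g Y nu l w.
  by rewrite /deviation le_max lexx.
apply: le_trans h1 _; rewrite /qw /remainder VE.
(* A sixth of the penalty has to cover twice the threshold [6 v L / n] subtracted in [deviation]. *)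
have h4 : 72 * (G * sg * Dl l * (L / n%:R)) <= chi * G * sg * Dl l * (L / n%:R).
  rewrite (_ : chi * G * sg * Dl l * (L / n%:R) = chi * (G * sg * Dl l * (L / n%:R))); last by ring.
  by apply: ler_wpM2r => //; rewrite !mulr_ge0 ?invr_ge0// ltW.
have e : 6 * (G * sg * Dl l) * L / n%:R = 6 * (G * sg * Dl l * (L / n%:R)) by ring.
rewrite e in h3; move: h2 h3 h4.
set X := (_ * \sum_j _) ^+ 2; set Z := G * sg * Dl l * _; set Z' := chi * G * sg * Dl l * _.
set D' := deviation _ _ _ _ _ _ _ _; set F' := fluctuation _ _ _ _ _ _ _ _; set W := _ * (2 * _).
by move: X Z Z' D' F' W => X Z Z' D' F' W h2 h3 h4; lra.
Qed.

Lemma penalty_deviation l w : (0 < l <= Kn)%N ->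
  V c chi Psi f g n l - Vhat (fun j => Y j w) c chi Psi g l <= penalty_gap c f g Y chi w.
Proof.
move=> lK; rewrite VE /Vhat /penalty_gap.
have hG : G * Dl l <= n%:R := index_le dg wlt (index lK).
set sh := sigma_hat _ c g.
have sh0 : 0 <= sh.
  apply: mulr_ge0; first by rewrite invr_ge0 ltW.
  by apply: sumr_ge0 => j _; exact: (squared_ratio_ge0 df dg mY nuE).
have X0 : 0 <= chi * G * Dl l * (L / n%:R) by rewrite !mulr_ge0 ?invr_ge0// ltW.
have -> : chi * G * sg * Dl l * (L / n%:R) - 2 * chi * G * sh * Dl l * (L / n%:R) =
  chi * G * Dl l * (L / n%:R) * (sg - 2 * sh) by ring.
have [h|h] := ltP sh (sg / 2) => /=; rewrite ?mulr1n ?mulr0n ?mulr1 ?mulr0; last first.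
  by rewrite mulr_ge0_le0//; lra.
apply: (@le_trans _ _ (chi * G * Dl l * (L / n%:R) * sg)).
  by apply: ler_wpM2l => //; lra.
have -> : chi * G * Dl l * (L / n%:R) * sg = chi * sg * L * (G * Dl l / n%:R) by ring.
rewrite -[leRHS]mulr1; apply: ler_wpM2l; last by rewrite ler_pdivrMr ?mul1r.
by rewrite !mulr_ge0// ltW.
Qed.

Lemma Vhat_ge0 l w : 0 <= Vhat (fun j => Y j w) c chi Psi g l.
Proof.
rewrite /Vhat !mulr_ge0// ?invr_ge0 ?(ltW G0) ?(ltW L0) ?(ltW n0')//.
by apply: sumr_ge0 => j _; exact: (squared_ratio_ge0 df dg mY nuE).
Qed.

Lemma Ahat_oracle k w : (0 < k <= Kn)%N ->
  Ahat (fun j => Y j w) c chi Psi g Kn k =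
  oracle_stat (fun l => estimate l w) (fun l => Vhat (fun j => Y j w) c chi Psi g l) Kn k.
Proof.
move=> kK; apply: eq_big_nat => l /andP[kl]; rewrite ltnS => lK.
rewrite !theta_hat_estimate ?lK ?(leq_ltn_trans _ kl)// -rmorphB.
by rewrite normc_sqr /= expr0n/= addr0.
Qed.

Let khatK w : (0 < khat w <= Kn)%N.
Proof. by case: (argminP w) => Kk _; rewrite (Kmax Kk) andbT; case: Kk. Qed.

Lemma risk_pointwise k w : (0 < k <= Kn)%N ->
  (theta_on c Psi f setT - estimate (khat w) w) ^+ 2 <=
  16 * fine (tail_norm c Psi f k%:R) ^+ 2 + 2 / 3 * V c chi Psi f g n k +
  56 * fluctuation c Psi f g Y nu Kn w + 56 * remainder c Psi f g Y nu Kn w +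
  4 * penalty_gap c f g Y chi w + 4 * Vhat (fun j => Y j w) c chi Psi g k.
Proof.
move=> kK; have k0 : 0 < k%:R :> R by rewrite ltr0n; case/andP: kK.
have J0 := penalty_gap_ge0 df dg mY Y nuE n2 w chi0.
have bias D : measurable (D : set (measurableTypeR R)) -> `[- k%:R, k%:R] `<=` D ->
    (theta_on c Psi f D - centre k) ^+ 2 <= fine (tail_norm c Psi f k%:R) ^+ 2.
  move=> mD sD; have h := bias_le mPsi conjPsi Lf iPf k0 mD sD.
  rewrite -(real_normK (num_real (theta_on c Psi f D - centre k))).
  by apply: lerXn2r => //; rewrite nnegrE// (le_trans _ h).
apply: le_trans (oracle_pointwise (Th := fun l => estimate l w) (th := centre)
  (V := V c chi Psi f g n) (Vh := fun l => Vhat (fun j => Y j w) c chi Psi g l)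
  (q := qw w) kK (khatK w) _ _ _ _ _ _ J0 (qw0 w) (bias setT _ _)) _.
- have [_ hk] := argminP w.
  by rewrite -!Ahat_oracle//; apply: hk; exact: index.
- by move=> l; exact: Vhat_ge0.
- by move=> l; exact: estimate_deviation.
- move=> l /andP[kl lK]; apply: bias; first exact: measurable_itv.
  have : k%:R <= l%:R :> R by rewrite ler_nat ltnW.
  by move=> h t; rewrite /= !in_itv/= => /andP[h1 h2]; apply/andP; split; lra.
- move=> l /andP[kl lK]; rewrite !VE; apply: ler_wpM2r.
    by rewrite divr_ge0 ?ltW.
  apply: ler_wpM2l; first by rewrite !mulr_ge0// ltW.
  apply: fine_le; [exact: (index_fin dg (index kK))| |].
    by apply: (index_fin dg (@index l _)); rewrite lK andbT (leq_ltn_trans _ kl).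
  by apply: le_Delta => //; rewrite ler_nat ltnW.
- by move=> l; exact: penalty_deviation.
- exact: measurableT.
- by [].
- by rewrite le_eqVlt /qw; apply/orP; left; apply/eqP; ring.
Qed.

Let lossE w : Normc.normc (theta c Psi f - theta_hat (fun j => Y j w) c Psi g (khat w)%:R) ^+ 2 =
  (theta_on c Psi f setT - estimate (khat w) w) ^+ 2.
Proof.
rewrite (thetaE mPsi conjPsi Lf iPf) theta_hat_estimate// -rmorphB.
by rewrite normc_sqr /= expr0n/= addr0.
Qed.

(** The index of the estimator is random but takes finitely many values, so the loss is a finite sum
    over the events on which [khat] is constant. *)
Lemma measurable_loss :
  measurable_fun setT (fun w => (theta_on c Psi f setT - estimate (khat w) w) ^+ 2).
Proof.
have -> : (fun w => (theta_on c Psi f setT - estimate (khat w) w) ^+ 2) =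
  (fun w => \sum_(i < Kn) (khat w == i.+1)%:R * (theta_on c Psi f setT - estimate i.+1 w) ^+ 2).
  apply/funext => w; have := khatK w; case E : (khat w) => [|l] //= lK.
  rewrite (bigD1 (Ordinal lK))//= eqxx mul1r big1 ?addr0// => i iE.
  rewrite eqSS; case: eqP => [e|]; last by rewrite mul0r.
  by case/eqP: iE; apply/val_inj.
apply: measurable_sum => i; apply: measurable_funM; last first.
  by apply: measurable_funX; apply: measurable_funB => //; apply: measurable_estimate; rewrite /= ltn_ord.
have mn : measurable_fun setT (fun k : nat => (k == i.+1)%:R : R) by [].
exact: (measurableT_comp mn).
Qed.

Lemma integral_Vhat k : (0 < k <= Kn)%N ->
  (\int[P]_w (Vhat (fun j => Y j w) c chi Psi g k)%:E = (2 * V c chi Psi f g n k)%:E)%E.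
Proof.
move=> kK; pose b := 2 * chi * G * Dl k * (L / n%:R).
have b0 : 0 <= b by rewrite !mulr_ge0 ?invr_ge0// ltW.
have -> : 2 * V c chi Psi f g n k = b * sg by rewrite VE /b; ring.
rewrite EFinM -(integral_sigma_hat df dg mY lawY nuE n2) -ge0_integralZl_EFin//.
- by apply: eq_integral => w _; rewrite -EFinM /Vhat /b; congr EFin; ring.
- move=> w _; rewrite lee_fin; apply: mulr_ge0; first by rewrite invr_ge0 ltW.
  by apply: sumr_ge0 => j _; exact: (squared_ratio_ge0 df dg mY nuE).
- by apply/measurable_EFinP; exact: measurable_sigma_hat.
Qed.

Lemma risk_le k : index_set c Psi g n k ->
  (\int[P]_w (Normc.normc (theta c Psi f -
      theta_hat (fun j => Y j w) c Psi g (khat w)%:R) ^+ 2)%:E <=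
   (16 * (fine (tail_norm c Psi f k%:R) ^+ 2 + V c chi Psi f g n k) +
    (56 * (56 * sg + remainder_cst c m f g) +
     4 * (2 * chi * sg / rate c m f g ^+ 2)) / n%:R)%:E)%E.
Proof.
move=> Kk; have kK : (0 < k <= Kn)%N by rewrite (Kmax Kk) andbT; case: Kk.
pose a := 16 * fine (tail_norm c Psi f k%:R) ^+ 2 + 2 / 3 * V c chi Psi f g n k.
have V0 : 0 <= V c chi Psi f g n k by rewrite VE !mulr_ge0 ?invr_ge0// ltW.
have a0 : 0 <= a by rewrite addr_ge0// mulr_ge0// sqr_ge0.
pose F1 w := (56 * fluctuation c Psi f g Y nu Kn w)%:E.
pose F2 w := (56 * remainder c Psi f g Y nu Kn w)%:E.
pose F3 w := (4 * penalty_gap c f g Y chi w)%:E.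
pose F4 w := (4 * Vhat (fun j => Y j w) c chi Psi g k)%:E.
have F10 w : (0 <= F1 w)%E by rewrite lee_fin mulr_ge0// fluctuation_ge0.
have F20 w : (0 <= F2 w)%E by rewrite lee_fin mulr_ge0// remainder_ge0.
have J0 w : 0 <= penalty_gap c f g Y chi w by exact (penalty_gap_ge0 df dg mY Y nuE n2 w chi0).
have F30 w : (0 <= F3 w)%E by rewrite lee_fin mulr_ge0.
have F40 w : (0 <= F4 w)%E by rewrite lee_fin mulr_ge0// Vhat_ge0.
have mF1 : measurable_fun setT (fluctuation c Psi f g Y nu Kn) by exact: measurable_fluctuation.
have mF2 : measurable_fun setT (remainder c Psi f g Y nu Kn) by exact: measurable_remainder.
have mF3 : measurable_fun setT (penalty_gap c f g Y chi) by exact: measurable_penalty_gap.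
have mF4 : measurable_fun setT (fun w => Vhat (fun j => Y j w) c chi Psi g k).
  by do 3 (apply: measurable_funM => //); exact: measurable_sigma_hat.
have mE (r : R) (h : T -> R) : measurable_fun setT h -> measurable_fun setT (fun w => (r * h w)%:E).
  by move=> mh; apply/measurable_EFinP; exact: measurable_funM.
have iE (r : R) (h : T -> R) : 0 <= r -> (forall w, 0 <= h w) -> measurable_fun setT h ->
    (\int[P]_w (r * h w)%:E = r%:E * \int[P]_w (h w)%:E)%E.
  move=> r0 h0 mh; rewrite -ge0_integralZl_EFin//.
    by move=> w _; rewrite lee_fin.
  by apply/measurable_EFinP.
have mE1 : measurable_fun setT F1 := mE _ _ mF1.
have mE2 : measurable_fun setT F2 := mE _ _ mF2.
have mE3 : measurable_fun setT F3 := mE _ _ mF3.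
have mE4 : measurable_fun setT F4 := mE _ _ mF4.
have mE34 : measurable_fun setT (fun w => F3 w + F4 w)%E := emeasurable_funD mE3 mE4.
have mE234 : measurable_fun setT (fun w => F2 w + (F3 w + F4 w))%E := emeasurable_funD mE2 mE34.
have mE1234 : measurable_fun setT (fun w => F1 w + (F2 w + (F3 w + F4 w)))%E :=
  emeasurable_funD mE1 mE234.
apply: (@le_trans _ _ (\int[P]_w (a%:E + (F1 w + (F2 w + (F3 w + F4 w))))%E)%E).
  apply: ge0_le_integral => //.
  - by move=> w _; rewrite lee_fin sqr_ge0.
  - apply/measurable_EFinP; apply: (eq_measurable_fun _ _ measurable_loss) => w _.
    by rewrite lossE.
  - exact: (emeasurable_funD (measurable_cst _) mE1234).
  - move=> w _; rewrite lossE -!EFinD lee_fin; apply: le_trans (risk_pointwise w kK) _.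
    by rewrite /a !addrA.
rewrite ge0_integralD//; last by move=> w _; rewrite !adde_ge0.
rewrite ge0_integralD//; last by move=> w _; rewrite !adde_ge0.
rewrite ge0_integralD//; last by move=> w _; rewrite !adde_ge0.
rewrite ge0_integralD//.
rewrite integral_cst//= probability_setT mule1.
rewrite [X in (_ + (X + _) <= _)%E](iE 56 _ _ (fluctuation_ge0 c Psi f g Y nu Kn) mF1)//.
rewrite [X in (_ + (_ + (X + _)) <= _)%E](iE 56 _ _ (remainder_ge0 c Psi f g Y nu Kn) mF2)//.
rewrite [X in (_ + (_ + (_ + (X + _))) <= _)%E](iE 4 _ _ J0 mF3)//.
rewrite [X in (_ + (_ + (_ + (_ + X))) <= _)%E](iE 4 _ _ (Vhat_ge0 k) mF4)// integral_Vhat//.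
have h1 := integral_fluctuation df dg Lg mPsi conjPsi wlt mY indY lawY nuE n2 KKn.
have h2 := integral_remainder df dg wlt mY indY lawY nuE n2 KKn.
have h3 := integral_penalty_gap df dg mY indY lawY nuE n2 chi0.
apply: (@le_trans _ _ (a%:E + (56%:E * (56 * sg / n%:R)%:E + (56%:E * (remainder_cst c m f g / n%:R)%:E +
  (4%:E * (2 * chi * sg / rate c m f g ^+ 2 / n%:R)%:E + 4%:E * (2 * V c chi Psi f g n k)%:E))))%E).
  apply: leeD => //; apply: leeD; first exact: (lee_wpmul2l _ h1).
  apply: leeD; first exact: (lee_wpmul2l _ h2).
  by apply: leeD => //; exact: (lee_wpmul2l _ h3).
rewrite -!EFinM -!EFinD lee_fin /a.
(* The coefficient of [v] is [2 / 3 + 4 * 2], the last factor coming from the mean of [Vhat]; it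
   stays below 16, the coefficient of the squared bias. *)
have gen (x v i p q r : R) : 0 <= x -> 0 <= v ->
    16 * x + 2 / 3 * v + (56 * (p * i) + (56 * (q * i) + (4 * (r * i) + 4 * (2 * v)))) <=
    16 * (x + v) + (56 * (p + q) + 4 * r) * i by move=> *; lra.
by apply: gen => //; exact: sqr_ge0.
Qed.

End Risk.

Theorem theorem2p9 (R : realType) :
  exists C1 : R, 0 < C1 /\
  forall (c chi : R) (Psi : R -> R[i]) (g : R -> R) (m s : R),
    72 <= chi ->
    is_density g ->
    in_Lp 1 (c - 1) g ->
    (forall t, mellin c g t != 0) ->
    (wsup c g < +oo)%E ->
    cmeasurable setT Psi ->
    (forall t, (Psi t)^* = Psi (- t)) ->
    (forall k : R, 0 < k ->
       cintegrable `[- k, k] (fun t => Psi t / mellin c g t)) ->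
  exists C2 : R, 0 < C2 /\
  forall (f : R -> R) (n Kn : nat)
    (d : measure_display) (T : measurableType d) (P : probability T R)
    (Y : 'I_n -> {RV P >-> R}) (khat : {RV P >-> nat}),
    is_density f ->
    in_Lp 1 (c - 1) f ->
    in_Lp 2 (2 * c - 1) f ->
    cintegrable setT (fun t => Psi t * mellin c f t) ->
    (moment_Y (8 * (c - 1)) f g = m%:E)%E ->
    sigma c f = s ->
    (2 <= n)%N ->
    index_set c Psi g n Kn ->
    (forall k, index_set c Psi g n k -> (k <= Kn)%N) ->
    iid_with_density Y (dens_Y f g) ->
    (forall w, is_argmin (fun j => Y j w) c chi Psi g Kn (khat w)) ->
    ('E_P[fun w => (Normc.normc (theta c Psi f -
        theta_hat (fun j => Y j w) c Psi g (khat w)%:R) ^+ 2)%R]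
     <= C1%:E * ereal_inf [set (tail_norm c Psi f k%:R ^+ 2
                                + (V c chi Psi f g n k)%:E)%E
                          | k in index_set c Psi g n]
        + (C2 / n%:R)%:E)%E.
Proof.
exists 16; split => // c chi Psi g m s chi72 dg Lg g_neq0 wlt mPsi conjPsi _.
(* These are [remainder_cst] and [rate] with [s] in place of [sigma c f], so that the constant is
   fixed before [f] and [n]. *)
pose be := 2 * pi * fine (wsup c g) * s / 27.
pose cr := 64 * m / (pi * fine (wsup c g) * be ^+ 3) +
  2048 * m ^+ 2 / (pi * fine (wsup c g) * be ^+ 7).
pose r := s ^+ 2 / (16 * ((1 + m) / fine (moment (2 * (c - 1)) g) ^+ 2)).
pose C := 56 * (56 * s + cr) + 4 * (2 * chi * s / r ^+ 2).
(* At this point [m] and [s] are arbitrary reals, so the sign of [C] is unknown; the absolute value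
   and the 1 secure positivity. *)
exists (1 + `|C|); split; first by rewrite ltr_wpDr.
move=> f n Kn d T P Y khat df Lf _ iPf mY sE n2 KKn Kmax iidY argminP.
have n0 : 0 < n%:R :> R by rewrite ltr0n (leq_trans _ n2).
have risk k (Kk : index_set c Psi g n k) := risk_le chi72 df dg Lf Lg g_neq0 wlt mPsi
  conjPsi iPf mY n2 KKn Kmax iidY argminP Kk.
(* Isolating the infimum reduces the claim to the bound at each single index. *)
rewrite unlock -leeBlDr// -lee_pdivrMl//; apply: le_ereal_inf_tmp => _ [k Kk <-].
rewrite lee_pdivrMl// leeBlDr//; apply: le_trans (risk k Kk) _.
rewrite -(fineK (tail_fin mPsi Lf iPf k%:R)) -EFin_expe -EFinD lee_fin lerD2l.
rewrite ler_wpM2r ?invr_ge0 ?(ltW n0)//.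
rewrite /remainder_cst /rate sE -/be -/cr -/r -/C.
by rewrite (le_trans (ler_norm C))// lerDr.
Qed.
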